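(* Let $N\ge2$, $p>N$ and $R>0$. For each $q\ge1$ let $w_q=w_q(|x|)$ denote the positive extremal function of $\lambda_q(B_R)$. Then $$\lim_{q\to\infty}w_q(|x|)=1-\left(\frac{|x|}{R}\right)^{\frac{p-N}{p-1}},$$ strongly in $C(\overline{B_R})$ and also strongly in $W_0^{1,p}(B_R)$. Moreover, this convergence holds in $C^1(\overline{B_{\epsilon,R}})$ for each $\epsilon\in(0,R)$, where $B_{\epsilon,R}:=\{x\in\mathbb{R}^N:\epsilon<|x|<R\}$.
   Context: $B_R$ is the ball of $\mathbb{R}^N$ of radius $R$ centered at the origin. $\|\cdot\|_s$ denotes the norm of $L^s(B_R)$. For $q\ge1$, $\lambda_q(B_R):=\inf\{\|\nabla u\|_p^p: u\in W_0^{1,p}(B_R),\ \|u\|_q=1\}$. A positive extremal function of $\lambda_q(B_R)$ is a function $w_q\in W_0^{1,p}(B_R)$ with $w_q>0$ in $B_R$, $\|w_q\|_q=1$ and $\|\nabla w_q\|_p^p=\lambda_q(B_R)$; on a ball such functions are radial, so one writes $w_q(|x|)$. *)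

(* Defs.v *)
(* MathComp-Analysis. Points of R^N are row vectors 'rV[R]_N. The library's
   norm on 'rV[R]_N is the sup norm, so the Euclidean norm is defined here; the
   two norms induce the same topology, so closures, continuity and uniform
   convergence are taken from the library. *)
From HB Require Import structures.
From mathcomp Require Import all_boot all_order all_algebra.
From mathcomp Require Import all_classical all_reals all_analysis.
Set Implicit Arguments.
Unset Strict Implicit.
Unset Printing Implicit Defensive.
Import Order.TTheory GRing.Theory Num.Theory.
Import numFieldNormedType.Exports.
Local Open Scope classical_set_scope.
Local Open Scope ring_scope.

Definition rV_display : measure_display.
Proof. exact: default_measure_display. Qed.

Section measurable_rV.
Context {R : realType} {n : nat}.

Definition coord_rV (i : 'I_n) (v : 'rV[R]_n) : measurableTypeR R := v ord0 i.

Let rV_set0 : g_sigma_preimage coord_rV set0.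
Proof. exact: sigma_algebra0. Qed.

Let rV_setC A : g_sigma_preimage coord_rV A -> g_sigma_preimage coord_rV (~` A).
Proof. exact: sigma_algebraC. Qed.

Let rV_bigcup (F : _^nat) : (forall i, g_sigma_preimage coord_rV (F i)) ->
  g_sigma_preimage coord_rV (\bigcup_i (F i)).
Proof. exact: sigma_algebra_bigcup. Qed.

(* The product sigma-algebra, which is the Borel sigma-algebra of R^n. *)
HB.instance Definition _ := @isMeasurable.Build rV_display
  'rV[R]_n (g_sigma_preimage coord_rV) rV_set0 rV_setC rV_bigcup.

Lemma measurable_coord_rV (i : 'I_n) :
  measurable_fun [set: 'rV[R]_n] (coord_rV i).
Proof.
move=> _ Y mY; rewrite setTI; apply: sub_sigma_algebra => /=.
rewrite -bigcup_seq/=; exists i => /=; first by rewrite mem_index_enum.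
by exists Y => //; rewrite setTI.
Qed.

Lemma measurable_fun_rVP d (T : measurableType d) (f : T -> 'rV[R]_n) :
  measurable_fun [set: T] f <->
  forall i, measurable_fun [set: T] (coord_rV i \o f).
Proof.
split=> [mf i|mf]; first exact: measurableT_comp (measurable_coord_rV i) mf.
apply: (@iffRL _ (g_sigma_preimage (fun i => coord_rV i \o f) `<=` measurable)).
  rewrite g_sigma_preimage_comp; split=> [mf' A [/= C preC <-]|prefS].
    exact: mf'.
  by move=> _ A mA; apply: prefS; exists A.
apply: smallest_sub; first exact: sigma_algebra_measurable.
move=> A; rewrite -bigcup_seq => -[i _ [B mB <-]].
exact: mf.
Qed.

End measurable_rV.

Section lebesgue_rV.
Context {R : realType}.

Definition cons_rV n (z : measurableTypeR R * 'rV[R]_n) : 'rV[R]_n.+1 :=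
  \row_i oapp (z.2 ord0) z.1 (unlift ord0 i).

Definition uncons_rV n (v : 'rV[R]_n.+1) : measurableTypeR R * 'rV[R]_n :=
  (v ord0 ord0, \row_i v ord0 (lift ord0 i)).

Lemma cons_rVK n : cancel (@cons_rV n) (@uncons_rV n).
Proof.
move=> [x v]; congr (_, _) => /=; first by rewrite mxE unlift_none.
by apply/rowP => i; rewrite !mxE liftK.
Qed.

Lemma measurable_cons_rV n : measurable_fun setT (@cons_rV n).
Proof.
apply/measurable_fun_rVP => i.
have [j ->|->] := unliftP ord0 i.
  rewrite (_ : _ \o _ = coord_rV j \o snd).
    exact: measurableT_comp (measurable_coord_rV j) measurable_snd.
  by apply/funext => z; rewrite /coord_rV /= mxE liftK.
rewrite (_ : _ \o _ = fst); first exact: measurable_fst.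
by apply/funext => z; rewrite /coord_rV /= mxE unlift_none.
Qed.

Lemma measurable_uncons_rV n : measurable_fun setT (@uncons_rV n).
Proof.
apply/measurable_fun_pairP; split; first exact: measurable_coord_rV ord0.
apply/measurable_fun_rVP => i.
rewrite (_ : _ \o _ = coord_rV (lift ord0 i)); first exact: measurable_coord_rV.
by apply/funext => v; rewrite /coord_rV /= mxE.
Qed.

Section step.
Variables (n : nat) (mu : {sigma_finite_measure set 'rV[R]_n -> \bar R}).

Definition lebesgue_cons : set 'rV[R]_n.+1 -> \bar R :=
  pushforward (lebesgue_measure \x mu)%E (@cons_rV n).

Let pushforward_cons : {measure set 'rV[R]_n.+1 -> \bar R} :=
  measure_function_pushforward__canonical__measure_function_Measure
    (lebesgue_measure \x mu)%E (@measurable_cons_rV n).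

Let lebesgue_cons0 : lebesgue_cons set0 = 0%E.
Proof. exact: (measure0 pushforward_cons). Qed.

Let lebesgue_cons_ge0 A : (0 <= lebesgue_cons A)%E.
Proof. exact: (measure_ge0 pushforward_cons). Qed.

Let lebesgue_cons_sigma_additive : semi_sigma_additive lebesgue_cons.
Proof. exact: (@measure_semi_sigma_additive _ _ _ pushforward_cons). Qed.

HB.instance Definition _ := isMeasure.Build _ _ _ lebesgue_cons
  lebesgue_cons0 lebesgue_cons_ge0 lebesgue_cons_sigma_additive.

Let lebesgue_cons_sigma_finite : sigma_finite setT lebesgue_cons.
Proof.
have /sigma_finiteP[F [UF ndF Foo]] :=
  sigma_finiteT (@lebesgue_measure R : {sigma_finite_measure set _ -> \bar R}).
have /sigma_finiteP[G [UG ndG Goo]] := sigma_finiteT mu.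
exists (fun k => @uncons_rV n @^-1` (F k `*` G k)).
  rewrite -preimage_bigcup (_ : \bigcup_i _ = setT) ?preimage_setT//.
  apply/seteqP; split=> // -[x v] _.
  have [k _ Fx] : (\bigcup_i F i) x by rewrite -UF.
  have [l _ Gv] : (\bigcup_i G i) v by rewrite -UG.
  exists (maxn k l) => //; split.
    by move: x Fx; exact/subsetPset/ndF/leq_maxl.
  by move: v Gv; exact/subsetPset/ndG/leq_maxr.
move=> k; have [mF Fk] := Foo k; have [mG Gk] := Goo k; split.
  rewrite -[X in measurable X]setTI; apply: measurable_uncons_rV => //.
  exact: measurableX.
rewrite /lebesgue_cons /pushforward -comp_preimage.
rewrite (_ : _ \o _ = id); last by apply/funext => z /=; rewrite cons_rVK.
by rewrite preimage_id product_measure1E// lte_mul_pinfty// ge0_fin_numE.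
Qed.

HB.instance Definition _ := Measure_isSigmaFinite.Build _ _ _ lebesgue_cons
  lebesgue_cons_sigma_finite.

End step.

(* Lebesgue measure on R^n, as the n-fold product of the one on R. *)
Fixpoint lebesgue_rV n : {sigma_finite_measure set 'rV[R]_n -> \bar R} :=
  if n is m.+1 then lebesgue_cons (lebesgue_rV m) else \d_(0 : 'rV[R]_0).

Lemma measurable_box_rV n (A : 'I_n -> set (measurableTypeR R)) :
  (forall i, measurable (A i)) ->
  measurable [set v : 'rV[R]_n | forall i, A i (v ord0 i)].
Proof.
move=> mA; rewrite (_ : mkset _ = \bigcap_(i in [set: 'I_n])
    (coord_rV i @^-1` A i)).
  apply: fin_bigcap_measurable => // i _.
  by rewrite -[X in measurable X]setTI; exact: measurable_coord_rV.
by apply/seteqP; split=> v h i; [move=> _; exact: (h i)|exact: (h i I)].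
Qed.

Lemma lebesgue_rV_box n (A : 'I_n -> set (measurableTypeR R)) :
  (forall i, measurable (A i)) ->
  lebesgue_rV n [set v | forall i, A i (v ord0 i)] =
  (\prod_(i < n) lebesgue_measure (A i))%E.
Proof.
elim: n A => [|n IH] A mA.
  by rewrite big_ord0 /= diracE mem_set // => -[].
rewrite big_ord_recl -IH; last by move=> i; exact: mA.
have mB := @measurable_box_rV n (fun i => A (lift ord0 i)) (fun i => mA _).
rewrite -(product_measure1E _ _ (mA _) mB).
rewrite [LHS]/= /lebesgue_cons /pushforward.
congr (_ _); apply/seteqP; split=> -[x v] /= h.
  split=> [|i]; first by have := h ord0; rewrite mxE unlift_none.
  by have := h (lift ord0 i); rewrite mxE liftK.
move=> i; rewrite mxE; have [j ->|->] := unliftP ord0 i.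
  exact: h.2.
exact: h.1.
Qed.

End lebesgue_rV.

Section euclidean.
Context {R : realType} {N : nat}.
Implicit Types (x : 'rV[R]_N) (f : 'rV[R]_N -> R) (Omega : set 'rV[R]_N).

Definition enorm x : R := Num.sqrt (\sum_i x ord0 i ^+ 2).

Definition eball (r : R) : set 'rV[R]_N := [set x | enorm x < r].

Definition annulus (e r : R) : set 'rV[R]_N := [set x | e < enorm x < r].

Definition pderiv (i : 'I_N) f : 'rV[R]_N -> R := 'D_(delta_mx ord0 i) f.

Definition grad f x : 'rV[R]_N := \row_i pderiv i f x.

Fixpoint Ck (k : nat) f : Prop :=
  if k is j.+1 then
    [/\ continuous f, forall i x, derivable f x (delta_mx ord0 i)
      & forall i, Ck j (pderiv i f)]
  else continuous f.

(* C_c^infinity(Omega) *)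
Definition test_function Omega f : Prop :=
  [/\ forall k, Ck k f, compact (closure [set x | f x != 0])
    & closure [set x | f x != 0] `<=` Omega].

(* C^1(closure Omega) for Omega open: Df is the continuous extension to the
   closure of the classical gradient of f in Omega. *)
Definition C1_closure Omega f (Df : 'rV[R]_N -> 'rV[R]_N) : Prop :=
  [/\ forall x, Omega x -> differentiable f x /\ grad f x = Df x,
      {within closure Omega, continuous f}
    & {within closure Omega, continuous Df}].

End euclidean.

Section sobolev.
Context {R : realType} {N : nat}.
Implicit Types (Omega : set 'rV[R]_N) (p q : R) (u : 'rV[R]_N -> R)
  (G : 'rV[R]_N -> 'rV[R]_N).
Local Notation mu := (lebesgue_rV N).

Definition Lp_norm Omega p u : \bar R := 'N[mu]_(p%:E)[(EFin \o u) \_ Omega].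

Lemma Lp_normE Omega p u : 0 < p ->
  Lp_norm Omega p u = ((\int[mu]_(x in Omega) (`|u x| `^ p)%:E) `^ p^-1)%E.
Proof.
move=> p0; rewrite /Lp_norm unlock; congr (_ `^ _)%E.
rewrite [RHS]integral_mkcond; apply: eq_integral => x _; rewrite !patchE.
by case: ifP => //= _; rewrite /point /= normr0 powR0 // gt_eqF.
Qed.

(* Norm in L^p(Omega; R^N), for the Euclidean norm on R^N. *)
Definition Lp_vnorm Omega p G : \bar R := Lp_norm Omega p (enorm \o G).

Definition weak_gradient Omega u G : Prop :=
  forall phi, test_function Omega phi -> forall i : 'I_N,
  \int[mu]_(x in Omega) (u x * pderiv i phi x) =
  - \int[mu]_(x in Omega) (G x ord0 i * phi x).

(* u is in W^{1,p}(Omega), with weak gradient G. *)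
Definition W1p Omega p u G : Prop :=
  [/\ measurable_fun Omega u /\ (Lp_norm Omega p u < +oo)%E,
      forall i, measurable_fun Omega (fun x => G x ord0 i),
      (Lp_vnorm Omega p G < +oo)%E
    & weak_gradient Omega u G].

(* u is in W_0^{1,p}(Omega), the closure of C_c^infinity(Omega) in
   W^{1,p}(Omega), with weak gradient G. *)
Definition W01p Omega p u G : Prop :=
  W1p Omega p u G /\
  exists phi : nat -> 'rV[R]_N -> R,
  [/\ forall n, test_function Omega (phi n),
      Lp_norm Omega p (phi n \- u) @[n --> \oo] --> 0%E
    & Lp_vnorm Omega p (grad (phi n) \- G) @[n --> \oo] --> 0%E].

(* lambda_q(Omega) *)
Definition lambda Omega p q : \bar R :=
  ereal_inf [set (Lp_vnorm Omega p uG.2 `^ p)%E | uG in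
    [set uG : ('rV[R]_N -> R) * ('rV[R]_N -> 'rV[R]_N) |
      W01p Omega p uG.1 uG.2 /\ Lp_norm Omega q uG.1 = 1%E]].

Definition positive_extremal Omega p q u : Prop :=
  [/\ forall x, Omega x -> 0 < u x, Lp_norm Omega q u = 1%E
    & exists2 G, W01p Omega p u G &
        (Lp_vnorm Omega p G `^ p)%E = lambda Omega p q].

(* v is a representative, continuous on the closure of Omega, of the almost
   everywhere class of u on Omega. *)
Definition continuous_rep Omega u v : Prop :=
  {within closure Omega, continuous v} /\ {ae mu, forall x, Omega x -> v x = u x}.

(* Below, u is a family of functions u q indexed by the real numbers q >= 1, and
   the convergences are as q tends to +oo. *)

Definition cvg_C Omega (u : R -> 'rV[R]_N -> R) (U : 'rV[R]_N -> R) : Prop :=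
  [/\ forall q, 1 <= q -> {within closure Omega, continuous (u q)},
      {within closure Omega, continuous U}
    & {uniform closure Omega, u @ +oo_R --> U}].

Definition cvg_W01p Omega p (u : R -> 'rV[R]_N -> R) (U : 'rV[R]_N -> R) :
    Prop :=
  exists (G : R -> 'rV[R]_N -> 'rV[R]_N) (DU : 'rV[R]_N -> 'rV[R]_N),
  [/\ forall q, 1 <= q -> W01p Omega p (u q) (G q),
      W01p Omega p U DU,
      Lp_norm Omega p (u q \- U) @[q --> +oo_R] --> 0%E
    & Lp_vnorm Omega p (G q \- DU) @[q --> +oo_R] --> 0%E].

Definition cvg_C1 Omega (u : R -> 'rV[R]_N -> R) (U : 'rV[R]_N -> R) : Prop :=
  exists (Du : R -> 'rV[R]_N -> 'rV[R]_N) (DU : 'rV[R]_N -> 'rV[R]_N),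
  [/\ forall q, 1 <= q -> C1_closure Omega (u q) (Du q),
      C1_closure Omega U DU,
      {uniform closure Omega, u @ +oo_R --> U}
    & {uniform closure Omega, Du @ +oo_R --> DU}].

End sobolev.

(* Main.v *)
(** Write alpha = (p - N) / (p - 1), T = r^alpha, and let u be the extremal
    function for the exponent q, with eigenvalue lam = lambda_q.

    Since f = lam u^(q-1) is radial, the divergence equation for f can be solved
    by integration along rays: the radial function
      z(x) = P(T) - P(|x|^alpha),  P' = m,
    with m a continuous nondecreasing function built from the mass of f in the
    balls centred at 0, is a weak solution of the p-Laplace equation with right
    hand side f.  By Hoelder and the definition of lam, z has p-energy at most
    lam, and then the convexity gap between the gradients of u and z has integral
    at most 0.  So u = z almost everywhere, without any Euler-Lagrange equation
    or regularity theory for u.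

    The claimed limit is the profile with constant slope 1 / T.  Bounding lam
    from above with this profile as a competitor gives limsup m_q(T) <= 1 / T,
    while the normalisation of u gives liminf z_q(0) >= 1, where z_q(0) is the
    integral of m_q over [0, T].  As m_q is nondecreasing, it converges to 1 / T
    uniformly on [e, T] for every e > 0, and all three convergences follow. *)
Require Import Defs.
From HB Require Import structures.
From mathcomp Require Import all_boot all_order all_algebra.
From mathcomp Require Import all_classical all_reals all_analysis.
From mathcomp Require Import measurable_realfun.
From mathcomp Require Import ring lra.
Set Implicit Arguments.
Unset Strict Implicit.
Unset Printing Implicit Defensive.
Import Order.TTheory GRing.Theory Num.Theory.
Import numFieldNormedType.Exports.
Local Open Scope classical_set_scope.
Local Open Scope ring_scope.

(** * Lebesgue measure on R^n and dilations *)

Section tonelli.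
Context {R : realType}.
Local Notation leb := (@lebesgue_measure R).
Local Open Scope ereal_scope.

(** Since (alpha - 1)(p - 1) = 1 - n, a profile of slope m >= 0 in t = |x|^alpha has p-flux -(alpha
    m)^(p - 1) |x|^(-n) x. The divergence equation thus gives m pointwise as a power 1/(p - 1) of a
    mass, and m inherits the monotonicity of the mass. The condition p > n gives alpha > 0, so the
    profile is continuous at 0.

    The weak equation comes from Tonelli in the dilations x = s^(1/n) y, 0 < s < 1: along each ray a
    test function is an integral of its radial derivative.

    Testing with u and z themselves needs approximants that also converge in L^q; there lam > 0 acts
    as the Sobolev constant. Testing with u, the flux of z against grad u has integral lam. Testing
    with z, the energy a of z satisfies a <= lam (a / lam)^(1/p), so a <= lam. The gap then has
    integral lam / p + (1 - 1/p) a - lam <= 0.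

    The gradient of z may be unbounded near 0, of order |x|^(alpha - 1), so z is not a smooth
    function; it is placed in W_0^{1,p} by smooth radial approximants with a uniform integrable
    majorant. *)

Lemma ge0_integral_lebesgue_rVS n (F : 'rV[R]_n.+1 -> \bar R) :
  measurable_fun [set: _] F -> (forall x, 0 <= F x) ->
  \int[lebesgue_rV n.+1]_x F x =
  \int[leb]_t \int[lebesgue_rV n]_v F (cons_rV (t, v)).
Proof.
move=> mF F0.
transitivity (\int[pushforward (leb \x lebesgue_rV n) (@cons_rV R n)]_x F x).
  by [].
rewrite ge0_integral_pushforward//; last exact: measurable_cons_rV.
rewrite preimage_setT fubini_tonelli1//.
  by apply: measurableT_comp => //; exact: measurable_cons_rV.
by move=> x; exact: F0.
Qed.

Lemma measurable_affine1 (c b : R) :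
  measurable_fun setT (fun t : measurableTypeR R => (c * t + b)%R : measurableTypeR R).
Proof. by apply: measurable_funD => //; exact: measurable_funM. Qed.

(** Both sides are measures in A, and they agree on the intervals ]x, y], which determine Lebesgue
    measure. *)
Lemma lebesgue_affine1 (c b : R) A : (0 < c)%R -> measurable A ->
  leb A = c%:E * leb ((fun t => c * t + b)%R @^-1` A).
Proof.
move=> c0 mA.
pose f t : measurableTypeR R := (c * t + b)%R.
pose m1 := measure_function_pushforward__canonical__measure_function_Measure
  leb (measurable_affine1 c b).
have c0' : (0 <= c)%R by exact: ltW.
pose m2 := mscale (NngNum c0') m1.
rewrite -[RHS]/(m2 A).
apply: lebesgue_measure_unique => // X [[x y] _ <-].
transitivity (c%:E * leb (f @^-1` `]x, y])); last by [].
rewrite (_ : _ @^-1` _ = `]((x - b) / c)%R, ((y - b) / c)%R]%classic); last first.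
  by apply/seteqP; split => t /=; rewrite !in_itv/= ltr_pdivrMr// ler_pdivlMr//;
    rewrite ltrBlDr lerBrDr [(t * c)%R]mulrC.
rewrite !lebesgue_measure_itv/= !lte_fin ltr_pM2r ?invr_gt0// ltrD2r.
case: ifPn => xy; last by rewrite mule0.
rewrite -!EFinD -EFinM; congr EFin; field; exact: lt0r_neq0.
Qed.

Lemma ge0_integral_affine1 (c b : R) (F : measurableTypeR R -> \bar R) : (0 < c)%R ->
  measurable_fun [set: _] F -> (forall x, 0 <= F x) ->
  \int[leb]_t F t = c%:E * \int[leb]_t F (c * t + b)%R.
Proof.
move=> c0 mF F0.
pose m1 := measure_function_pushforward__canonical__measure_function_Measure
  leb (measurable_affine1 c b).
have c0' : (0 <= c)%R by exact: ltW.
pose m2 := mscale (NngNum c0') m1.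
transitivity (\int[m2]_t F t).
  apply: eq_measure_integral => A mA _; exact: lebesgue_affine1.
rewrite ge0_integral_mscale//=; congr (_ * _).
by rewrite ge0_integral_pushforward//; exact: measurable_affine1.
Qed.

Lemma measurable_affine n (c : R) (b : 'rV[R]_n) :
  measurable_fun setT (fun x : 'rV[R]_n => c *: x + b)%R.
Proof.
apply/measurable_fun_rVP => i.
rewrite (_ : _ \o _ = (fun t => c * t + b ord0 i)%R \o coord_rV i).
  exact: measurableT_comp (measurable_affine1 _ _) (measurable_coord_rV i).
by apply/funext => x; rewrite /coord_rV /= !mxE.
Qed.

(** Each coordinate contributes one factor c: the induction peels off the first coordinate by
    Tonelli and rescales it with the one-dimensional formula. *)
Lemma ge0_integral_affine n (c : R) (b : 'rV[R]_n) (F : 'rV[R]_n -> \bar R) :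
  (0 < c)%R -> measurable_fun [set: _] F -> (forall x, 0 <= F x) ->
  \int[lebesgue_rV n]_x F x =
  (c ^+ n)%:E * \int[lebesgue_rV n]_x F (c *: x + b)%R.
Proof.
elim: n b F => [|n IH] b F c0 mF F0.
  rewrite expr0 mul1e; apply: eq_integral => x _.
  by rewrite [(_ + _)%R]thinmx0 [x]thinmx0.
have mFa : measurable_fun setT (fun x : 'rV[R]_n.+1 => F (c *: x + b)%R).
  by apply: measurableT_comp => //; exact: measurable_affine.
rewrite !ge0_integral_lebesgue_rVS//.
pose b' : 'rV[R]_n := (\row_i b ord0 (lift ord0 i))%R.
have mFc : measurable_fun setT (F \o @cons_rV R n).
  by apply: measurableT_comp => //; exact: measurable_cons_rV.
under eq_integral => t _.
  rewrite (IH b' (fun v => F (cons_rV (t, v))))//; last first.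
    by apply: (measurableT_comp mFc); exact: measurable_pair1.
  over.
have mG : measurable_fun setT (fun t => \int[lebesgue_rV n]_x F (cons_rV (t, (c *: x + b')%R))).
  pose g (z : measurableTypeR R * 'rV[R]_n) := (z.1, c *: z.2 + b')%R.
  have mg : measurable_fun setT g.
    apply/measurable_fun_pairP; split; first exact: measurable_fst.
    by apply: measurableT_comp (measurable_affine c b') _; exact: measurable_snd.
  apply: (@measurable_fun_fubini_tonelli_F _ _ _ _ _ (lebesgue_rV n) (F \o @cons_rV R n \o g)) => //.
    exact: measurableT_comp.
  by move=> x; exact: F0.
rewrite ge0_integralZl; [|exact: measurableT|exact: mG| |]; last 2 first.
- by move=> t _; exact: integral_ge0.
- by rewrite lee_fin exprn_ge0// ltW.
rewrite [X in _ * X = _](@ge0_integral_affine1 c (b ord0 ord0))//; last first.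
  by move=> t; exact: integral_ge0.
rewrite muleA -EFinM -exprSr; congr (_ * _).
apply: eq_integral => t _; apply: eq_integral => v _; congr F.
apply/rowP => i; rewrite !mxE.
by have [j ->|->] := unliftP ord0 i; rewrite ?liftK ?unlift_none/= ?mxE.
Qed.

End tonelli.

(** * The Euclidean norm *)

Section topology_rV.
Context {R : realType} {n : nat}.
Implicit Types (x y : 'rV[R]_n).

(** The sigma-algebra is generated by the coordinates, so an open set is exhibited as a countable
    union of boxes, with rational centre and half-side 1 / (k + 1), enumerated by [pickle]. *)
Lemma open_measurable_rV (O : set 'rV[R]_n) : open O -> measurable O.
Proof.
move=> oO.
pose box (qk : 'rV[rat]_n * nat) : set 'rV[R]_n :=
  [set v | forall i, `](ratr (qk.1 ord0 i) - qk.2.+1%:R^-1),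
                        (ratr (qk.1 ord0 i) + qk.2.+1%:R^-1)[%classic (v ord0 i)].
pose F (m : nat) : set 'rV[R]_n :=
  if unpickle m is Some qk then if `[< box qk `<=` O >] then box qk else set0
  else set0.
have -> : O = \bigcup_m F m.
  apply/seteqP; split => [x Ox|x [m _]]; last first.
    rewrite /F; case: unpickle => // qk; case: asboolP => //; exact.
  have /nbhs_ballP[e /= e0 eO] := open_nbhs_nbhs (conj oO Ox).
  (* Two points of a box of half-side 1 / (k + 1) differ by less than twice that in each coordinate,
     hence e / 2. *)
  have [k ke] : exists k, k.+1%:R^-1 < e / 2.
    have := near_infty_natSinv_lt (PosNum (divr_gt0 e0 (ltr0n _ 2))).
    by move=> [k _ /(_ _ (leqnn _))] /=; exists k.
  have k0 : 0 < k.+1%:R^-1 :> R by rewrite invr_gt0 ltr0n.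
  have /choice[q qx] : forall i : 'I_n, exists q : rat,
      ratr q \in `](x ord0 i - k.+1%:R^-1), (x ord0 i + k.+1%:R^-1)[.
    move=> i; have [|q qi] := @rat_in_itvoo _ (x ord0 i - k.+1%:R^-1) (x ord0 i + k.+1%:R^-1).
      by rewrite ltrBlDr -addrA ltrDl addr_gt0.
    by exists q.
  pose qk := (\row_i q i, k) : 'rV[rat]_n * nat.
  have bx : box qk x.
    move=> i /=; have := qx i; rewrite !in_itv/= mxE => /andP[a1 a2].
    by rewrite ltrBlDr a2 -ltrBlDr a1.
  have bO : box qk `<=` O.
    move=> y yb; apply: eO; split => // a i; rewrite (ord1 a).
    have := yb i; have := bx i; rewrite /= !in_itv/= mxE => /andP[a1 a2] /andP[a3 a4].
    rewrite /ball /= ltr_norml; move: a1 a2 a3 a4 ke.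
    move: (k.+1%:R^-1) (ratr _) (x ord0 i) (y ord0 i) => d c X Y *; apply/andP; split; lra.
  exists (pickle qk) => //; rewrite /F pickleK; case: asboolP => //.
apply: bigcup_measurable => m _; rewrite /F; case: unpickle => // qk.
by case: asboolP => // _; apply: (@measurable_box_rV R n (fun i => `](ratr (qk.1 ord0 i) - qk.2.+1%:R^-1),
  (ratr (qk.1 ord0 i) + qk.2.+1%:R^-1)[%classic)) => i; exact: measurable_itv.
Qed.

Lemma continuous_measurable_rV (f : 'rV[R]_n -> R) :
  continuous f -> measurable_fun setT f.
Proof.
move=> /continuousP cf; apply: (measurability _ (RGenOpens.measurableE R)).
move=> _ [_ [a [b ->] <-]]; rewrite setTI.
by apply: open_measurable_rV; exact/cf/interval_open.
Qed.

End topology_rV.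

Lemma cvg_bigsum (R : realType) (T : Type) (F : set_system T) (I : finType)
    (f : I -> T -> R) (a : I -> R) {FF : Filter F} :
  (forall i, f i x @[x --> F] --> a i) ->
  (\sum_i f i x) @[x --> F] --> \sum_i a i.
Proof.
move=> fa; apply: cvg_big => //; exact: add_continuous.
Qed.

Section euclidean_norm.
Context {R : realType} {n : nat}.
Implicit Types (x y : 'rV[R]_n).

Definition dotr x y : R := \sum_i x ord0 i * y ord0 i.

Lemma enorm_ge0 x : 0 <= enorm x. Proof. exact: sqrtr_ge0. Qed.

Lemma sqr_enorm x : enorm x ^+ 2 = dotr x x.
Proof.
rewrite sqr_sqrtr; last by apply: sumr_ge0 => i _; exact: sqr_ge0.
by apply: eq_bigr => i _; rewrite expr2.
Qed.

Lemma enormZ (c : R) x : enorm (c *: x) = `|c| * enorm x.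
Proof.
rewrite /enorm -sqrtr_sqr -sqrtrM ?sqr_ge0// mulr_sumr; congr Num.sqrt.
by apply: eq_bigr => i _; rewrite mxE exprMn.
Qed.

Lemma enorm0 : enorm (0 : 'rV[R]_n) = 0.
Proof. by rewrite -(scale0r 0) enormZ normr0 mul0r. Qed.

Lemma enormN x : enorm (- x) = enorm x.
Proof. by rewrite -scaleN1r enormZ normrN1 mul1r. Qed.

Lemma coord_le_enorm x i : `|x ord0 i| <= enorm x.
Proof.
rewrite -sqrtr_sqr ler_wsqrtr// (bigD1 i)//= lerDl.
by apply: sumr_ge0 => j _; exact: sqr_ge0.
Qed.

Lemma enorm_eq0 x : (enorm x == 0) = (x == 0).
Proof.
apply/eqP/eqP => [x0|->]; last exact: enorm0.
apply/rowP => i; rewrite mxE; apply/eqP; rewrite -normr_le0 -x0.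
exact: coord_le_enorm.
Qed.

Lemma enorm_gt0 x : (0 < enorm x) = (x != 0).
Proof. by rewrite lt0r enorm_ge0 andbT enorm_eq0. Qed.

Lemma dotrC x y : dotr x y = dotr y x.
Proof. by apply: eq_bigr => i _; rewrite mulrC. Qed.

Lemma dotrDl x y z : dotr (x + y) z = dotr x z + dotr y z.
Proof. by rewrite -big_split; apply: eq_bigr => i _ /=; rewrite mxE mulrDl. Qed.

Lemma dotrZl c x y : dotr (c *: x) y = c * dotr x y.
Proof. by rewrite mulr_sumr; apply: eq_bigr => i _; rewrite mxE mulrA. Qed.

Lemma dotrZr c x y : dotr x (c *: y) = c * dotr x y.
Proof. by rewrite dotrC dotrZl dotrC. Qed.

Lemma dotrDr x y z : dotr z (x + y) = dotr z x + dotr z y.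
Proof. by rewrite dotrC dotrDl !(dotrC z). Qed.

Lemma sqr_enormD x y :
  enorm (x + y) ^+ 2 = enorm x ^+ 2 + 2 * dotr x y + enorm y ^+ 2.
Proof.
rewrite !sqr_enorm dotrDl !dotrDr (dotrC y x); ring.
Qed.

(** The square of | |y| x - |x| y | is nonnegative; expand it and divide by |x| |y|. *)
Lemma dotr_le_enorm x y : dotr x y <= enorm x * enorm y.
Proof.
have [->|x0] := eqVneq x 0.
  by rewrite -(scale0r 0) dotrZl enormZ normr0 !mul0r.
have [->|y0] := eqVneq y 0.
  by rewrite -(scale0r 0) dotrZr enormZ normr0 !mul0r mulr0.
have X : 0 < enorm x * enorm y by rewrite mulr_gt0// enorm_gt0.
have := sqr_ge0 (enorm (enorm y *: x + (- enorm x) *: y)).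
rewrite sqr_enormD dotrZl dotrZr !enormZ normrN !ger0_norm ?enorm_ge0// => H.
rewrite -(ler_pM2l X); nra.
Qed.

Lemma norm_dotr_le_enorm x y : `|dotr x y| <= enorm x * enorm y.
Proof.
rewrite ler_norml dotr_le_enorm andbT lerNl -enormN; apply: le_trans (dotr_le_enorm _ _).
by rewrite -[in leRHS]scaleN1r dotrZl mulN1r.
Qed.

Lemma enormD x y : enorm (x + y) <= enorm x + enorm y.
Proof.
rewrite -ler_sqr ?nnegrE ?addr_ge0 ?enorm_ge0// sqr_enormD.
have := dotr_le_enorm x y; nra.
Qed.

Lemma continuous_dotr : continuous (fun x => dotr x x).
Proof.
move=> x; rewrite /dotr; apply: (@cvg_bigsum _ _ (nbhs x)) => i.
by apply: cvgM; exact: coord_continuous.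
Qed.

Lemma enormE x : enorm x = Num.sqrt (dotr x x).
Proof. by rewrite -sqr_enorm sqrtr_sqr ger0_norm// enorm_ge0. Qed.

Lemma continuous_enorm : continuous (@enorm R n).
Proof.
move=> x; rewrite (_ : enorm = Num.sqrt \o (fun x => dotr x x)).
  by apply: continuous_comp; [exact: continuous_dotr|exact: sqrt_continuous].
by apply/funext => y; rewrite /= enormE.
Qed.

Lemma measurable_enorm : measurable_fun setT (@enorm R n).
Proof. by apply: continuous_measurable_rV; exact: continuous_enorm. Qed.

Lemma open_eball (s : R) : open (@eball R n s).
Proof.
rewrite (_ : eball s = enorm @^-1` `]-oo, s[%classic).
  by apply: open_comp; [move=> x _; exact: continuous_enorm|exact: interval_open].
by apply/seteqP; split => x; rewrite /eball /= in_itv/=.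
Qed.

Lemma measurable_eball (s : R) : measurable (@eball R n s).
Proof. by apply: open_measurable_rV; exact: open_eball. Qed.

Lemma closure_eball (s : R) x : closure (@eball R n s) x -> enorm x <= s.
Proof.
move=> cx; suff : [set x : 'rV[R]_n | enorm x <= s] x by [].
have clo : closed [set x : 'rV[R]_n | enorm x <= s].
  rewrite (_ : mkset _ = enorm @^-1` `]-oo, s]%classic).
    apply: preimage_closed; first by move=> z _; exact: continuous_enorm.
    exact: interval_closed.
  by apply/seteqP; split => z; rewrite /eball /= in_itv/=.
move/closure_id : clo => ->; move: x cx; apply: closureS => x /= /ltW//.
Qed.

Lemma closure_annulus (e s : R) x :
  closure (@annulus R n e s) x -> e <= enorm x <= s.
Proof.
move=> cx; suff : [set x : 'rV[R]_n | e <= enorm x <= s] x by [].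
have clo : closed [set x : 'rV[R]_n | e <= enorm x <= s].
  rewrite (_ : mkset _ = enorm @^-1` `[e, s]%classic).
    apply: preimage_closed; first by move=> z _; exact: continuous_enorm.
    exact: interval_closed.
  by apply/seteqP; split => z; rewrite /eball /= in_itv/=.
move/closure_id : clo => ->; move: x cx; apply: closureS => x /= /andP[/ltW ? /ltW ?].
by apply/andP.
Qed.

End euclidean_norm.

(** * Measure of balls and integrals of radial functions *)

Section ball_measure.
Context {R : realType} {n : nat}.
Local Notation mu := (@lebesgue_rV R n).
Local Open Scope ereal_scope.

Lemma mu_eball_scale (s r : R) : (0 < s)%R -> (0 < r)%R ->
  mu (eball s) = ((s / r) ^+ n)%:E * mu (eball r).
Proof.
move=> s0 r0.
have indE t : mu (eball t) = \int[mu]_x (\1_(@eball R n t) x)%:E.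
  by rewrite integral_indic ?setIT//; exact: measurable_eball.
rewrite (indE s) (@ge0_integral_affine _ _ (s / r)%R 0%R)//; last 2 first.
- by rewrite divr_gt0.
- by apply/measurable_EFinP; apply: measurable_indic; exact: measurable_eball.
rewrite indE; congr (_ * _); apply: eq_integral => x _.
rewrite addr0; congr (_%:E); rewrite !indicE; congr ((_ : bool)%:R)%R.
apply/idP/idP; rewrite !inE /eball/= enormZ ger0_norm ?divr_ge0 ?ltW//.
  by rewrite mulrAC ltr_pdivrMr// ltr_pM2l.
by rewrite mulrAC ltr_pdivrMr// ltr_pM2l.
Qed.

Lemma mu_eball_fin (r : R) : mu (eball r) < +oo.
Proof.
pose B : set 'rV[R]_n := [set v | forall i, `](- r)%R, r[%classic (v ord0 i)].
have mB : measurable B.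
  by apply: (@measurable_box_rV R n (fun=> `](- r)%R, r[%classic)) => i; exact: measurable_itv.
apply: (@le_lt_trans _ _ (mu B)).
  apply: le_measure; rewrite ?inE//; first exact: measurable_eball.
  move=> x /= xr i /=; rewrite in_itv/= -ltr_norml.
  by apply: le_lt_trans xr; exact: coord_le_enorm.
rewrite (@lebesgue_rV_box R n (fun=> `](- r)%R, r[%classic)); last first.
  by move=> i; exact: measurable_itv.
rewrite (eq_bigr (fun=> (fine (@lebesgue_measure R `](- r)%R, r[))%:E)); last first.
  move=> i _; rewrite fineK// lebesgue_measure_itv/=.
  by case: ifP => // _; rewrite -EFinD.
by rewrite prodEFin ltry.
Qed.

Lemma mu_eball_gt0 (r : R) : (0 < r)%R -> 0 < mu (eball r).
Proof.
(* The cube of half-side r / (n + 1) lies in the ball, because n / (n + 1)^2 < 1; the successor also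
   covers n = 0. *)
move=> r0; pose c := (r / n.+1%:R)%R.
have c0 : (0 < c)%R by rewrite divr_gt0.
pose B : set 'rV[R]_n := [set v | forall i, `](- c)%R, c[%classic (v ord0 i)].
have mB : measurable B.
  by apply: (@measurable_box_rV R n (fun=> `](- c)%R, c[%classic)) => i; exact: measurable_itv.
apply: (@lt_le_trans _ _ (mu B)); last first.
  apply: le_measure; rewrite ?inE//; first exact: measurable_eball.
  move=> x /= Bx; rewrite /eball/= -ltr_sqr ?nnegrE ?enorm_ge0 ?ltW// sqr_enorm.
  apply: (@le_lt_trans _ _ (\sum_(i < n) c ^+ 2)%R).
    apply: ler_sum => i _; have := Bx i; rewrite /= in_itv/= => /andP[*]; nra.
  rewrite sumr_const card_ord -mulr_natl /c exprMn mulrCA gtr_pMr ?exprn_gt0//.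
  rewrite exprVn ltr_pdivrMr ?exprn_gt0 ?ltr0n// mul1r -natrX ltr_nat.
  by rewrite expnS expn1 mulSn ltn_addr.
rewrite (@lebesgue_rV_box R n (fun=> `](- c)%R, c[%classic)); last first.
  by move=> i; exact: measurable_itv.
rewrite (eq_bigr (fun=> (c + c)%:E)); last first.
  move=> i _; rewrite lebesgue_measure_itv/= lte_fin gtrN// -EFinD opprK//.
by rewrite prodEFin lte_fin prodr_gt0// => i _; exact: addr_gt0.
Qed.

End ball_measure.

Section radial_formula.
Context {R : realType} {n : nat}.
Local Notation mu := (@lebesgue_rV R n).
Local Notation leb := (@lebesgue_measure R).
Local Open Scope ereal_scope.

Lemma measure_unique_ray (m1 m2 : {measure set (measurableTypeR R) -> \bar R}) :
  (forall s : R, m1 `]-oo, s[%classic = m2 `]-oo, s[%classic) ->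
  (forall s : R, m1 `]-oo, s[%classic < +oo) ->
  forall A, measurable A -> m1 A = m2 A.
Proof.
move=> m12 m1fin A mA.
apply: (@measure_unique _ R (measurableTypeR R) (@RGenInftyO.G R)
  (fun k => `]-oo, k%:R[%classic)) => //.
- exact: RGenInftyO.measurableE.
- move=> _ _ [x ->] [y ->]; exists (Num.min x y).
  apply/seteqP; split => z /=; rewrite !in_itv/= lt_min; first by move=> [-> ->].
  by move=> /andP[].
- by move=> k; exists k%:R.
- apply/seteqP; split => // x _; exists (Num.bound `|x|) => //=.
  by rewrite in_itv/= (le_lt_trans (ler_norm x))// archi_boundP.
- by move=> _ [x ->].
Qed.

(** This takes the place of polar coordinates: under the Lebesgue measure of the ball, |x| is
    distributed as r s^(1/n) for s uniform on ]0, 1[, up to the factor mu(B). Both laws give the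
    mass mu(B) (t / r)^n to [0, t[, and rays determine a finite measure. *)
Lemma radial_integral (r : R) (F : measurableTypeR R -> \bar R) :
  (0 < n)%N -> (0 < r)%R -> measurable_fun setT F -> (forall s, 0 <= F s) ->
  \int[mu]_(x in eball r) F (enorm x) =
  mu (eball r) * \int[leb]_(s in `]0%R, 1%R[) F (r * s `^ n%:R^-1)%R.
Proof.
move=> n0 r0 mF F0.
pose D : set (measurableTypeR R) := `]-oo, r[%classic.
have mD : measurable D by exact: measurable_itv.
(* The value r outside ]0, 1[ lies out of D, so restricting to D discards exactly these s. *)
pose g (s : measurableTypeR R) : measurableTypeR R :=
  (if (0 < s < 1)%R then r * s `^ n%:R^-1 else r)%R.
have n0' : (0 < n%:R^-1 :> R)%R by rewrite invr_gt0 ltr0n.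
have mg : measurable_fun setT g.
  apply: measurable_fun_ifT => //.
    apply: (measurable_fun_bool true); rewrite (_ : _ @^-1` _ = `]0%R, 1%R[%classic).
      by rewrite setTI; exact: measurable_itv.
    by apply/seteqP; split => s; rewrite /= in_itv.
  by apply: measurable_funM => //; exact: measurable_powR.
have menorm : measurable_fun setT (@enorm R n : _ -> measurableTypeR R).
  exact: measurable_enorm.
pose m1 : {measure set (measurableTypeR R) -> \bar R} :=
  measure_function_pushforward__canonical__measure_function_Measure mu menorm.
pose m2 : {measure set (measurableTypeR R) -> \bar R} :=
  measure_function_pushforward__canonical__measure_function_Measure leb mg.
have [v v0 muE] : exists2 v : R, (0 < v)%R & mu (eball r) = v%:E.
  have := mu_eball_gt0 (n := n) r0; have := mu_eball_fin (n := n) r.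
  by case: (mu (eball r)) => [v _|//|//]; rewrite lte_fin; exists v.
have v0' : (0 <= v)%R by exact: ltW.
pose m3 : {measure set (measurableTypeR R) -> \bar R} := mscale (NngNum v0') (mrestr m2 mD).
pose m4 : {measure set (measurableTypeR R) -> \bar R} := mrestr m1 mD.
have gD : g @^-1` D = `]0%R, 1%R[%classic.
  apply/seteqP; split => s; rewrite /D /= !in_itv /= /g.
    by case: ifP => //; rewrite ltxx.
  move=> s01; rewrite s01; case/andP : s01 => s0 s1.
  rewrite gtr_pMr//; have := @gt0_ltr_powR R _ n0' s 1%R.
  by rewrite powR1 !nnegrE; apply; rewrite // ltW.
have m34 A : measurable A -> m4 A = m3 A.
  apply: measure_unique_ray => [s|s].
    transitivity (mu (eball (Num.min s r))).
      rewrite /m4 /= /mrestr; congr (mu _).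
      apply/seteqP; split => x; rewrite /D /eball /= !in_itv/= lt_min.
        by move=> [-> ->].
      by move/andP.
    transitivity (v%:E * leb (g @^-1` (`]-oo, s[ `&` D))); last by [].
    have [s0|s0] := leP s 0%R.
      rewrite (_ : eball _ = set0) ?measure0; last first.
        by apply/seteqP; split => x //; rewrite /eball/= lt_min ltNge (le_trans s0)// enorm_ge0.
      rewrite preimage_setI (_ : _ @^-1` _ = set0) ?set0I ?measure0 ?mule0//.
      apply/seteqP; split => x //=; rewrite in_itv/= /g ltNge (le_trans s0)//.
      by case: ifP => _; rewrite ?mulr_ge0 ?powR_ge0// ltW.
    have t0 : (0 < Num.min s r)%R by rewrite lt_min s0.
    rewrite (mu_eball_scale t0 r0) muE muleC; congr (_ * _).
    rewrite preimage_setI gD.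
    rewrite (_ : _ `&` _ = `]0%R, ((Num.min s r / r) ^+ n)%R[%classic); last first.
      have aux (x : R) : (0 < x)%R -> ((r * x `^ n%:R^-1 < s) = (x < (s / r) ^+ n))%R.
        move=> x0; rewrite mulrC -ltr_pdivlMr//.
        have nn : (n%:R != 0 :> R)%R by rewrite pnatr_eq0 -lt0n.
        have xE : (x = (x `^ n%:R^-1) ^+ n)%R.
          by rewrite -powR_mulrn ?powR_ge0// -powRrM mulVf// powRr1// ltW.
        rewrite [in RHS]xE ltr_pXn2r// ?nnegrE ?powR_ge0// divr_ge0// ltW//.
      apply/seteqP; split => x; rewrite /D /= !in_itv/= /g.
        move=> [xs x01]; move: xs; rewrite x01; case/andP : x01 => x0 x1.
        rewrite x0/= aux//; case: (leP s r) => // _ _; rewrite divff ?gt_eqF// expr1n//.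
      move=> /andP[x0 xs].
      have x1 : (x < 1)%R.
        apply: (lt_le_trans xs); rewrite exprn_ile1// ?divr_ge0 ?(ltW t0) ?(ltW r0)//.
        by rewrite ler_pdivrMr// mul1r ge_min lexx orbT.
      rewrite x0 x1/= aux//; split => //; apply: (lt_le_trans xs).
      rewrite lerXn2r ?nnegrE ?divr_ge0 ?(ltW t0) ?(ltW r0) ?(ltW s0)//.
      by rewrite ler_pM2r ?invr_gt0// ge_min lexx.
    rewrite lebesgue_measure_itv/= lte_fin exprn_gt0 ?divr_gt0//.
    by rewrite EFinN sube0.
  rewrite /m4 /= /mrestr; apply: (@le_lt_trans _ _ (mu (eball r))); last exact: mu_eball_fin.
  apply: (@le_measure _ _ _ mu (enorm @^-1` (`]-oo, s[ `&` D))); rewrite ?inE.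
  - have H : measurable (`]-oo, s[ `&` D) by apply: measurableI => //; exact: measurable_itv.
    by have := menorm measurableT _ H; rewrite setTI.
  - exact: measurable_eball.
  - by move=> x; rewrite /D /= !in_itv/= => -[].
transitivity (\int[m1]_(y in D) F y).
  by rewrite /m1/= ge0_integral_pushforward//; exact: measurable_funTS.
transitivity (\int[m3]_(y in D) F y).
  apply: eq_measure_integral => A mA AD; rewrite -m34// /m4/= /mrestr.
  by rewrite (setIidl AD).
rewrite ge0_integral_mscale//; last exact: measurable_funTS.
rewrite muE; congr (_ * _).
transitivity (\int[m2]_(y in D) F y).
  apply: eq_measure_integral => A mA AD; rewrite /= /mrestr.
  by rewrite (setIidl AD).
rewrite /m2/= ge0_integral_pushforward//; last exact: measurable_funTS.
rewrite gD; apply: eq_integral => x; rewrite inE/= in_itv/= => x01.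
by rewrite /g x01.
Qed.

End radial_formula.

(** * Calculus along lines *)

Section line_derivative.
Context {R : realType} {V : normedModType R}.
Implicit Types (f : V -> R) (x v w : V) (t : R).

Lemma line_quotient f x v t (h : R) :
  h^-1 *: ((fun s : R => f (x + s *: v)) (h *: 1 + t) - (fun s : R => f (x + s *: v)) t) =
  h^-1 *: (f (h *: v + (x + t *: v)) - f (x + t *: v)).
Proof.
rewrite /=; congr (_ *: (f _ - _)).
by rewrite [h *: 1]mulr1 scalerDl addrCA.
Qed.

Lemma derivable_line f x v t :
  derivable f (x + t *: v) v -> derivable (fun s : R => f (x + s *: v)) t 1.
Proof.
move=> /cvg_ex[l H]; apply/cvg_ex; exists l; apply: cvg_trans H; apply: near_eq_cvg; near=> h.
by rewrite -line_quotient.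
Unshelve. all: by end_near.
Qed.

Lemma derive_line f x v t :
  'D_1 (fun s : R => f (x + s *: v)) t = 'D_v f (x + t *: v).
Proof.
transitivity (lim ((fun h => h^-1 *: (f (h *: v + (x + t *: v)) - f (x + t *: v))) @ 0^'));
  last by [].
rewrite /derive; congr (lim _).
by rewrite (funext (line_quotient f x v t)).
Qed.

Lemma is_derive_line f x v t : derivable f (x + t *: v) v ->
  is_derive t 1 (fun s : R => f (x + s *: v)) ('D_v f (x + t *: v)).
Proof.
move=> H; rewrite -derive_line; apply: derivableP; exact: derivable_line.
Qed.

Lemma is_derive_of_line f x v d :
  is_derive (0 : R) 1 (fun s : R => f (x + s *: v)) d -> is_derive x v f d.
Proof.
move=> [dv E]; apply: DeriveDef.
  by apply/derivable1P; under eq_fun do rewrite addrC.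
by move: E; rewrite derive_line scale0r addr0.
Qed.

Lemma MVT_line f x v (h : R) : (forall y, derivable f y v) ->
  exists2 c, `|c| <= `|h| & f (x + h *: v) - f x = h * 'D_v f (x + c *: v).
Proof.
move=> df.
have cf (a b : R) : {within `[a, b], continuous (fun s : R => f (x + s *: v))}.
  apply: derivable_within_continuous => s _; exact/derivable_line.
have [h0|h0] := leP 0 h.
  have [//||c] := @MVT_segment R (fun s : R => f (x + s *: v)) (fun s : R => 'D_v f (x + s *: v)) _ _ h0.
  - by move=> s _; exact: is_derive_line.
  - exact: cf.
  rewrite in_itv/= => /andP[c0 ch]; rewrite scale0r addr0 subr0 mulrC => ->.
  by exists c => //; rewrite !ger0_norm// (le_trans c0).
have [//||c] := @MVT_segment R (fun s : R => f (x + s *: v)) (fun s : R => 'D_v f (x + s *: v)) _ _ (ltW h0).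
- by move=> s _; exact: is_derive_line.
- exact: cf.
rewrite in_itv/= => /andP[ch c0] E; exists c.
  by rewrite !ler0_norm// ?lerN2// (le_trans ch).
by move: E; rewrite scale0r addr0 sub0r mulrN -opprB => /oppr_inj ->; rewrite mulrC.
Qed.

(** The increment along v + w is the increment along v at x followed by one along w at the displaced
    point. The mean value theorem turns the second into a value of D_w near x, and continuity of D_w
    at x gives the limit. *)
Lemma is_derive_addv f x v w : (forall y, derivable f y v) ->
  (forall y, derivable f y w) -> {for x, continuous ('D_w f)} ->
  is_derive x (v + w) f ('D_v f x + 'D_w f x).
Proof.
move=> dv dw cw.
have H : h^-1 *: (f (h *: (v + w) + x) - f x) @[h --> 0^'] --> 'D_v f x + 'D_w f x.
  have dvx : h^-1 *: (f (h *: v + x) - f x) @[h --> 0^'] --> 'D_v f x by exact: dv.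
  suff dwx : h^-1 *: (f (h *: (v + w) + x) - f (h *: v + x)) @[h --> 0^'] --> 'D_w f x.
    rewrite (_ : (fun h : R => h^-1 *: (f (h *: (v + w) + x) - f x)) = (fun h =>
      h^-1 *: (f (h *: v + x) - f x) + h^-1 *: (f (h *: (v + w) + x) - f (h *: v + x)))).
      exact: (cvgD dvx dwx).
    apply/funext => h; rewrite -scalerDr; congr (_ *: _).
    by rewrite [RHS]addrC addrA subrK.
  apply/cvgrPdist_lt => /= e e0.
  move/cvgrPdist_lt : cw => /(_ _ e0) /nbhs_ballP[d /= d0 cw].
  have M0 : 0 < `|v| + `|w| + 1 by rewrite ltr_wpDl// addr_ge0.
  near=> h.
  have h0 : h != 0 by near: h; exact: nbhs_dnbhs_neq.
  have [c ch] := MVT_line (h *: v + x) h dw.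
  rewrite (_ : h *: v + x + h *: w = h *: (v + w) + x); last first.
    by rewrite scalerDr addrAC.
  move=> ->; rewrite scalerA mulVf// scale1r.
  apply: cw; rewrite -ball_normE /ball_/= [h *: v + x]addrC -addrA opprD addrA subrr.
  rewrite sub0r normrN (le_lt_trans (ler_normD _ _))// !normrZ.
  apply: (@le_lt_trans _ _ (`|h| * (`|v| + `|w| + 1))).
    rewrite mulrDr mulr1 mulrDr -addrA lerD2l (le_trans (ler_wpM2r _ ch))//.
    by rewrite lerDl.
  rewrite -ltr_pdivlMr//; near: h; apply: dnbhs0_lt; exact: divr_gt0.
by apply: DeriveDef; [apply/cvg_ex; eexists; exact: H|exact: cvg_lim H].
Unshelve. all: by end_near. Qed.

End line_derivative.

Section directional.
Context {R : realType} {n : nat}.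
Implicit Types (f : 'rV[R]_n -> R) (x v : 'rV[R]_n).

(** Convertible to [Ck 1], so that the algebra of [Ck] applies to it directly. *)
Definition C1 f := [/\ continuous f,
  forall i x, derivable f x (delta_mx ord0 i) & forall i, continuous (pderiv i f)].

(** [C1] provides partial derivatives only; the derivative along v is built by adding one coordinate
    direction at a time with [is_derive_addv]. *)
Lemma is_derive_dir f x v : C1 f -> is_derive x v f (dotr v (grad f x)).
Proof.
move=> [_ df cf].
have dZ i (c : R) y : is_derive y (c *: delta_mx ord0 i) f (c * pderiv i f y).
  apply: is_derive_of_line.
  rewrite (_ : (fun s : R => f (y + s *: (c *: delta_mx ord0 i))) =
    (fun s : R => f (y + s *: delta_mx ord0 i)) \o (c \*: @id R)); last first.
    by apply/funext => h /=; rewrite scalerA mulrC.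
  rewrite mulrC; apply: is_derive1_comp.
    rewrite [(_ \*: _) _](_ : _ = 0) ?[LHS]scaler0//.
    have := @is_derive_line _ _ f y (delta_mx ord0 i) 0.
    by rewrite scale0r addr0; apply.
  by apply: is_derive_eq; rewrite [c *: 1]mulr1.
have sumP (r : seq 'I_n) : forall y, is_derive y (\sum_(i <- r) v ord0 i *: delta_mx ord0 i) f
    (\sum_(i <- r) v ord0 i * pderiv i f y).
  elim: r => [|i r IH] y; first by rewrite !big_nil; exact: is_derive0.
  rewrite !big_cons.
  have E1 : 'D_(v ord0 i *: delta_mx ord0 i) f y = v ord0 i * pderiv i f y.
    by have [_ ->] := dZ i (v ord0 i) y.
  have E2 z : 'D_(\sum_(i <- r) v ord0 i *: delta_mx ord0 i) f z =
      \sum_(i <- r) v ord0 i * pderiv i f z.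
    by have [_ ->] := IH z.
  rewrite -E1 -E2; apply: is_derive_addv.
  - by move=> z; have [] := dZ i (v ord0 i) z.
  - by move=> z; have [] := IH z.
  - rewrite (funext E2); apply: (@cvg_big _ _ _ _ _ _ _ (nbhs y)) => [|j _].
      exact: add_continuous.
    by apply: cvgM; [exact: cvg_cst|exact: cf].
rewrite {1}(row_sum_delta v).
rewrite (_ : dotr _ _ = \sum_i v ord0 i * pderiv i f x); first exact: sumP.
by apply: eq_bigr => i _; rewrite mxE.
Qed.

Lemma integral_translate (b : 'rV[R]_n) (F : 'rV[R]_n -> \bar R) :
  measurable_fun setT F ->
  (\int[lebesgue_rV n]_x F x = \int[lebesgue_rV n]_x F (x + b)%R)%E.
Proof.
move=> mF; rewrite integralE [RHS]integralE.
have aux G : measurable_fun setT G -> (forall x, 0 <= G x)%E ->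
  (\int[lebesgue_rV n]_x G x = \int[lebesgue_rV n]_x G (x + b)%R)%E.
  move=> mG G0; rewrite (@ge0_integral_affine _ _ 1 b)// expr1n mul1e.
  by apply: eq_integral => x _; rewrite scale1r.
congr (_ - _)%E.
  by rewrite (aux _ (measurable_funepos mF) (fun x => funepos_ge0 F x)); apply: eq_integral => x _; rewrite !funeposE.
by rewrite (aux _ (measurable_funeneg mF) (fun x => funeneg_ge0 F x)); apply: eq_integral => x _; rewrite !funenegE.
Qed.

Lemma bounded_continuous_rV (g : 'rV[R]_n -> R) (s : R) : continuous g ->
  (forall x, s <= enorm x -> g x = 0) -> exists C, forall x, `|g x| <= C.
Proof.
move=> cg g0.
have [s0|s0] := ltP s 0.
  by exists 0 => x; rewrite g0 ?normr0// (le_trans (ltW s0))// enorm_ge0.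
pose A := [set x : 'rV[R]_n | enorm x <= s].
have cA : compact A.
  apply: bounded_closed_compact.
    exists s; split; first exact: num_real.
    move=> M sM x /= xs; rewrite [leLHS]/Num.norm /= mx_normrE.
    apply/bigmax_leP; split => [|[i j] _ /=]; first by rewrite (le_trans s0)// ltW.
    by rewrite (ord1 i) (le_trans (coord_le_enorm _ _))// (le_trans xs)// ltW.
  rewrite (_ : A = enorm @^-1` `]-oo, s]%classic).
    apply: preimage_closed; first by move=> z _; exact: continuous_enorm.
    exact: interval_closed.
  by apply/seteqP; split => z; rewrite /A /= in_itv/=.
have A0 : A !=set0 by exists 0; rewrite /A /= enorm0.
have cN : {within A, continuous (fun x => `|g x|)}.
  apply: continuous_subspaceT => x; apply: (@continuous_comp _ _ _ g Num.norm); first exact: cg.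
  exact: norm_continuous.
have [c _ cmax] := EVT_max_rV A0 cA cN.
exists `|g c| => x; have [xs|/ltW xs] := leP (enorm x) s.
  by apply: cmax; rewrite inE.
by rewrite g0// normr0.
Qed.

Lemma integrable_compact_support (g : 'rV[R]_n -> R) (s : R) : continuous g ->
  (forall x, s <= enorm x -> g x = 0) ->
  (lebesgue_rV n).-integrable setT (EFin \o g).
Proof.
move=> cg g0.
have [C gC] := bounded_continuous_rV cg g0.
have mb : measurable (@eball R n s) by exact: measurable_eball.
have -> : EFin \o g = (EFin \o g) \_ (eball s).
  apply/funext => x; rewrite patchE; case: ifPn => //.
  rewrite notin_setE /eball /= => /negP; rewrite -leNgt => /g0 ->.
  by [].
apply: (integrable_mkcond _ mb).1; apply: measurable_bounded_integrable => //.
- exact: mu_eball_fin.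
- by apply: measurable_funTS; exact: continuous_measurable_rV.
- exists C; split; first exact: num_real.
  by move=> M CM x _; exact: le_trans (gC x) (ltW CM).
Qed.

End directional.

Section continuous_arithmetic.
Context {R : realType} {T : topologicalType}.
Implicit Types f g : T -> R.

Lemma continuous_add f g : continuous f -> continuous g -> continuous (fun x => f x + g x).
Proof. by move=> cf cg x; exact: (continuousD (cf x) (cg x)). Qed.

Lemma continuous_sub f g : continuous f -> continuous g -> continuous (fun x => f x - g x).
Proof. by move=> cf cg x; exact: (continuousB (cf x) (cg x)). Qed.

Lemma continuous_mul f g : continuous f -> continuous g -> continuous (fun x => f x * g x).
Proof. by move=> cf cg x; exact: (continuousM (cf x) (cg x)). Qed.

Lemma continuous_scale f (c : R) : continuous f -> continuous (fun x => c * f x).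
Proof. by apply: continuous_mul => x; exact: cst_continuous. Qed.

Lemma continuous_sum_ord n (F : 'I_n -> T -> R) : (forall i, continuous (F i)) ->
  continuous (fun x => \sum_i F i x).
Proof. by move=> cF x; apply: (@cvg_bigsum R T (nbhs x)) => i; exact: cF. Qed.

End continuous_arithmetic.

Lemma continuous_translate (R : realType) n (f : 'rV[R]_n -> R) (b : 'rV[R]_n) :
  continuous f -> continuous (fun x : 'rV[R]_n => f (x + b)).
Proof.
move=> cf x; apply: (@continuous_comp _ _ _ (fun x : 'rV[R]_n => x + b) f); last exact: cf.
apply: (@continuousD R 'rV[R]_n _ id (cst b)); [exact: cvg_id|exact: cst_continuous].
Qed.

(** * Integrals of partial derivatives *)

Section integral_pderiv.
Context {R : realType} {n : nat}.
Implicit Types (f g : 'rV[R]_n -> R) (x v : 'rV[R]_n).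
Local Notation mu := (@lebesgue_rV R n).

Lemma enorm_delta (i : 'I_n) : enorm (delta_mx ord0 i : 'rV[R]_n) = 1.
Proof.
rewrite /enorm (bigD1 i)//= mxE !eqxx expr1n big1 ?addr0 ?sqrtr1// => j ji.
by rewrite mxE (negbTE ji) andbF expr0n.
Qed.

Lemma enormB x v : enorm x - enorm v <= enorm (x + v).
Proof.
rewrite lerBlDr -{1}(addrK v x); apply: (le_trans (enormD _ _)).
by rewrite enormN.
Qed.

Lemma pderiv_out f (s : R) i x : (forall y, s <= enorm y -> f y = 0) ->
  s < enorm x -> pderiv i f x = 0.
Proof.
move=> f0 sx.
rewrite /pderiv (@near_eq_derive _ _ _ f (cst 0)); first by rewrite derive_cst.
near=> y; rewrite f0//; apply: ltW; near: y.
exact: (cvgr_gt (enorm x) (@continuous_enorm R n x)).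
Unshelve. all: by end_near. Qed.

(** The difference quotients have integral 0 by translation invariance. By the mean value theorem
    they are values of the derivative at nearby points, so they are bounded by its supremum and
    converge to it; dominated convergence concludes. *)
Lemma Rintegral_pderiv0 f (s : R) i : C1 f -> (forall x, s <= enorm x -> f x = 0) ->
  \int[mu]_x pderiv i f x = 0.
Proof.
move=> [cf df cdf] f0.
set e : 'rV[R]_n := delta_mx ord0 i.
(* The margin 1 absorbs the shifts by h k <= 1 below, so a single ball carries all the difference
   quotients. *)
have g0 x : s + 1 <= enorm x -> pderiv i f x = 0.
  by move=> sx; apply: (pderiv_out i f0); rewrite (lt_le_trans _ sx)// ltrDl.
have [C gC] := bounded_continuous_rV (cdf i) g0.
pose h (k : nat) : R := k.+1%:R^-1.
have h0 k : 0 < h k by rewrite invr_gt0.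
have h1 k : h k <= 1 by rewrite invf_le1// ler1n.
pose F (k : nat) x : R := (h k)^-1 * (f (x + h k *: e) - f x).
have FE k x : exists2 c, `|c| <= h k & F k x = pderiv i f (x + c *: e).
  have [c ch E] := MVT_line x (h k) (df i).
  exists c; first by rewrite (le_trans ch)// ger0_norm// ltW.
  by rewrite /F E mulrA mulVf ?mul1r// gt_eqF.
have cF k : continuous (F k).
  apply: continuous_scale; apply: continuous_sub => //; exact: continuous_translate.
have ft0 k x : s + 1 <= enorm x -> f (x + h k *: e) = 0.
  move=> sx; apply: f0; apply: (le_trans _ (enormB _ _)).
  rewrite enormZ enorm_delta mulr1 gtr0_norm// lerBrDr (le_trans _ sx)//.
  by rewrite lerD2l.
have F0 k x : s + 1 <= enorm x -> F k x = 0.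
  by move=> sx; rewrite /F ft0// f0 ?subrr ?mulr0// (le_trans _ sx)// lerDl.
have intF k : (\int[mu]_x (F k x)%:E = 0)%E.
  have If : mu.-integrable setT (EFin \o f) by exact: integrable_compact_support f0.
  have It : mu.-integrable setT (EFin \o (fun x => f (x + h k *: e))).
    apply: integrable_compact_support (ft0 k).
    exact: continuous_translate.
  have ID : mu.-integrable setT (EFin \o (fun x => f (x + h k *: e) - f x)).
    apply: (@integrable_compact_support _ _ _ (s + 1)) => [|x sx].
      by apply: continuous_sub => //; exact: continuous_translate.
    by rewrite ft0// f0 ?subrr// (le_trans _ sx)// lerDl.
  under eq_integral do rewrite /F EFinM.
  rewrite (integralZl measurableT ID).
  under eq_integral do rewrite /= EFinB.
  rewrite (integralB measurableT It If).
  rewrite (@integral_translate _ _ (h k *: e) (EFin \o f)); last first.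
    by apply/measurable_EFinP; exact: continuous_measurable_rV.
  rewrite subee ?mule0//.
  by apply: integrable_fin_num => //.
have mball : measurable (@eball R n (s + 1)) by exact: measurable_eball.
have [|||||_ _] := @dominated_convergence _ _ R mu setT measurableT
   (fun k => EFin \o F k) (EFin \o pderiv i f) ((EFin \o cst C) \_ (eball (s + 1))).
- by move=> k; apply/measurable_EFinP; exact: continuous_measurable_rV.
- by apply/measurable_EFinP; apply: continuous_measurable_rV; exact: cdf.
- apply: aeW => x _; apply/cvg_EFin; first exact: nearW.
  apply/cvgrPdist_lt => /= d d0.
  have /cvgrPdist_lt/(_ _ d0)/nbhs_ballP[r /= r0 rd] := cdf i x.
  near=> k; have [c ck ->] := FE k x.
  apply: rd; rewrite -ball_normE /ball_/= opprD addrA subrr sub0r normrN normrZ.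
  apply: (@le_lt_trans _ _ (h k * (`|e| + 1))).
    by rewrite ler_pM// lerDl.
  rewrite -ltr_pdivlMr ?ltr_wpDl//; near: k.
  by apply: (near_infty_natSinv_lt (PosNum (divr_gt0 r0 _))); rewrite ltr_wpDl.
- apply: (integrable_mkcond _ mball).1; apply: measurable_bounded_integrable => //.
    exact: mu_eball_fin.
  exact: bounded_cst.
- apply: aeW => x k _; rewrite patchE; case: ifPn => [_|xs].
    by rewrite /= lee_fin; have [c _ ->] := FE k x.
  rewrite /= F0 ?normr0//; move: xs; rewrite notin_setE /eball /= => /negP.
  by rewrite -leNgt.
rewrite (_ : [sequence _]_n = cst 0%E); last by apply/funext => k; exact: intF.
move=> H; rewrite /Rintegral.
suff -> : (\int[mu]_x (pderiv i f x)%:E)%E = 0%E by [].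
by rewrite -(cvg_lim _ H)// lim_cst.
Unshelve. all: by end_near. Qed.

End integral_pderiv.

(** * Functions of class C^k and test functions *)

Section Ck_algebra.
Context {R : realType} {n : nat}.
Implicit Types (f g : 'rV[R]_n -> R) (x : 'rV[R]_n).

Lemma CkS k f : Ck k.+1 f -> Ck k f.
Proof.
elim: k f => [|k IH] f; first by case.
by move=> [cf df ckf]; split => // i; exact/IH/ckf.
Qed.

Lemma Ck_cst k (c : R) : Ck k (fun _ : 'rV[R]_n => c).
Proof.
elim: k c => [|k IH] c; first by move=> x; exact: cst_continuous.
split; [by move=> x; exact: cst_continuous|by move=> i x; exact: derivable_cst|].
move=> i; rewrite (_ : pderiv i _ = fun=> 0); first exact: IH.
by apply/funext => x; rewrite /pderiv derive_cst.
Qed.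

Lemma pderivD f g i x : derivable f x (delta_mx ord0 i) ->
  derivable g x (delta_mx ord0 i) ->
  pderiv i (fun y => f y + g y) x = pderiv i f x + pderiv i g x.
Proof. by move=> df dg; rewrite /pderiv (deriveD df dg). Qed.

Lemma pderivM f g i x : derivable f x (delta_mx ord0 i) ->
  derivable g x (delta_mx ord0 i) ->
  pderiv i (fun y => f y * g y) x = f x * pderiv i g x + g x * pderiv i f x.
Proof. by move=> df dg; rewrite /pderiv (deriveM df dg). Qed.

Lemma Ck_add k f g : Ck k f -> Ck k g -> Ck k (fun x => f x + g x).
Proof.
elim: k f g => [|k IH] f g /=; first exact: continuous_add.
move=> [cf df kf] [cg dg kg]; split; first exact: continuous_add.
  by move=> i x; exact: derivableD.
move=> i; rewrite (_ : pderiv i _ = fun x => pderiv i f x + pderiv i g x); first exact: IH.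
by apply/funext => x; exact: pderivD.
Qed.

Lemma Ck_mul k f g : Ck k f -> Ck k g -> Ck k (fun x => f x * g x).
Proof.
elim: k f g => [|k IH] f g; first exact: continuous_mul.
move=> f1 g1; have [f2 g2] := (CkS f1, CkS g1).
move: f1 g1 => [cf df kf] [cg dg kg]; split; first exact: continuous_mul.
  by move=> i x; exact: derivableM.
move=> i; rewrite (_ : pderiv i _ = fun x => f x * pderiv i g x + g x * pderiv i f x).
  by apply: Ck_add; apply: IH; [exact: f2|exact: kg|exact: g2|exact: kf].
by apply/funext => x; exact: pderivM.
Qed.

Lemma Ck_scale k f (c : R) : Ck k f -> Ck k (fun x => c * f x).
Proof. by apply: Ck_mul; exact: Ck_cst. Qed.

Lemma is_derive_coord (j : 'I_n) x v :
  is_derive x v (fun x : 'rV[R]_n => x ord0 j) (v ord0 j).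
Proof.
apply: is_derive_of_line.
rewrite (_ : (fun s : R => _) = (fun s => x ord0 j + v ord0 j * s)); last first.
  by apply/funext => s; rewrite !mxE mulrC.
have : is_derive (0 : R) 1 (cst (x ord0 j) + v ord0 j \*: @id R) (0 + v ord0 j *: 1).
  by apply: is_deriveD.
by rewrite add0r [_ *: 1]mulr1.
Qed.

Lemma Ck_coord k (j : 'I_n) : Ck k (fun x : 'rV[R]_n => x ord0 j).
Proof.
case: k => [|k]; first by move=> x; exact: coord_continuous.
split; first by move=> x; exact: coord_continuous.
  by move=> i x; have [] := is_derive_coord j x (delta_mx ord0 i).
move=> i; rewrite (_ : pderiv i _ = fun=> (delta_mx ord0 i : 'rV[R]_n) ord0 j).
  exact: Ck_cst.
by apply/funext => x; have [_] := is_derive_coord j x (delta_mx ord0 i).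
Qed.

Lemma pderiv_coord (j : 'I_n) x : pderiv j (fun x : 'rV[R]_n => x ord0 j) x = 1.
Proof.
by have [_] := is_derive_coord j x (delta_mx ord0 j); rewrite mxE !eqxx.
Qed.

End Ck_algebra.

Section test_functions.
Context {R : realType} {n : nat}.
Implicit Types (f g : 'rV[R]_n -> R) (x : 'rV[R]_n) (Omega : set 'rV[R]_n).

Lemma test_out Omega f x : test_function Omega f -> ~ Omega x -> f x = 0.
Proof.
move=> [_ _ sf] nx; apply: contrapT => fx; apply: nx; apply: sf.
by apply: subset_closure; apply/eqP.
Qed.

Lemma test_pderiv_out Omega f i x : test_function Omega f -> ~ Omega x ->
  pderiv i f x = 0.
Proof.
move=> [_ _ sf] nx.
rewrite /pderiv (@near_eq_derive _ _ _ f (cst 0)); first by rewrite derive_cst.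
have : ~ closure [set x | f x != 0] x by move=> /sf.
move=> /existsNP[A] /not_implyP[nA nfA]; near=> y.
apply: contrapT => fy; apply: nfA; exists y; split; first by apply/eqP.
by near: y.
Unshelve. all: by end_near. Qed.

Lemma test_add Omega f g : test_function Omega f -> test_function Omega g ->
  test_function Omega (fun x => f x + g x).
Proof.
move=> [cf kf sf] [cg kg sg].
have H : closure [set x | f x + g x != 0] `<=`
    closure [set x | f x != 0] `|` closure [set x | g x != 0].
  rewrite -closureU; apply: closureS => x /=.
  by have [->|] := eqVneq (f x) 0; [rewrite add0r; right|left].
split => [k||x /H[/sf|/sg]//]; first exact: Ck_add.
apply: (subclosed_compact _ _ H); first exact: closed_closure.
exact: compactU.
Qed.

Lemma test_scale Omega f (c : R) : test_function Omega f ->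
  test_function Omega (fun x => c * f x).
Proof.
move=> [cf kf sf].
have H : closure [set x | c * f x != 0] `<=` closure [set x | f x != 0].
  by apply: closureS => x /=; rewrite mulf_eq0 negb_or => /andP[].
split => [k||x /H/sf//]; first exact: Ck_scale.
by apply: (subclosed_compact _ _ H) => //; exact: closed_closure.
Qed.

Lemma test_C1 Omega f : test_function Omega f -> C1 f.
Proof. by move=> [/(_ 1%N)]. Qed.

End test_functions.

(** * Integration by parts and Poincare's inequality on the ball *)

Section ball_integrals.
Context {R : realType} {n : nat} (r : R).
Implicit Types (f g : 'rV[R]_n -> R) (x : 'rV[R]_n).
Local Notation mu := (@lebesgue_rV R n).
Local Notation B := (@eball R n r).

Lemma not_eball x : ~ B x <-> r <= enorm x.
Proof. by rewrite /eball /= leNgt; split => /negP. Qed.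

Lemma integrable_ball_continuous g : continuous g ->
  mu.-integrable B (EFin \o g).
Proof.
have mB : measurable B by exact: measurable_eball.
move=> cg; apply: measurable_bounded_integrable => //.
- exact: mu_eball_fin.
- by apply: measurable_funTS; exact: continuous_measurable_rV.
pose A := [set x : 'rV[R]_n | enorm x <= r].
have cA : compact A.
  apply: bounded_closed_compact.
    exists r; split; first exact: num_real.
    move=> M sM x /= xs; rewrite [leLHS]/Num.norm /= mx_normrE.
    apply/bigmax_leP; split => [|[i j] _ /=].
      by rewrite ltW// (le_lt_trans _ sM)// (le_trans (enorm_ge0 x) xs).
    by rewrite (ord1 i) (le_trans (coord_le_enorm _ _))// (le_trans xs)// ltW.
  rewrite (_ : A = enorm @^-1` `]-oo, r]%classic).
    apply: preimage_closed; first by move=> z _; exact: continuous_enorm.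
    exact: interval_closed.
  by apply/seteqP; split => z; rewrite /A /= in_itv/=.
have [A0|A0] := pselect (A !=set0); last first.
  exists 0; split; first exact: num_real.
  by move=> M M0 x Bx; exfalso; apply: A0; exists x; exact: ltW.
have cN : {within A, continuous (fun x => `|g x|)}.
  apply: continuous_subspaceT => x; apply: (@continuous_comp _ _ _ g Num.norm); first exact: cg.
  exact: norm_continuous.
have [c _ cmax] := EVT_max_rV A0 cA cN.
exists `|g c|; split; first exact: num_real.
move=> M M0 x Bx; apply: le_trans (ltW M0); apply: cmax; rewrite inE.
exact: ltW.
Qed.

Lemma Rintegral_ballT g : (forall x, ~ B x -> g x = 0) ->
  \int[mu]_(x in B) g x = \int[mu]_x g x.
Proof.
move=> g0; rewrite Rintegral_mkcond; apply: eq_Rintegral => x _.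
by rewrite patchE; case: ifPn => //; rewrite notin_setE => /g0 ->.
Qed.

Lemma integration_by_parts_ball f g i : C1 f -> C1 g ->
  (forall x, ~ B x -> f x = 0 /\ pderiv i f x = 0) ->
  \int[mu]_(x in B) (f x * pderiv i g x) = - \int[mu]_(x in B) (pderiv i f x * g x).
Proof.
move=> C1f C1g fg0.
have mB : measurable B by exact: measurable_eball.
have C1fg : C1 (fun x => f x * g x) by exact: (@Ck_mul _ _ 1).
have cfg := C1fg.
have out x : r <= enorm x -> f x * g x = 0.
  by move=> /not_eball /fg0[-> _]; rewrite mul0r.
have Z := Rintegral_pderiv0 i C1fg out.
have [cf df kf] := C1f; have [cg dg kg] := C1g.
have E x : pderiv i (fun x => f x * g x) x = f x * pderiv i g x + pderiv i f x * g x.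
  by rewrite pderivM// [X in _ + X]mulrC.
suff : \int[mu]_(x in B) (f x * pderiv i g x + pderiv i f x * g x) = 0.
  rewrite RintegralD//; first by move/eqP; rewrite addr_eq0 => /eqP.
    by apply: integrable_ball_continuous; exact: continuous_mul.
  by apply: integrable_ball_continuous; exact: continuous_mul.
rewrite -[RHS]Z -Rintegral_ballT; last first.
  by move=> x /fg0[f0 df0]; rewrite E f0 df0 !mul0r addr0.
by apply: eq_Rintegral => x _; rewrite E.
Qed.

(** Integrating f against the derivative of x_i f gives int f^2 = -2 int x_i f d_i f. The right side
    is at most half of int f^2 plus 2 r^2 int (d_i f)^2, and the first term is absorbed. *)
Lemma poincare_ball f i : C1 f ->
  (forall x, ~ B x -> f x = 0 /\ pderiv i f x = 0) ->
  \int[mu]_(x in B) (f x ^+ 2) <= 4 * r ^+ 2 * \int[mu]_(x in B) (pderiv i f x ^+ 2).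
Proof.
move=> C1f f0; have [cf df kf] := C1f.
have mB : measurable B by exact: measurable_eball.
have C1g : C1 (fun x => x ord0 i * f x).
  exact: (Ck_mul (@Ck_coord R n 1 i) C1f).
have I g : continuous g -> mu.-integrable B (EFin \o g) by exact: integrable_ball_continuous.
have c1 : continuous (fun x => f x ^+ 2) by move=> x; exact: (continuous_mul cf cf).
have c2 : continuous (fun x => pderiv i f x ^+ 2) by move=> x; exact: (continuous_mul (kf i) (kf i)).
have c3 : continuous (fun x => f x * pderiv i f x * x ord0 i).
  apply: continuous_mul; first exact: continuous_mul.
  by move=> x; exact: coord_continuous.
have := integration_by_parts_ball C1f C1g f0.
rewrite (@eq_Rintegral _ _ _ _ _ (fun x => f x ^+ 2 + f x * pderiv i f x * x ord0 i)); last first.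
  move=> x _; rewrite pderivM//; last by have [] := is_derive_coord i x (delta_mx ord0 i).
  by rewrite pderiv_coord; ring.
rewrite RintegralD//; [|exact: I|exact: I].
rewrite [in X in _ = X -> _](@eq_Rintegral _ _ _ _ _ (fun x => f x * pderiv i f x * x ord0 i)); last first.
  by move=> x _; ring.
set a := \int[mu]_(x in B) (f x ^+ 2); set b := \int[mu]_(x in B) (_ * _ * _).
set d := \int[mu]_(x in B) (pderiv i f x ^+ 2) => ab.
have : \int[mu]_(x in B) (-2 * (f x * pderiv i f x * x ord0 i)) <=
    \int[mu]_(x in B) (2^-1 * (f x ^+ 2) + 2 * r ^+ 2 * (pderiv i f x ^+ 2)).
  apply: le_Rintegral => //.
  - by apply: I; exact: continuous_scale.
  - by apply: I; apply: continuous_add; exact: continuous_scale.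
  move=> x Bx; have : x ord0 i ^+ 2 <= r ^+ 2.
    rewrite -real_normK ?num_real// lerXn2r ?nnegrE//.
      by rewrite (le_trans (enorm_ge0 x))// ltW.
    by rewrite (le_trans (coord_le_enorm _ _))// ltW.
  move: (f x) (pderiv i f x) (x ord0 i) => u v y yr.
  have := sqr_ge0 (u + 2 * y * v); have := sqr_ge0 v; nra.
rewrite RintegralZl//; last exact: I.
rewrite RintegralD//; [|by apply: I; exact: continuous_scale|by apply: I; exact: continuous_scale].
rewrite RintegralZl//; last exact: I.
rewrite RintegralZl//; last exact: I.
rewrite -/a -/b -/d; lra.
Qed.

End ball_integrals.

(** * Smooth functions of one variable *)

Section smooth1.
Context {R : realType}.
Implicit Types (f g : R -> R) (x : R).

Lemma is_derive1_add f g x a b : is_derive x 1 f a -> is_derive x 1 g b ->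
  is_derive x 1 (fun y => f y + g y) (a + b).
Proof. by move=> fa gb; exact: is_deriveD. Qed.

Lemma is_derive1_mul f g x a b : is_derive x 1 f a -> is_derive x 1 g b ->
  is_derive x 1 (fun y => f y * g y) (f x * b + g x * a).
Proof. by move=> fa gb; exact: is_deriveM. Qed.

Lemma is_derive1_affine (c d x : R) : is_derive x 1 (fun y : R => c * y + d) c.
Proof.
have -> : c = c *: 1 + 0 :> R by rewrite addr0 [_ *: 1]mulr1.
have H : is_derive x 1 (c \*: @id R) (c *: 1) by apply: is_deriveZ.
have := is_derive1_add H (is_derive_cst d x 1).
by rewrite addr0 [_ *: 1]mulr1.
Qed.

Lemma is_derive1_scale f x a (c : R) : is_derive x 1 f a ->
  is_derive x 1 (fun y => c * f y) (c * a).
Proof. by move=> fa; exact: (@is_deriveZ _ _ _ f c x 1 a). Qed.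

Lemma is_derive1_continuous f x a : is_derive x 1 f a -> {for x, continuous f}.
Proof.
by move=> [df _]; apply: differentiable_continuous; apply/derivable1_diffP.
Qed.

Lemma is_derive1_val f x a : is_derive x 1 f a -> (derive1 f) x = a.
Proof. by move=> [_ <-]; rewrite derive1E. Qed.

Fixpoint Sm (k : nat) f : Prop :=
  if k is j.+1 then (forall x, derivable f x 1) /\ Sm j (derive1 f) else continuous f.

Lemma Sm_intro k f g : (forall x, is_derive x 1 f (g x)) -> Sm k g -> Sm k.+1 f.
Proof.
move=> fg kg; split; first by move=> x; have [] := fg x.
by rewrite (_ : (derive1 f) = g)//; apply/funext => x; exact/is_derive1_val.
Qed.

Lemma Sm_is_derive k f x : Sm k.+1 f -> is_derive x 1 f ((derive1 f) x).
Proof. by move=> [df _]; rewrite derive1E; exact: derivableP. Qed.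

Lemma Sm_continuous k f : Sm k f -> continuous f.
Proof.
by case: k => // k kf x; apply: is_derive1_continuous; exact: Sm_is_derive kf.
Qed.

Lemma SmS k f : Sm k.+1 f -> Sm k f.
Proof.
elim: k f => [|k IH] f kf; first exact: Sm_continuous kf.
by move: kf => [df kf]; split => //; exact: IH.
Qed.

Lemma Sm_cst k (c : R) : Sm k (fun=> c).
Proof.
elim: k c => [|k IH] c; first by move=> x; exact: cst_continuous.
by apply: (@Sm_intro _ _ (fun=> 0)) => // x; exact: is_derive_cst.
Qed.

Lemma Sm_add k f g : Sm k f -> Sm k g -> Sm k (fun x => f x + g x).
Proof.
elim: k f g => [|k IH] f g; first exact: continuous_add.
move=> kf kg; apply: (@Sm_intro _ _ (fun x => (derive1 f) x + (derive1 g) x)).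
  by move=> x; apply: is_derive1_add; [exact: Sm_is_derive kf|exact: Sm_is_derive kg].
by apply: IH; [case: kf|case: kg].
Qed.

Lemma Sm_mul k f g : Sm k f -> Sm k g -> Sm k (fun x => f x * g x).
Proof.
elim: k f g => [|k IH] f g; first exact: continuous_mul.
move=> kf kg; apply: (@Sm_intro _ _ (fun x => f x * (derive1 g) x + g x * (derive1 f) x)).
  by move=> x; apply: is_derive1_mul; [exact: Sm_is_derive kf|exact: Sm_is_derive kg].
have [kf' kg'] := (SmS kf, SmS kg).
by apply: Sm_add; apply: IH => //; [case: kg|case: kf].
Qed.

Lemma Sm_scale k f (c : R) : Sm k f -> Sm k (fun x => c * f x).
Proof. by apply: Sm_mul; exact: Sm_cst. Qed.

Lemma Sm_affine k f (c d : R) : Sm k f -> Sm k (fun x => f (c * x + d)).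
Proof.
elim: k f => [|k IH] f kf.
  move=> x; apply: (@continuous_comp _ _ _ (fun x => c * x + d) f); last exact: kf.
  exact: is_derive1_continuous (is_derive1_affine c d x).
apply: (@Sm_intro _ _ (fun x => c * (derive1 f) (c * x + d))); last first.
  by apply: Sm_scale; apply: IH; case: kf.
move=> x; rewrite mulrC; apply: (@is_derive1_comp R f (fun x => c * x + d)).
  exact: Sm_is_derive kf.
exact: is_derive1_affine.
Qed.

Lemma Sm_sum k (I : Type) (s : seq I) (F : I -> R -> R) : (forall i, Sm k (F i)) ->
  Sm k (fun x => \sum_(i <- s) F i x).
Proof.
move=> kF; elim: s => [|i s IH].
  by under eq_fun do rewrite big_nil; exact: Sm_cst.
by under eq_fun do rewrite big_cons; exact: Sm_add.
Qed.

(* The functions P(1/x) e^(-1/x) on x > 0 are stable under derivation. *)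
Definition flat (P : {poly R}) x := if 0 < x then P.[x^-1] * expR (- x^-1) else 0.

Lemma poly_le_expR (P : {poly R}) :
  exists2 C, 0 <= C & forall y, 0 <= y -> `|P.[y]| <= C * expR y.
Proof.
(* Here y^m = m^m (y / m)^m, and y / m <= e^(y / m). *)
have Xn m (y : R) : 0 <= y -> y ^+ m <= (m%:R ^+ m) * expR y.
  case: m => [|m] y0; first by rewrite !expr0 mul1r -expR0 ler_expR.
  have m0 : 0 < m.+1%:R :> R by [].
  rewrite -{2}(divfK (lt0r_neq0 m0) y) expRM_natr.
  rewrite -exprMn; apply: lerXn2r; rewrite ?nnegrE ?mulr_ge0 ?expR_ge0//.
  rewrite mulrC -ler_pdivrMr// (le_trans _ (expR_ge1Dx _))//.
  by rewrite lerDr.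
exists (\sum_(i < size P) `|P`_i| * (i%:R ^+ i)).
  by apply: sumr_ge0 => i _; rewrite mulr_ge0// exprn_ge0.
move=> y y0; rewrite horner_coef mulr_suml (le_trans (ler_norm_sum _ _ _))//.
apply: ler_sum => i _; rewrite normrM -mulrA ler_wpM2l//.
by rewrite ger0_norm ?exprn_ge0// Xn.
Qed.

(** The exponential bound is applied to X^2 P, which gains the factor x^2; this decay is what makes
    [flat P] differentiable at 0. *)
Lemma flat_le_sqr P : exists2 C, 0 <= C & forall x, `|flat P x| <= C * x ^+ 2.
Proof.
have [C C0 PC] := poly_le_expR ('X^2 * P).
exists C => // x; rewrite /flat; case: ifPn => [x0|_]; last first.
  by rewrite normr0 mulr_ge0// sqr_ge0.
have y0 : 0 <= x^-1 by rewrite invr_ge0 ltW.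
have := PC _ y0; rewrite hornerM hornerXn normrM ger0_norm ?exprn_ge0// => H.
rewrite normrM (ger0_norm (expR_ge0 _)) expRN -ler_pdivlMr ?invr_gt0 ?expR_gt0// invrK.
rewrite -(ler_pM2l (_ : 0 < x^-1 ^+ 2)) ?exprn_gt0 ?invr_gt0//.
rewrite (le_trans H)// mulrA mulrCA -exprMn mulVf ?gt_eqF// expr1n mulr1//.
Qed.

(** Differentiating P(1/x) e^(-1/x) brings out the factor x^(-2), that is X^2 in the variable 1/x.
    At 0 the quadratic bound gives the derivative 0. *)
Lemma is_derive_flat P x : is_derive x 1 (flat P) (flat ('X^2 * (P - P^`())) x).
Proof.
have [x0|x0|->] := ltgtP x 0.
- rewrite {2}/flat ltNge ltW//=.
  apply: (@near_eq_is_derive _ _ _ (cst 0) _ x 1 0 _ (is_derive_cst 0 x 1)).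
  by near=> y; rewrite /flat ltNge ltW//; near: y; exact: lt_nbhsl.
- rewrite {2}/flat x0.
  have dV : is_derive x 1 (fun y : R => y^-1) (- x ^- 2).
    have -> : - x ^- 2 = - x ^- 2 *: (1 : R) by rewrite [_ *: _]mulr1.
    split; last by rewrite deriveV// ?gt_eqF// derive_id.
    by apply: derivableV => //; rewrite gt_eqF.
  have dP : is_derive x 1 (fun y : R => P.[y^-1]) (P^`().[x^-1] * - x ^- 2).
    exact: (@is_derive1_comp R (horner P) (fun y => y^-1)).
  have dE : is_derive x 1 (fun y : R => expR (- y^-1)) (expR (- x^-1) * x ^- 2).
    apply: (@is_derive1_comp R expR (fun y => - y^-1)).
    by have := @is_deriveN _ _ _ _ x 1 _ dV; rewrite opprK.
  have H := is_derive1_mul dP dE.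
  rewrite (_ : _ * _ = P.[x^-1] * (expR (- x^-1) * x ^- 2) +
    expR (- x^-1) * (P^`().[x^-1] * - x ^- 2)); last first.
    by rewrite hornerM hornerXn hornerD hornerN exprVn; ring.
  suff N : \forall y \near x, P.[y^-1] * expR (- y^-1) = flat P y.
    exact: (near_eq_is_derive N H).
  by near=> y; rewrite /flat ifT//; near: y; exact: lt_nbhsr.
- rewrite {2}/flat ltxx; have [C C0 H] := flat_le_sqr P.
  have f0 : flat P 0 = 0 by rewrite /flat ltxx.
  have L : h^-1 *: (flat P (h *: 1 + 0) - flat P 0) @[h --> 0^'] --> (0 : R).
    apply/cvgrPdist_lt => e e0; near=> h.
    have h0 : h != 0 by near: h; exact: nbhs_dnbhs_neq.
    rewrite sub0r normrN addr0 f0 subr0 [_ *: 1]mulr1 normrZ normfV.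
    apply: (@le_lt_trans _ _ ((C + 1) * `|h|)).
      rewrite ler_pdivrMl ?normr_gt0// (le_trans (H h))//.
      rewrite [leRHS]mulrCA -expr2 real_normK ?num_real// ler_wpM2r ?sqr_ge0//.
      by rewrite lerDl.
    rewrite mulrC -ltr_pdivlMr ?ltr_wpDl//; near: h; apply: dnbhs0_lt.
    by rewrite divr_gt0// ltr_wpDl.
  by apply: DeriveDef; [apply/cvg_ex; exists 0; exact: L|exact: cvg_lim L].
Unshelve. all: by end_near. Qed.

Lemma Sm_flat k P : Sm k (flat P).
Proof.
elim: k P => [|k IH] P.
  by move=> x; exact: is_derive1_continuous (is_derive_flat P x).
exact: (Sm_intro (is_derive_flat P)).
Qed.

Lemma is_derive_primitive f (a x : R) : continuous f -> a < x ->
  is_derive x 1 (fun y => \int[lebesgue_measure]_(t in `[a, y]) f t) (f x).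
Proof.
move=> cf ax; have x1 : x < x + 1 by rewrite ltrDl.
have I : lebesgue_measure.-integrable `[a, x + 1] (EFin \o f).
  by apply: continuous_compact_integrable; [exact: segment_compact|exact: continuous_subspaceT].
have [df <-] := continuous_FTC1_closed x1 I ax (cf x).
by rewrite derive1E; exact: derivableP.
Qed.

Lemma primitive_vanishing f : continuous f -> (forall x, x <= 0 -> f x = 0) ->
  exists F, (forall x, is_derive x 1 F (f x)) /\ (forall x, x <= 0 -> F x = 0).
Proof.
move=> cf f0.
(* Starting at -1 makes 0 an interior point. Up to 0 the integrand vanishes, and below -1 the
   interval of integration is empty. *)
pose F y := \int[lebesgue_measure]_(t in `[-1, y]) f t.
have F0 x : x <= 0 -> F x = 0.
  move=> x0; rewrite /F (@eq_Rintegral _ _ _ _ _ (cst 0)); last first.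
    by move=> t; rewrite inE/= in_itv/= => /andP[_ tx]; rewrite f0// (le_trans tx).
  by rewrite /Rintegral integral0.
exists F; split => // x; have [x1|x1] := ltP (-1) x.
  exact: is_derive_primitive.
rewrite f0; last by rewrite (le_trans x1).
apply: (@near_eq_is_derive _ _ _ (cst 0) _ x 1 0 _ (is_derive_cst 0 x 1)).
near=> y; rewrite F0//; apply: ltW; near: y; apply: lt_nbhsl.
by rewrite (le_lt_trans x1).
Unshelve. all: by end_near. Qed.

(** A primitive of the bump e^(-1/x) e^(-1/(1 - x)) on ]0, 1[, divided by its total mass F 1. *)
Lemma smooth_step : exists S : R -> R, [/\ forall k, Sm k S,
  forall x, x <= 0 -> S x = 0, forall x, 1 <= x -> S x = 1 &
  forall x y, x <= y -> S x <= S y].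
Proof.
pose b x := flat 1 x * flat 1 (- 1 * x + 1).
have b0 x : 0 <= b x.
  by rewrite /b /flat; do 2 case: ifP => _; rewrite ?mulr0 ?mul0r// !hornerC !mul1r mulr_ge0// expR_ge0.
have bpos x : 0 < x < 1 -> 0 < b x.
  move=> /andP[x0 x1]; rewrite /b /flat x0 mulN1r addrC subr_gt0 x1.
  by rewrite !hornerC !mul1r mulr_gt0// expR_gt0.
have bl x : x <= 0 -> b x = 0 by move=> x0; rewrite /b /flat ltNge x0 mul0r.
have br x : 1 <= x -> b x = 0.
  by move=> x0; rewrite /b /flat mulN1r addrC subr_gt0 [x < 1]ltNge x0 mulr0.
have kb k : Sm k b by apply: Sm_mul; [|apply: Sm_affine]; exact: Sm_flat.
have [F [dF F0]] := primitive_vanishing (@Sm_continuous 0 _ (kb 0%N)) bl.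
have wc (a c : R) : {within `[a, c], continuous F}.
  by apply: derivable_within_continuous => x _; have [] := dF x.
have ndF x y : x <= y -> F x <= F y.
  move=> xy; have [c _ E] := @MVT_segment R F b x y xy (fun z _ => dF z) (wc x y).
  by rewrite -subr_ge0 E mulr_ge0// subr_ge0.
have F1 : 0 < F 1.
  have [c cin E] := @MVT R F b 0 1 ltr01 (fun z _ => dF z) (wc 0 1).
  have -> : F 1 = b c by move: E; rewrite (F0 0)// !subr0 mulr1.
  by apply: bpos; move: cin; rewrite in_itv.
have Fr x : 1 <= x -> F x = F 1.
  move=> x1; have [c cin E] := @MVT_segment R F b 1 x x1 (fun z _ => dF z) (wc 1 x).
  apply/eqP; rewrite -subr_eq0 E br ?mul0r//.
  by move: cin; rewrite in_itv/= => /andP[].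
exists (fun x => (F 1)^-1 * F x); split.
- move=> k; apply: Sm_scale; case: k => [|k]; last exact: (Sm_intro dF).
  by move=> x; exact: is_derive1_continuous (dF x).
- by move=> x x0; rewrite (F0 x x0) mulr0.
- by move=> x x1; rewrite (Fr x x1) mulVf// gt_eqF.
- by move=> x y xy; rewrite ler_wpM2l ?invr_ge0 ?ndF// ltW.
Qed.

End smooth1.

(** * Smooth approximation on a grid *)

Section grid_approximation.
Context {R : realType}.
Implicit Types (S zeta : R -> R).

(** A mollification by a partition of unity: the weights are differences of shifted steps, hence
    nonnegative; the i-th is supported in [(i - 1) d, (i + 1) d], and their sum telescopes. The
    range 2 <= i <= k + 1 with d = L / (k + 4) keeps the support away from both 0 and L. *)
Definition grid_sum S (L : R) zeta (k : nat) (t : R) : R :=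
  let d := L / k.+4%:R in
  \sum_(2 <= i < k.+2) zeta (i%:R * d) * (S (d^-1 * t + (1 - i%:R)) - S (d^-1 * t + - i%:R)).

Variables (S : R -> R) (L : R).
Hypotheses (kS : forall k, Sm k S) (S0 : forall x, x <= 0 -> S x = 0)
  (S1 : forall x, 1 <= x -> S x = 1) (ndS : forall x y, x <= y -> S x <= S y)
  (L0 : 0 < L).

Let S_ge0 x : 0 <= S x.
Proof. by have [/S0->//|x0] := leP x 0; rewrite -(S0 (lexx 0)) ndS// ltW. Qed.

Let S_le1 x : S x <= 1.
Proof. by have [/S1->//|x0] := leP 1 x; rewrite -(S1 (lexx 1)) ndS// ltW. Qed.

Let d k : R := L / k.+4%:R.
Let d0 k : 0 < d k. Proof. by rewrite divr_gt0. Qed.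
Let w k (t : R) (i : nat) := S ((d k)^-1 * t + (1 - i%:R)) - S ((d k)^-1 * t + - i%:R).

Let w0 k t i : 0 <= w k t i.
Proof. by rewrite subr_ge0 ndS// lerD2l lerDr. Qed.

Let w_supp k t i : w k t i != 0 -> (i%:R - 1) * d k < t < (i%:R + 1) * d k.
Proof.
move=> wt; apply/andP; split; rewrite ltNge; apply: contra wt => tw; rewrite /w.
  rewrite !S0 ?subrr//.
    have : (d k)^-1 * t <= i%:R - 1 by rewrite mulrC ler_pdivrMr.
    lra.
  have : (d k)^-1 * t <= i%:R - 1 by rewrite mulrC ler_pdivrMr.
  lra.
rewrite !S1 ?subrr//.
  have : i%:R + 1 <= (d k)^-1 * t by rewrite [leRHS]mulrC ler_pdivlMr.
  lra.
have : i%:R + 1 <= (d k)^-1 * t by rewrite [leRHS]mulrC ler_pdivlMr.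
lra.
Qed.

Let w_sum k t : \sum_(2 <= i < k.+2) w k t i =
  S ((d k)^-1 * t - 1) - S ((d k)^-1 * t - k.+1%:R).
Proof.
pose u i := - S ((d k)^-1 * t + (1 - i%:R)).
rewrite (eq_bigr (fun i => u i.+1 - u i)); last first.
  move=> i _; have E : 1 - i.+1%:R = - i%:R :> R by rewrite -natr1; lra.
  by rewrite /u /w E opprK addrC.
have E1 : 1 - 2%:R = - 1 :> R by lra.
have E2 : 1 - k.+2%:R = - k.+1%:R :> R by rewrite -natr1; lra.
by rewrite telescope_sumr// /u E1 E2 opprK addrC.
Qed.

Lemma grid_sum_smooth zeta k j : Sm j (grid_sum S L zeta k).
Proof.
apply: Sm_sum => i; apply: Sm_scale.
rewrite (_ : (fun x => _) = fun x => S ((d k)^-1 * x + (1 - i%:R)) +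
  -1 * S ((d k)^-1 * x + - i%:R)); last by apply/funext => x; rewrite mulN1r.
apply: Sm_add; first exact: Sm_affine.
by apply: Sm_scale; exact: Sm_affine.
Qed.

Let L_eq k : L = (k%:R + 4) * d k.
Proof. by rewrite -natrD addn4 /d mulrC divfK. Qed.

Let grid_index k i : (1 < i)%N -> (i < k.+2)%N ->
  [/\ 0 <= (i%:R - 2) * d k, 0 <= (k%:R + 1 - i%:R) * d k & L = (k%:R + 4) * d k].
Proof.
move=> i2 ik; have dk := ltW (d0 k); split.
- by rewrite mulr_ge0// subr_ge0 ler_nat.
- by rewrite mulr_ge0// subr_ge0 natr1 ler_nat.
- exact: L_eq.
Qed.

Lemma grid_sum_support zeta k :
  exists2 e, 0 < e & forall t, t <= e \/ L - e <= t -> grid_sum S L zeta k t = 0.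
Proof.
exists (d k) => // t te; rewrite /grid_sum -/(d k) big_nat_cond big1// => i /andP[/andP[i2 ik] _].
rewrite -/(w k t i).
have [->|wn] := eqVneq (w k t i) 0; first by rewrite mulr0.
have /andP[t1 t2] := w_supp wn; exfalso.
have [p1 p2 LE] := grid_index i2 ik.
move: (d0 k) t1 t2 te; rewrite LE.
move: (i%:R) (k%:R) (d k) p1 p2 => I K D p1 p2 D0 t1 t2 [te|te]; lra.
Qed.

(** Where the i-th weight is nonzero, t < (i + 1) d, and i >= 2 gives t / 2 <= i d; a nonincreasing
    power at the node is then at most its value at t / 2. The weights sum to at most 1, so the bound
    is uniform in k and can dominate. *)
Lemma grid_sum_bound zeta (C b : R) k t : b <= 0 -> 0 <= C ->
  (forall s, 0 < s < L -> `|zeta s| <= C * s `^ b) -> 0 < t ->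
  `|grid_sum S L zeta k t| <= C * (t / 2) `^ b.
Proof.
move=> b0 C0 zC t0; rewrite /grid_sum -/(d k).
apply: (@le_trans _ _ (\sum_(2 <= i < k.+2) C * (t / 2) `^ b * w k t i)).
  rewrite (le_trans (ler_norm_sum _ _ _))// !big_nat; apply: ler_sum => i /andP[i2 ik].
  rewrite normrM [X in _ * X]ger0_norm; last exact: w0.
  rewrite -/(w k t i).
  have [->|wn] := eqVneq (w k t i) 0; first by rewrite !mulr0.
  have /andP[t1 t2] := w_supp wn.
  rewrite ler_wpM2r ?w0//.
  have [p1 p2 LE] := grid_index i2 ik.
  have [ti ti0 tL] : [/\ t / 2 <= i%:R * d k, 0 < i%:R * d k & i%:R * d k < L].
    move: (d0 k) t1 t2; rewrite [in _ < L]LE.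
    by move: (i%:R) (k%:R) (d k) p1 p2 => I K D p1 p2 D0 t1 t2; split; lra.
  apply: le_trans (zC _ _) _; first by rewrite ti0.
  have E x : x `^ b = (x `^ (- b))^-1 by rewrite -powRN opprK.
  rewrite ler_wpM2l// !E lef_pV2 ?posrE ?powR_gt0 ?divr_gt0//.
  by rewrite ge0_ler_powR ?nnegrE ?oppr_ge0// ltW// divr_gt0.
rewrite -big_distrr/= w_sum ler_piMr//; first by rewrite mulr_ge0// powR_ge0.
by rewrite lerBlDr (le_trans (S_le1 _))// lerDl.
Qed.

Lemma grid_sum_cvg zeta t : 0 < t < L -> {for t, continuous zeta} ->
  grid_sum S L zeta k t @[k --> \oo] --> zeta t.
Proof.
move=> /andP[t0 tL] cz; apply/cvgrPdist_le => /= e e0.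
have /cvgrPdist_lt/(_ _ e0)/nbhs_ballP[a /= a0 za] := cz.
near=> k.
(* In the telescoped sum, 2 d <= t brings the first step to 1 and t <= L - 3 d = (k + 1) d keeps the
   last one at 0, so the weights sum to 1. The bound d < a places the contributing nodes where zeta
   is close to zeta t. *)
have [dk ka kt kL] : [/\ 0 < d k, d k < a, 2 * d k <= t & t <= L - 3 * d k].
  have : k.+1%:R^-1 < Num.min a (Num.min (t / 2) ((L - t) / 3)) / L.
    near: k; apply: (near_infty_natSinv_lt (PosNum _)).
    by rewrite divr_gt0// !lt_min a0/= !divr_gt0// subr_gt0.
  rewrite ltr_pdivlMr// !lt_min => /and3P[h1 h2 h3].
  have : d k <= k.+1%:R^-1 * L.
    rewrite /d mulrC; apply: ler_wpM2r; first exact: ltW.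
    by rewrite lef_pV2 ?posrE// ler_nat; do 3 apply: leqW.
  have := d0 k; move: h1 h2 h3; move: (k.+1%:R^-1 * L) (d k) => X Y *.
  by split; lra.
have W1 : \sum_(2 <= i < k.+2) w k t i = 1.
  rewrite w_sum S1 ?S0 ?subr0//.
    have : t / d k <= k%:R + 1.
      rewrite ler_pdivrMr// (le_trans kL)//.
      by move: (dk); rewrite {1}(L_eq k); move: (k%:R) (d k) => K D D0; lra.
    by rewrite mulrC -natr1; lra.
  have : 2 <= t / d k by rewrite ler_pdivlMr.
  by rewrite mulrC; lra.
rewrite -{1}[zeta t]mulr1 -W1 mulr_sumr /grid_sum -/(d k) -sumrB.
rewrite (le_trans (ler_norm_sum _ _ _))//.
apply: (@le_trans _ _ (\sum_(2 <= i < k.+2) e * w k t i)); last first.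
  by rewrite -mulr_sumr W1 mulr1.
apply: ler_sum => i _; rewrite -/(w k t i) -mulrBl normrM [X in _ * X]ger0_norm//.
have [->|wn] := eqVneq (w k t i) 0; first by rewrite !mulr0.
have /andP[t1 t2] := w_supp wn.
rewrite ler_wpM2r// ltW// za// /ball/= ltr_norml.
by move: t1 t2 ka; move: (i%:R) (d k) => I D *; apply/andP; split; lra.
Unshelve. all: by end_near. Qed.

End grid_approximation.

(** * Smooth radial functions *)

Section radial_functions.
Context {R : realType} {n : nat}.
Implicit Types (f : R -> R) (x v : 'rV[R]_n).

Lemma is_derive_radial f a x v : is_derive (dotr x x) (1 : R) f a ->
  is_derive x v (fun y => f (dotr y y)) (a * (2 * dotr x v)).
Proof.
move=> fa; apply: is_derive_of_line.
apply: (@is_derive1_comp R f (fun s => dotr (x + s *: v) (x + s *: v))).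
  by rewrite scale0r addr0.
rewrite (_ : (fun s => _) = fun s => s * (dotr v v * s + 2 * dotr x v) + dotr x x).
  have := is_derive1_add (is_derive1_mul (is_derive_id (0 : R) (1 : R)) (is_derive1_affine (dotr v v) (2 * dotr x v) 0))
    (is_derive_cst (dotr x x) (0 : R) (1 : R)).
  by rewrite /= mul0r add0r mulr0 add0r mulr1 addr0.
by apply/funext => s; rewrite !(dotrDl, dotrDr, dotrZl, dotrZr) (dotrC v x); ring.
Qed.

Lemma pderiv_radial f a x i : is_derive (dotr x x) (1 : R) f a ->
  pderiv i (fun y => f (dotr y y)) x = 2 * a * x ord0 i.
Proof.
move=> /is_derive_radial => /(_ (delta_mx ord0 i)) [_].
rewrite /pderiv => ->; rewrite mulrCA mulrA; congr (_ * _).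
rewrite /dotr (bigD1 i)//= mxE !eqxx mulr1 big1 ?addr0// => j ji.
by rewrite mxE (negbTE ji) andbF mulr0.
Qed.

(** Radial functions are written through |x|^2, a polynomial, and not through |x|, which is not
    differentiable at 0. Each derivative has the same form times a coordinate, which feeds the
    induction. *)
Lemma Ck_radial f : (forall j, Sm j f) -> forall k, Ck k (fun x => f (dotr x x)).
Proof.
move=> kf k; elim: k f kf => [|k IH] f kf.
  move=> x; apply: (@continuous_comp _ _ _ (fun x => dotr x x) f); first exact: continuous_dotr.
  exact: (kf 0%N).
have df x := Sm_is_derive (dotr x x) (kf 1%N).
split => [x|i x|i].
- apply: (@continuous_comp _ _ _ (fun x => dotr x x) f); first exact: continuous_dotr.
  exact: (kf 0%N).
- by have [] := is_derive_radial (delta_mx ord0 i) (df x).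
rewrite (_ : pderiv i _ = fun x => 2 * (derive1 f) (dotr x x) * x ord0 i); last first.
  by apply/funext => x; exact: pderiv_radial.
apply: Ck_mul; last exact: Ck_coord.
by apply: Ck_scale; apply: IH => j; have [] := kf j.+1.
Qed.

(** Beyond r^2 - e the derivative of K vanishes, so K is constant there and the support lies in
    |x|^2 <= r^2 - e. *)
Lemma radial_test_function (r e : R) (K eta : R -> R) : 0 < r -> 0 < e ->
  (forall j, Sm j eta) -> (forall t : R, is_derive t (1 : R) K (eta t)) ->
  (forall t, r ^+ 2 - e <= t -> eta t = 0) ->
  test_function (@eball R n r) (fun x => K (dotr x x) - K (r ^+ 2)).
Proof.
move=> r0 e0 keta dK eta0.
have wc a b : {within `[a, b], continuous K}.
  by apply: derivable_within_continuous => x _; have [] := dK x.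
have K0 t : r ^+ 2 - e <= t -> K t = K (r ^+ 2).
  move=> te; apply/eqP; rewrite -subr_eq0.
  have [tr|/ltW tr] := leP (r ^+ 2) t.
    have [c cin ->] := MVT_segment tr (fun z _ => dK z) (wc _ _).
    rewrite eta0 ?mul0r//; move: cin; rewrite in_itv/= => /andP[c1 c2].
    by rewrite (le_trans _ c1)// gerBl ltW.
  have [c cin E] := MVT_segment tr (fun z _ => dK z) (wc _ _).
  rewrite -opprB E eta0 ?mul0r ?oppr0//; move: cin; rewrite in_itv/= => /andP[c1 c2].
  by rewrite (le_trans _ c1).
have H : closure [set x : 'rV[R]_n | K (dotr x x) - K (r ^+ 2) != 0] `<=`
    [set x | dotr x x <= r ^+ 2 - e].
  have clo : closed [set x : 'rV[R]_n | dotr x x <= r ^+ 2 - e].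
    rewrite (_ : mkset _ = (fun x => dotr x x) @^-1` `]-oo, r ^+ 2 - e]%classic).
      apply: preimage_closed; first by move=> z _; exact: continuous_dotr.
      exact: interval_closed.
    by apply/seteqP; split => z; rewrite /= in_itv/=.
  move/closure_id : clo => clo; rewrite [X in _ `<=` X]clo; apply: closureS => x /=.
  by apply: contraNT; rewrite -ltNge => /ltW/K0->; rewrite subrr.
have sub : closure [set x : 'rV[R]_n | K (dotr x x) - K (r ^+ 2) != 0] `<=` eball r.
  move=> x /H /= xr; rewrite /eball /= -ltr_sqr ?nnegrE ?enorm_ge0 ?(ltW r0)//.
  by rewrite sqr_enorm (le_lt_trans xr)// gtrBl.
split => //.
  move=> k; apply: (@Ck_radial (fun t => K t - K (r ^+ 2))) => -[|j].
    by move=> t; apply: (continuous_sub (g := fun=> K (r ^+ 2))) => u;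
      [exact: is_derive1_continuous (dK u)|exact: cst_continuous].
  apply: (@Sm_intro _ _ _ eta) => // t.
  by have := is_derive1_add (dK t) (is_derive_cst (- K (r ^+ 2)) t 1); rewrite addr0.
apply: bounded_closed_compact; last exact: closed_closure.
exists r; split; first exact: num_real.
move=> M rM x /sub /= xr; rewrite [leLHS]/Num.norm /= mx_normrE.
apply/bigmax_leP; split => [|[i j] _ /=]; first by rewrite (le_trans (ltW r0))// ltW.
rewrite (ord1 i) (le_trans (coord_le_enorm _ _))// ltW//.
exact: lt_trans xr rM.
Qed.

End radial_functions.

(** * The p-th power integral *)

(** The p-th power of the L^p norm: without the root, estimates remain inequalities between
    integrals. *)
HB.lock Definition Ip d (T : measurableType d) (R : realType)
  (mu : {measure set T -> \bar R}) (D : set T) (p : R) (f : T -> R) : \bar R :=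
  (\int[mu]_(x in D) (`|f x| `^ p)%:E)%E.

Section Lp_tools.
Context d {T : measurableType d} {R : realType}.
Variables (mu : {measure set T -> \bar R}) (D : set T) (mD : measurable D).
Implicit Types (f g : T -> R) (p q e : R).

Lemma IpE p f : Ip mu D p f = (\int[mu]_(x in D) (`|f x| `^ p)%:E)%E.
Proof. by rewrite unlock. Qed.

Lemma Ip_ge0 p f : (0 <= Ip mu D p f)%E.
Proof. by rewrite IpE; apply: integral_ge0 => x _; rewrite lee_fin powR_ge0. Qed.

Lemma measurable_powR_norm p f : measurable_fun D f ->
  measurable_fun D (fun x => (`|f x| `^ p)%:E).
Proof.
move=> mf; apply/measurable_EFinP.
apply: (@measurableT_comp _ _ _ _ _ _ (@powR R ^~ p)); first exact: measurable_powR.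
exact: measurableT_comp.
Qed.

Lemma powR_add_le (a b p : R) : 0 <= a -> 0 <= b -> 0 <= p ->
  (a + b) `^ p <= 2 `^ p * (a `^ p + b `^ p).
Proof.
move=> a0 b0 p0.
wlog ab : a b a0 b0 / a <= b.
  move=> H; have [ab|/ltW ba] := leP a b; first exact: H.
  by rewrite addrC [_ `^ p + _]addrC; exact: H.
apply: (@le_trans _ _ ((2 * b) `^ p)).
  by rewrite ge0_ler_powR ?nnegrE ?addr_ge0 ?mulr_ge0// mulr_natl mulr2n lerD2r.
by rewrite powRM// ler_wpM2l ?powR_ge0// lerDr powR_ge0.
Qed.

Lemma Ip_add p f g (h : T -> R) : 0 <= p -> measurable_fun D f -> measurable_fun D g ->
  measurable_fun D h ->
  (forall x, D x -> `|h x| <= `|f x| + `|g x|) ->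
  (Ip mu D p h <= (2 `^ p)%:E * (Ip mu D p f + Ip mu D p g))%E.
Proof.
move=> p0 mf mg mh hfg; rewrite !IpE -ge0_integralD//; first last.
- exact: measurable_powR_norm.
- exact: measurable_powR_norm.
rewrite -ge0_integralZl//; first last.
- by move=> x _; rewrite adde_ge0// lee_fin powR_ge0.
- by apply: emeasurable_funD; exact: measurable_powR_norm.
apply: ge0_le_integral => //.
- exact: measurable_powR_norm.
- by apply: emeasurable_funM => //; apply: emeasurable_funD; exact: measurable_powR_norm.
move=> x Dx; rewrite -EFinD -EFinM lee_fin.
apply: le_trans (powR_add_le _ _ p0) => //.
by rewrite ge0_ler_powR ?nnegrE ?addr_ge0//; exact: hfg.
Qed.

Lemma Ip_scale p f (c : R) : 0 <= p -> measurable_fun D f ->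
  Ip mu D p (fun x => c * f x) = ((`|c| `^ p)%:E * Ip mu D p f)%E.
Proof.
move=> p0 mf; rewrite !IpE -ge0_integralZl//; last exact: measurable_powR_norm.
by apply: eq_integral => x _; rewrite normrM powRM// EFinM.
Qed.

Lemma le_Ip p f g : 0 <= p -> measurable_fun D f -> measurable_fun D g ->
  (forall x, D x -> `|f x| <= `|g x|) -> (Ip mu D p f <= Ip mu D p g)%E.
Proof.
move=> p0 mf mg fg; rewrite !IpE; apply: ge0_le_integral => //.
- exact: measurable_powR_norm.
- exact: measurable_powR_norm.
by move=> x Dx; rewrite lee_fin ge0_ler_powR ?nnegrE//; exact: fg.
Qed.

(** Below e the first term suffices, above it (a / e)^q <= (a / e)^p. As e is free, on a set of
    finite measure this turns convergence in L^p into convergence in L^q. *)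
Lemma powR_interp (a e p q : R) : 0 <= a -> 0 < e -> 0 <= q <= p ->
  a `^ q <= e `^ q + e `^ (q - p) * a `^ p.
Proof.
move=> a0 e0 /andP[q0 qp]; have [ae|ea] := leP a e.
  apply: (@le_trans _ _ (e `^ q)); first by rewrite ge0_ler_powR ?nnegrE// ltW.
  by rewrite lerDl mulr_ge0// powR_ge0.
have a1 : 0 < a by exact: lt_trans ea.
have -> : a `^ q = a `^ (q - p) * a `^ p.
  by rewrite -powRD ?subrK// (gt_eqF a1) implybT.
apply: (@le_trans _ _ (e `^ (q - p) * a `^ p)); last by rewrite lerDr powR_ge0.
rewrite ler_wpM2r ?powR_ge0// -opprB !powRN lef_pV2 ?posrE ?powR_gt0//.
by rewrite ge0_ler_powR ?nnegrE ?subr_ge0// ltW.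
Qed.

Lemma Ip_interp p q e f : 0 < e -> 0 <= q <= p -> measurable_fun D f ->
  (Ip mu D q f <= (e `^ q)%:E * mu D + (e `^ (q - p))%:E * Ip mu D p f)%E.
Proof.
move=> e0 qp mf; rewrite !IpE -ge0_integralZl//; first last.
- by rewrite lee_fin powR_ge0.
- exact: measurable_powR_norm.
rewrite -integral_cst// -ge0_integralD//; first last.
- by apply: emeasurable_funM => //; exact: measurable_powR_norm.
- by move=> x _; rewrite mule_ge0// lee_fin powR_ge0.
- by move=> x _; rewrite /= lee_fin powR_ge0.
apply: ge0_le_integral => //.
- exact: measurable_powR_norm.
- apply: emeasurable_funD => //; apply: emeasurable_funM => //.
  exact: measurable_powR_norm.
by move=> x Dx; rewrite -EFinM -EFinD lee_fin powR_interp.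
Qed.

Lemma cvge0P (I : Type) (F : set_system I) {FF : Filter F} (x : I -> \bar R) :
  (forall i, 0 <= x i)%E ->
  x @ F --> 0%E <-> forall e : R, 0 < e -> \forall i \near F, (x i <= e%:E)%E.
Proof.
move=> x0; split => [/fine_cvgP[xfin xcvg] e e0|H].
  move/cvgrPdist_le : xcvg => /(_ _ e0); apply: filterS2 xfin => i xi.
  rewrite sub0r normrN ger0_norm ?fine_ge0// => xe.
  by rewrite -(fineK xi) lee_fin.
apply/fine_cvgP; split.
  have := H 1 ltr01; apply: filterS => i xi.
  by rewrite ge0_fin_numE// (le_lt_trans xi) ?ltry.
apply/cvgrPdist_le => e e0; have := H e e0; apply: filterS => i xi /=.
rewrite sub0r normrN ger0_norm ?fine_ge0// -lee_fin fineK//.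
by rewrite ge0_fin_numE// (le_lt_trans xi) ?ltry.
Qed.

Lemma poweR_le_iff (x : \bar R) (p e : R) : 0 < p -> 0 <= e -> (0 <= x)%E ->
  (x `^ p^-1 <= e%:E)%E <-> (x <= (e `^ p)%:E)%E.
Proof.
move=> p0 e0; have pi0 : 0 < p^-1 by rewrite invr_gt0.
case: x => [x|_|//]; rewrite ?lee_fin; last first.
  by rewrite poweRyr ?gt_eqF//; split => //; rewrite leye_eq.
move=> x0; split => H.
  have -> : x = (x `^ p^-1) `^ p by rewrite -powRrM mulVf ?gt_eqF// powRr1.
  by rewrite ge0_ler_powR ?nnegrE ?powR_ge0// ltW.
have -> : e = (e `^ p) `^ p^-1 by rewrite -powRrM mulfV ?gt_eqF// powRr1.
by rewrite ge0_ler_powR ?nnegrE ?powR_ge0// ltW.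
Qed.

Lemma cvg_poweR0 (I : Type) (F : set_system I) {FF : Filter F} (x : I -> \bar R) (p : R) :
  0 < p -> (forall i, 0 <= x i)%E ->
  (x i `^ p^-1)%E @[i --> F] --> 0%E <-> x @ F --> 0%E.
Proof.
move=> p0 x0; rewrite !cvge0P//; last by move=> i; exact: poweR_ge0.
split => H e e0.
  have e1 : 0 < e `^ p^-1 by exact: powR_gt0.
  have := H _ e1; apply: filterS => i /(poweR_le_iff p0 (ltW e1) (x0 i)).
  by rewrite -powRrM mulVf ?gt_eqF// powRr1// ltW.
have := H _ (powR_gt0 p e0); apply: filterS => i xi.
by apply/(poweR_le_iff p0 (ltW e0) (x0 i)).
Qed.

(** Young's inequality for a / s and s b, with the factors 1/p and 1/q bounded by 1. The free scale
    s later balances the two terms of a pairing. *)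
Lemma young_scaled (a b s p q : R) : 0 <= a -> 0 <= b -> 0 < s -> 1 < p -> 1 < q ->
  p^-1 + q^-1 = 1 -> a * b <= s `^ (- p) * a `^ p + s `^ q * b `^ q.
Proof.
move=> a0 b0 s0 p1 q1 pq.
have [p0 q0] : 0 < p /\ 0 < q by split; lra.
have -> : a * b = (s^-1 * a) * (s * b) by rewrite mulrACA mulVf ?gt_eqF// mul1r.
apply: le_trans (conjugate_powR _ _ p0 q0 pq) _; rewrite ?mulr_ge0 ?invr_ge0 ?(ltW s0)//.
rewrite !powRM ?invr_ge0 ?(ltW s0)//.
have -> : s^-1 `^ p = s `^ (- p) by rewrite -powR_inv1 ?(ltW s0)// -powRrM mulN1r.
apply: lerD; rewrite ler_pdivrMr// ler_peMr ?(ltW p1) ?(ltW q1)// mulr_ge0 ?powR_ge0//.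
Qed.

End Lp_tools.

(** * Pairings of conjugate exponents *)

Section Lp_pairing.
Context d {T : measurableType d} {R : realType}.
Variables (mu : {measure set T -> \bar R}) (D : set T) (mD : measurable D).
Implicit Types (f g K : T -> R) (p q : R).

Lemma integrable_pairing p q K f : 1 < p -> 1 < q -> p^-1 + q^-1 = 1 ->
  measurable_fun D K -> measurable_fun D f ->
  (Ip mu D q K < +oo)%E -> (Ip mu D p f < +oo)%E ->
  mu.-integrable D (EFin \o (fun x => K x * f x)).
Proof.
move=> p1 q1 pq mK mf Koo foo; apply/integrableP; split.
  by apply/measurable_EFinP; exact: measurable_funM.
apply: (@le_lt_trans _ _ (Ip mu D p f + Ip mu D q K)%E); last exact: (lte_add_pinfty foo Koo).
rewrite !IpE -ge0_integralD//; [|exact: measurable_powR_norm|exact: measurable_powR_norm].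
apply: ge0_le_integral => //.
- by apply: measurableT_comp => //; apply/measurable_EFinP; exact: measurable_funM.
- by apply: emeasurable_funD; exact: measurable_powR_norm.
move=> x Dx; rewrite -EFinD lee_fin normrM mulrC.
have := @young_scaled _ `|f x| `|K x| 1 p q (normr_ge0 _) (normr_ge0 _) ltr01 p1 q1 pq.
by rewrite !powR1 !mul1r.
Qed.

Lemma Rintegral_pairing_le p q s K f : 1 < p -> 1 < q -> p^-1 + q^-1 = 1 -> 0 < s ->
  measurable_fun D K -> measurable_fun D f ->
  (Ip mu D q K < +oo)%E -> (Ip mu D p f < +oo)%E ->
  `|\int[mu]_(x in D) (K x * f x)| <=
  s `^ (- p) * fine (Ip mu D p f) + s `^ q * fine (Ip mu D q K).
Proof.
move=> p1 q1 pq s0 mK mf Koo foo.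
have I := integrable_pairing p1 q1 pq mK mf Koo foo.
rewrite (le_trans (le_normr_Rintegral mD I))//.
have Jf : (\int[mu]_(x in D) `|K x * f x|%:E)%E \is a fin_num.
  by apply: integrable_fin_num => //; exact: (integrable_norm I).
have Ff : Ip mu D p f \is a fin_num by rewrite (ge0_fin_numE (Ip_ge0 _ _ _ _)); exact: foo.
have Kf : Ip mu D q K \is a fin_num by rewrite (ge0_fin_numE (Ip_ge0 _ _ _ _)); exact: Koo.
rewrite -lee_fin EFinD !EFinM (fineK Ff) (fineK Kf) (fineK Jf).
rewrite !IpE -!ge0_integralZl//; [|exact: measurable_powR_norm|by rewrite lee_fin powR_ge0|
  exact: measurable_powR_norm|by rewrite lee_fin powR_ge0].
rewrite -ge0_integralD//; first last.
- by apply: emeasurable_funM => //; exact: measurable_powR_norm.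
- by move=> x _; rewrite mule_ge0// lee_fin powR_ge0.
- by apply: emeasurable_funM => //; exact: measurable_powR_norm.
- by move=> x _; rewrite mule_ge0// lee_fin powR_ge0.
apply: ge0_le_integral => //.
- by apply/measurable_EFinP; apply: measurableT_comp => //; exact: measurable_funM.
- by apply: emeasurable_funD; apply: emeasurable_funM => //; exact: measurable_powR_norm.
move=> x Dx; rewrite -!EFinM -EFinD lee_fin normrM mulrC.
exact: (@young_scaled _ `|f x| `|K x| s p q).
Qed.

Lemma cvg_pairing p q K f (f_ : nat -> T -> R) : 1 < p -> 1 < q -> p^-1 + q^-1 = 1 ->
  measurable_fun D K -> measurable_fun D f -> (forall k, measurable_fun D (f_ k)) ->
  (Ip mu D q K < +oo)%E -> (Ip mu D p f < +oo)%E ->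
  (forall k, Ip mu D p (f_ k) < +oo)%E ->
  Ip mu D p (f_ k \- f) @[k --> \oo] --> 0%E ->
  \int[mu]_(x in D) (K x * f_ k x) @[k --> \oo] --> \int[mu]_(x in D) (K x * f x).
Proof.
move=> p1 q1 pq mK mf mf_ Koo foo f_oo cf.
have [p0 q0] : 0 < p /\ 0 < q by split; lra.
apply/cvgrPdist_le => e e0.
set I := fine (Ip mu D q K).
have I0 : 0 <= I by rewrite fine_ge0// Ip_ge0.
(* With s^q = t the term carrying K is at most e / 2 independently of the index; s being fixed, the
   other term follows from the convergence of f_ to f. *)
pose t := e / 2 / (I + 1).
have t0 : 0 < t by rewrite !divr_gt0// ltr_wpDl.
pose s := t `^ q^-1.
have s0 : 0 < s by exact: powR_gt0.
have sq : s `^ q = t by rewrite -powRrM mulVf ?gt_eqF// powRr1// ltW.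
have e1 : 0 < s `^ p * (e / 2) by rewrite mulr_gt0 ?powR_gt0// divr_gt0.
have := cf; rewrite cvge0P; last by move=> k; exact: Ip_ge0.
move=> /(_ _ e1); apply: filterS => k H.
have Hoo : (Ip mu D p (f_ k \- f)%R < +oo)%E by rewrite (le_lt_trans H)// ltry.
rewrite distrC -RintegralB//; [|exact: (integrable_pairing p1 q1 pq mK (mf_ k) Koo (f_oo k))
  |exact: (integrable_pairing p1 q1 pq mK mf Koo foo)].
rewrite (@eq_Rintegral _ _ _ _ _ (fun x => K x * (f_ k \- f) x)); last first.
  by move=> x _ /=; rewrite mulrBr.
have mB : measurable_fun D (f_ k \- f) by exact: measurable_funB.
rewrite (le_trans (Rintegral_pairing_le p1 q1 pq s0 mK mB Koo Hoo))//.
rewrite -/I sq [leRHS]splitr.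
apply: lerD.
  rewrite powRN -ler_pdivlMl ?invr_gt0 ?powR_gt0// invrK.
  by rewrite -lee_fin fineK// ge0_fin_numE// Ip_ge0.
rewrite /t mulrAC ler_pdivrMr ?ltr_wpDl// ler_wpM2l ?divr_ge0 ?(ltW e0)//.
by rewrite lerDl.
Qed.

End Lp_pairing.

Section sobolev_ball.
Context {R : realType} {n : nat} (r p : R).
Hypothesis p1 : 1 < p.
Implicit Types (u v : 'rV[R]_n -> R) (G H : 'rV[R]_n -> 'rV[R]_n).
Local Notation mu := (@lebesgue_rV R n).
Local Notation B := (@eball R n r).
Local Notation E := (Ip mu B p).

Let p0 : 0 < p. Proof. exact: lt_trans ltr01 p1. Qed.
Let mB : measurable B. Proof. exact: measurable_eball. Qed.

Lemma Lp_norm_cvg0 (I : Type) (F : set_system I) {FF : Filter F}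
    (u : I -> 'rV[R]_n -> R) :
  Lp_norm B p (u i) @[i --> F] --> 0%E <-> E (u i) @[i --> F] --> 0%E.
Proof.
rewrite -(@cvg_poweR0 _ _ F FF (fun i => E (u i)) p p0); last by move=> i; exact: Ip_ge0.
suff -> : (fun i => Lp_norm B p (u i)) = (fun i => (E (u i) `^ p^-1)%E) by [].
by apply/funext => i; rewrite IpE; exact: Lp_normE.
Qed.

Lemma Lp_norm_lty u : (Lp_norm B p u < +oo)%E <-> (E u < +oo)%E.
Proof.
rewrite Lp_normE// -IpE; have := Ip_ge0 mu B p u.
case: (E u) => [x||]//= x0; rewrite ?ltry//; split => //.
by rewrite invr_eq0 gt_eqF.
Qed.

Lemma Lp_vnorm_powR G : (Lp_vnorm B p G `^ p)%E = E (enorm \o G).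
Proof.
rewrite /Lp_vnorm Lp_normE// -IpE -poweRrM mulVf ?gt_eqF// poweRe1//.
exact: Ip_ge0.
Qed.

Lemma measurable_dotr_comp G H : (forall i, measurable_fun B (fun x => G x ord0 i)) ->
  (forall i, measurable_fun B (fun x => H x ord0 i)) ->
  measurable_fun B (fun x => dotr (G x) (H x)).
Proof.
by move=> mG mH; apply: measurable_sum => i; exact: measurable_funM.
Qed.

Lemma measurable_enorm_comp G : (forall i, measurable_fun B (fun x => G x ord0 i)) ->
  measurable_fun B (enorm \o G).
Proof.
move=> mG; rewrite (_ : _ \o _ = Num.sqrt \o (fun x => dotr (G x) (G x))).
  apply: measurableT_comp; last exact: measurable_dotr_comp.
  by apply: continuous_measurable_fun; exact: sqrt_continuous.
by apply/funext => x; rewrite /= enormE.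
Qed.

Lemma Ip_continuous_lty q u : 0 <= q -> continuous u -> (Ip mu B q u < +oo)%E.
Proof.
move=> q0 cu.
have mu_ : measurable_fun B u by apply: measurable_funTS; exact: continuous_measurable_rV.
(* With a natural exponent, u^m is again a continuous function, to which
   [integrable_ball_continuous] applies. *)
have [m qm] : exists m : nat, q <= m%:R.
  by exists (Num.bound q); rewrite ltW// archi_boundP.
have qm' : 0 <= q <= m%:R by rewrite q0.
apply: (le_lt_trans (Ip_interp mu mB ltr01 qm' mu_)).
rewrite !powR1 !mul1e; apply: lte_add_pinfty; first exact: mu_eball_fin.
have : mu.-integrable B (EFin \o (fun x => u x ^+ m)).
  apply: integrable_ball_continuous => x.
  exact: (@continuous_comp _ _ _ u (fun y => y ^+ m) x (cu x) (@exprn_continuous _ m _)).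
move=> /integrableP[_]; apply: le_lt_trans.
rewrite le_eqVlt; apply/orP; left; apply/eqP; rewrite IpE; apply: eq_integral => x _ /=.
by rewrite powR_mulrn// normrX.
Qed.

Lemma enormE_grad_lty u : C1 u -> (E (enorm \o grad u) < +oo)%E.
Proof.
move=> [_ _ cu]; apply: Ip_continuous_lty; first exact: ltW.
move=> x; apply: (@continuous_comp _ _ _ (fun x => dotr (grad u x) (grad u x)) Num.sqrt).
  apply: (@continuous_sum_ord _ _ _ (fun i x => grad u x ord0 i * grad u x ord0 i)) => i.
  by rewrite /grad; under eq_fun do rewrite !mxE; exact: continuous_mul.
exact: sqrt_continuous.
Qed.

Lemma measurable_C1 u : C1 u -> measurable_fun B u.
Proof. by move=> [cu _ _]; apply: measurable_funTS; exact: continuous_measurable_rV. Qed.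

Lemma measurable_grad_C1 u i : C1 u -> measurable_fun B (fun x => grad u x ord0 i).
Proof.
move=> [_ _ cu]; apply: measurable_funTS; apply: continuous_measurable_rV.
by rewrite /grad; under eq_fun do rewrite mxE; exact: cu.
Qed.

End sobolev_ball.

(** * The Sobolev space of the ball *)

Section Lp_null.
Context d {T : measurableType d} {R : realType}.
Variables (mu : {measure set T -> \bar R}) (D : set T) (mD : measurable D).
Implicit Types (f g : T -> R) (p q : R).

Lemma Ip_eq0_ae p f : 0 < p -> measurable_fun D f -> Ip mu D p f = 0%E ->
  {ae mu, forall x, D x -> f x = 0}.
Proof.
move=> p0 mf If.
have := (ae_eq_integral_abs mu mD (measurable_powR_norm p mf)).1.
case.
  by rewrite -[RHS]If IpE; apply: eq_integral => x _; rewrite gee0_abs// lee_fin powR_ge0.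
move=> N [mN N0 sN]; exists N; split => // x /= xn; apply: sN => /= H; apply: xn => Dx.
have [/eqP] := H Dx; rewrite powR_eq0 normr_eq0 => /andP[/eqP]//.
Qed.

Lemma Ip_ae_eq p f g : measurable_fun D f -> measurable_fun D g ->
  {ae mu, forall x, D x -> f x = g x} -> Ip mu D p f = Ip mu D p g.
Proof.
move=> mf mg fg; rewrite !IpE; apply: ae_eq_integral => //; try exact: measurable_powR_norm.
by apply: filterS fg => x H Dx; rewrite H.
Qed.

Lemma cvg_Ip_interp p q (f_ : nat -> T -> R) : (mu D < +oo)%E -> 0 < q <= p ->
  (forall k, measurable_fun D (f_ k)) ->
  Ip mu D p (f_ k) @[k --> \oo] --> 0%E -> Ip mu D q (f_ k) @[k --> \oo] --> 0%E.
Proof.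
move=> Doo /andP[q0 qp] mf; rewrite !cvge0P; [|by move=> ?; exact: Ip_ge0|by move=> ?; exact: Ip_ge0].
move=> H e e0.
have [V V0 muV] : exists2 V, 0 <= V & mu D = V%:E.
  exists (fine (mu D)); first exact: fine_ge0.
  by rewrite fineK// ge0_fin_numE.
pose t := (e / 2 / (V + 1)).
have t0 : 0 < t by rewrite !divr_gt0// ltr_wpDl.
pose s := t `^ q^-1.
have s0 : 0 < s by exact: powR_gt0.
have sq : s `^ q = t by rewrite -powRrM mulVf ?gt_eqF// powRr1// ltW.
have e1 : 0 < (s `^ (q - p))^-1 * (e / 2) 
  by apply: mulr_gt0; [rewrite invr_gt0; exact: powR_gt0|exact: divr_gt0].
have := H _ e1; apply: filterS => k Hk.
have qp' : 0 <= q <= p by rewrite ltW.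
apply: (le_trans (Ip_interp mu mD s0 qp' (mf k))).
rewrite (splitr e) EFinD; apply: leeD.
  rewrite muV sq -EFinM lee_fin /t mulrAC ler_pdivrMr ?ltr_wpDl//.
  by rewrite ler_wpM2l ?divr_ge0 ?(ltW e0)// lerDl.
apply: (@le_trans _ _ ((s `^ (q - p))%:E * ((s `^ (q - p))^-1 * (e / 2))%:E)%E).
  by apply: lee_wpmul2l => //; rewrite lee_fin powR_ge0.
by rewrite -EFinM lee_fin mulrA mulfV ?mul1r// gt_eqF// powR_gt0.
Qed.

Lemma cvge0_le (x y : nat -> \bar R) : (forall k, 0 <= x k)%E -> (forall k, x k <= y k)%E ->
  y @ \oo --> 0%E -> x @ \oo --> 0%E.
Proof.
move=> x0 xy cy; apply: (@squeeze_cvge _ _ _ _ (cst 0%E) _ y) => //; last exact: cvg_cst.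
by apply: nearW => k; rewrite x0 xy.
Qed.

Lemma cvge0_scale (c : R) (x : nat -> \bar R) :
  x @ \oo --> 0%E -> (c%:E * x k)%E @[k --> \oo] --> 0%E.
Proof. by move=> cx; rewrite -[X in _ --> X](mule0 c%:E); exact: cvgeZl. Qed.

Lemma cvge0_add_scale (c : R) (x y z : nat -> \bar R) : 0 <= c ->
  (forall k, 0 <= x k)%E -> (forall k, 0 <= y k)%E -> (forall k, 0 <= z k)%E ->
  (forall k, z k <= c%:E * (x k + y k))%E ->
  x @ \oo --> 0%E -> y @ \oo --> 0%E -> z @ \oo --> 0%E.
Proof.
move=> c0 x0 y0 z0 zxy cx cy; apply: (cvge0_le z0 zxy).
rewrite -[0%E in X in _ --> X](mule0 c%:E) -[X in (c%:E * X)%E](adde0 0%E).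
by apply: cvgeZl => //; apply: cvgeD.
Qed.

End Lp_null.

Section sobolev_space.
Context {R : realType} {n : nat} (r p : R).
Hypothesis p1 : 1 < p.
Implicit Types (u v : 'rV[R]_n -> R) (G H : 'rV[R]_n -> 'rV[R]_n).
Local Notation mu := (@lebesgue_rV R n).
Local Notation B := (@eball R n r).
Local Notation E := (Ip mu B p).

Let p0 : 0 < p. Proof. exact: lt_trans ltr01 p1. Qed.
Let mB : measurable B. Proof. exact: measurable_eball. Qed.
Let q := p / (p - 1).
Let q1 : 1 < q.
Proof. by rewrite /q ltr_pdivlMr ?subr_gt0// mul1r gtrBl. Qed.
Let pq : p^-1 + q^-1 = 1.
Proof. by rewrite /q invf_div; field; rewrite gt_eqF. Qed.

Lemma measurable_subG G H : (forall i, measurable_fun B (fun x => G x ord0 i)) ->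
  (forall i, measurable_fun B (fun x => H x ord0 i)) ->
  forall i, measurable_fun B (fun x => (G \- H) x ord0 i).
Proof.
move=> mG mH i; rewrite (_ : (fun x => _) = (fun x => G x ord0 i - H x ord0 i)).
  exact: measurable_funB.
by apply/funext => x; rewrite !mxE.
Qed.

(** All of [W1p] follows from the approximation: finiteness of the norms from one approximant at
    distance at most 1, and the weak gradient identity by passing to the limit in pairings with the
    test function and its derivative. *)
Lemma W01p_of_approx u G (phi : nat -> 'rV[R]_n -> R) :
  measurable_fun B u -> (forall i, measurable_fun B (fun x => G x ord0 i)) ->
  (forall k, test_function B (phi k)) ->
  E (phi k \- u) @[k --> \oo] --> 0%E ->
  E (enorm \o (grad (phi k) \- G)) @[k --> \oo] --> 0%E ->
  W01p B p u G.
Proof.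
move=> mu_ mG tphi c1 c2.
have C1phi k := test_C1 (tphi k).
have mphi k : measurable_fun B (phi k) by exact: measurable_C1.
have mgphi k i : measurable_fun B (fun x => grad (phi k) x ord0 i) by exact: measurable_grad_C1.
have cphi k : continuous (phi k) by have [] := C1phi k.
have Ephi k : (E (phi k) < +oo)%E by apply: Ip_continuous_lty => //; exact: ltW.
have Egphi k : (E (enorm \o grad (phi k)) < +oo)%E by exact: enormE_grad_lty.
have mdG k : measurable_fun B (enorm \o (grad (phi k) \- G)).
  by apply: measurable_enorm_comp; exact: measurable_subG.
have md k : measurable_fun B (phi k \- u) by exact: measurable_funB.
have [k0 [d1 d2]] : exists k, (E (phi k \- u)%R <= 1%:E)%E /\ (E (enorm \o (grad (phi k) \- G))%R <= 1%:E)%E.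
  have h1 : \forall k \near \oo, (E (phi k \- u)%R <= 1%:E)%E.
    by move: c1; rewrite cvge0P; [by move/(_ _ ltr01)|move=> k; exact: Ip_ge0].
  have h2 : \forall k \near \oo, (E (enorm \o (grad (phi k) \- G))%R <= 1%:E)%E.
    by move: c2; rewrite cvge0P; [by move/(_ _ ltr01)|move=> k; exact: Ip_ge0].
  have [k _ Hk] := filterI h1 h2.
  by exists k; have [] := Hk k (leqnn k).
have Eu : (E u < +oo)%E.
  apply: (@le_lt_trans _ _ ((2 `^ p)%:E * (E (phi k0) + E (phi k0 \- u)%R))%E).
    apply: Ip_add => //; first exact: ltW.
    by move=> x _; rewrite /= distrC -{1}(subrK (phi k0 x) (u x)) addrC ler_normD.
  apply: lte_mul_pinfty; rewrite ?lee_fin ?powR_ge0//.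
  by apply: lte_add_pinfty; [exact: Ephi|exact: le_lt_trans d1 (ltry _)].
have EG : (E (enorm \o G) < +oo)%E.
  apply: (@le_lt_trans _ _ ((2 `^ p)%:E * (E (enorm \o grad (phi k0)) +
      E (enorm \o (grad (phi k0) \- G))%R))%E).
    apply: Ip_add => //.
    - exact: ltW.
    - exact: measurable_enorm_comp.
    - exact: measurable_enorm_comp.
    move=> x _ /=; rewrite !ger0_norm ?enorm_ge0//.
    rewrite -[enorm (_ - G x)]enormN opprB.
    by rewrite -{1}(subrK (grad (phi k0) x) (G x)) addrC; exact: enormD.
  apply: lte_mul_pinfty; rewrite ?lee_fin ?powR_ge0//.
  by apply: lte_add_pinfty; [exact: Egphi|exact: le_lt_trans d2 (ltry _)].
split; last first.
  by exists phi; split; [exact: tphi|exact/Lp_norm_cvg0|exact/Lp_norm_cvg0].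
split.
- by split => //; apply/Lp_norm_lty.
- exact: mG.
- by apply/Lp_norm_lty.
move=> psi tpsi i.
have C1psi := test_C1 tpsi; have [cpsi _ dpsi] := C1psi.
have mpsi : measurable_fun B psi by exact: measurable_C1.
have mdpsi : measurable_fun B (pderiv i psi).
  by apply: measurable_funTS; apply: continuous_measurable_rV; exact: dpsi.
have q0 : 0 <= q by apply: ltW; apply: lt_trans q1.
have L1 := cvg_pairing mB p1 q1 pq mdpsi mu_ mphi
  (Ip_continuous_lty r q0 (dpsi i)) Eu Ephi c1.
have mGk k : measurable_fun B (pderiv i (phi k)).
  by have := mgphi k i; rewrite /grad; under eq_fun do rewrite mxE.
have leE (K : 'rV[R]_n -> 'rV[R]_n) : (forall j, measurable_fun B (fun x => K x ord0 j)) ->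
    (E (fun x => K x ord0 i) <= E (enorm \o K))%E.
  move=> mK; apply: le_Ip => //; first exact: ltW.
  - exact: measurable_enorm_comp.
  by move=> x _ /=; rewrite (ger0_norm (enorm_ge0 _)) coord_le_enorm.
have EGi : (E (fun x => G x ord0 i) < +oo)%E by apply: le_lt_trans (leE _ mG) EG.
have Egi k : (E (pderiv i (phi k)) < +oo)%E.
  apply: le_lt_trans (Egphi k); have := leE (grad (phi k)) (mgphi k).
  by rewrite {1}/grad; under eq_fun do rewrite mxE.
have c3 : E (pderiv i (phi k) \- (fun x => G x ord0 i)) @[k --> \oo] --> 0%E.
  apply: cvge0_le c2 => [k|k]; first exact: Ip_ge0.
  have := leE (grad (phi k) \- G) (measurable_subG (mgphi k) mG).
  by rewrite (_ : (fun x => (grad (phi k) \- G) x ord0 i) =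
    (pderiv i (phi k) \- (fun x => G x ord0 i)))//; apply/funext => x; rewrite !mxE.
have L2 := cvg_pairing mB p1 q1 pq mpsi (mG i) mGk
  (Ip_continuous_lty r q0 cpsi) EGi Egi c3.
have -> : \int[mu]_(x in B) (u x * pderiv i psi x) = \int[mu]_(x in B) (pderiv i psi x * u x).
  by apply: eq_Rintegral => x _; rewrite mulrC.
have -> : \int[mu]_(x in B) (G x ord0 i * psi x) = \int[mu]_(x in B) (psi x * G x ord0 i).
  by apply: eq_Rintegral => x _; rewrite mulrC.
have EQ : (fun k => \int[mu]_(x in B) (pderiv i psi x * phi k x)) =
    (fun k => - \int[mu]_(x in B) (psi x * pderiv i (phi k) x)).
  apply/funext => k; rewrite (integration_by_parts_ball C1psi (C1phi k)) ?opprK// => x nx.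
  by split; [exact: test_out tpsi nx|exact: test_pderiv_out tpsi nx].
rewrite -(cvg_lim (@Rhausdorff R) L1) EQ; apply: cvg_lim; first exact: Rhausdorff.
exact: cvgN L2.
Qed.

Lemma grad_lincomb u v (c : R) x : C1 u -> C1 v ->
  grad (fun x => u x + c * v x) x = grad u x + c *: grad v x.
Proof.
move=> [_ du _] [_ dv _]; apply/rowP => i; rewrite !mxE.
have dcv : derivable (fun x => c * v x) x (delta_mx ord0 i) by exact: derivableZ.
rewrite pderivD; [|exact: du|exact: dcv]; congr (_ + _); rewrite /pderiv.
by rewrite (_ : (fun x => c * v x) = c \*: v)// deriveZ.
Qed.

Lemma W01p_facts u G : W01p B p u G -> [/\ measurable_fun B u, (E u < +oo)%E,
  forall i, measurable_fun B (fun x => G x ord0 i), (E (enorm \o G) < +oo)%E &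
  exists phi : nat -> 'rV[R]_n -> R, [/\ forall k, test_function B (phi k),
    E (phi k \- u) @[k --> \oo] --> 0%E &
    E (enorm \o (grad (phi k) \- G)) @[k --> \oo] --> 0%E]].
Proof.
move=> [[[mu_ Lu] mG LG _] [phi [tphi c1 c2]]]; split => //.
- exact/Lp_norm_lty.
- exact/Lp_norm_lty.
by exists phi; split => //; exact/Lp_norm_cvg0.
Qed.

Lemma W01p_lincomb u G v H (c : R) : W01p B p u G -> W01p B p v H ->
  W01p B p (fun x => u x + c * v x) (fun x => G x + c *: H x).
Proof.
move=> /W01p_facts[mu_ _ mG _ [phi [tphi c1 c2]]] /W01p_facts[mv _ mH _ [psi [tpsi c3 c4]]].
have C1phi k := test_C1 (tphi k); have C1psi k := test_C1 (tpsi k).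
have mphi k : measurable_fun B (phi k) by exact: measurable_C1.
have mpsi k : measurable_fun B (psi k) by exact: measurable_C1.
have mgphi k i : measurable_fun B (fun x => grad (phi k) x ord0 i) by exact: measurable_grad_C1.
have mgpsi k i : measurable_fun B (fun x => grad (psi k) x ord0 i) by exact: measurable_grad_C1.
have mcv : measurable_fun B (fun x => c * v x) by exact: measurable_funM.
have mcH i : measurable_fun B (fun x => (c *: H x) ord0 i).
  by under eq_fun do rewrite mxE; exact: measurable_funM.
have m1 k : measurable_fun B (phi k \- u) by exact: measurable_funB.
have m2 k : measurable_fun B (psi k \- v) by exact: measurable_funB.
have m3 k : measurable_fun B (enorm \o (grad (phi k) \- G)).
  by apply: measurable_enorm_comp; exact: measurable_subG.
have m4 k : measurable_fun B (enorm \o (grad (psi k) \- H)).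
  by apply: measurable_enorm_comp; exact: measurable_subG.
have c3' : E (fun x => c * (psi k \- v) x) @[k --> \oo] --> 0%E.
  rewrite (_ : (fun k => _) = (fun k => (`|c| `^ p)%:E * E (psi k \- v)%R)%E).
    exact: cvge0_scale.
  by apply/funext => k; rewrite Ip_scale// ltW.
have c4' : E (fun x => c * (enorm \o (grad (psi k) \- H)) x) @[k --> \oo] --> 0%E.
  rewrite (_ : (fun k => _) = (fun k => (`|c| `^ p)%:E * E (enorm \o (grad (psi k) \- H))%R)%E).
    exact: cvge0_scale.
  by apply/funext => k; rewrite Ip_scale// ltW.
apply: (@W01p_of_approx _ _ (fun k x => phi k x + c * psi k x)).
- exact: measurable_funD.
- by move=> i; under eq_fun do rewrite mxE; exact: measurable_funD.
- by move=> k; apply: test_add => //; exact: test_scale.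
- apply: (cvge0_add_scale (powR_ge0 2 p) _ _ _ _ c1 c3') => k; try exact: Ip_ge0.
  apply: Ip_add => //; first exact: ltW.
  + exact: measurable_funM.
  + by apply: measurable_funB; apply: measurable_funD => //; exact: measurable_funM.
  by move=> x _ /=; rewrite mulrBr opprD addrACA ler_normD.
- apply: (cvge0_add_scale (powR_ge0 2 p) _ _ _ _ c2 c4') => k; try exact: Ip_ge0.
  apply: Ip_add => //; first exact: ltW.
  + exact: measurable_funM.
  + apply: measurable_enorm_comp => i; apply: measurable_subG => j.
      under eq_fun do rewrite grad_lincomb// mxE; apply: measurable_funD => //.
      by under eq_fun do rewrite mxE; exact: measurable_funM.
    by under eq_fun do rewrite mxE; exact: measurable_funD.
  move=> x _ /=; rewrite grad_lincomb// opprD addrACA -scalerBr.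
  by rewrite normrM !(ger0_norm (enorm_ge0 _)) -enormZ enormD.
Qed.

Lemma W01p_scale u G (c : R) : W01p B p u G ->
  W01p B p (fun x => c * u x) (fun x => c *: G x).
Proof.
move=> uG; have := W01p_lincomb (c - 1) uG uG.
rewrite (_ : (fun x => _ + _ * _) = (fun x => c * u x)); last by apply/funext => x; ring.
rewrite (_ : (fun x => _ + _ *: _) = (fun x => c *: G x))//; apply/funext => x.
by rewrite scalerBl scale1r addrC subrK.
Qed.

Lemma W01p_sub u G v H : W01p B p u G -> W01p B p v H ->
  W01p B p (fun x => u x - v x) (fun x => G x - H x).
Proof.
move=> uG vH; have := W01p_lincomb (-1) uG vH.
rewrite (_ : (fun x => _ + _ * _) = (fun x => u x - v x)); last by apply/funext => x; ring.
by rewrite (_ : (fun x => _ + _ *: _) = (fun x => G x - H x))//; apply/funext => x; rewrite scaleN1r.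
Qed.

Lemma W01p_test phi : test_function B phi -> W01p B p phi (grad phi).
Proof.
move=> tphi; have C1phi := test_C1 tphi.
apply: (@W01p_of_approx _ _ (fun=> phi)) => //.
- exact: measurable_C1.
- by move=> i; exact: measurable_grad_C1.
- rewrite (_ : E _ = 0%E); first exact: cvg_cst.
  rewrite !IpE (eq_integral (cst 0%E)) ?integral0// => x _ /=.
  by rewrite subrr normr0 powR0// gt_eqF.
- rewrite (_ : E _ = 0%E); first exact: cvg_cst.
  rewrite !IpE (eq_integral (cst 0%E)) ?integral0// => x _ /=.
  by rewrite subrr enorm0 normr0 powR0// gt_eqF.
Qed.

End sobolev_space.

Section dominated_Ip.
Context d {T : measurableType d} {R : realType}.
Variables (mu : {measure set T -> \bar R}) (D : set T) (mD : measurable D).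

Lemma cvg_Ip_dominated p (f_ : nat -> T -> R) (g : T -> R) : 0 < p ->
  (forall k, measurable_fun D (f_ k)) -> measurable_fun D g ->
  {ae mu, forall x, D x -> f_ k x @[k --> \oo] --> 0} ->
  {ae mu, forall x k, D x -> `|f_ k x| <= g x} ->
  (Ip mu D p g < +oo)%E -> Ip mu D p (f_ k) @[k --> \oo] --> 0%E.
Proof.
move=> p0 mf mg fc fg goo.
have [|||||_ _] := @dominated_convergence _ _ R mu D mD
   (fun k x => (`|f_ k x| `^ p)%:E) (cst 0%E) (fun x => (`|g x| `^ p)%:E).
- by move=> k; exact: measurable_powR_norm.
- exact: measurable_cst.
- apply: filterS fc => x fx Dx; apply/cvg_EFin; first exact: nearW.
  apply/cvgrPdist_lt => e e0.
  have e1 : 0 < e `^ p^-1 by exact: powR_gt0.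
  have /cvgrPdist_lt/(_ _ e1) := fx Dx; apply: filterS => k /=.
  rewrite !sub0r !normrN => fk; rewrite ger0_norm ?powR_ge0//.
  rewrite (_ : e = (e `^ p^-1) `^ p); last by rewrite -powRrM mulVf ?gt_eqF// powRr1// ltW.
  by rewrite gt0_ltr_powR ?nnegrE// ltW.
- apply/integrableP; split; first exact: measurable_powR_norm.
  rewrite (eq_integral (fun x => (`|g x| `^ p)%:E)) -?IpE// => x _.
  by rewrite gee0_abs// lee_fin powR_ge0.
- apply: filterS fg => x H k Dx; rewrite gee0_abs ?lee_fin ?powR_ge0//.
  have := H k Dx => fgx.
  by rewrite ge0_ler_powR ?nnegrE ?(ltW p0)// (le_trans fgx)// ler_norm.
rewrite integral0; apply: cvg_trans; apply: near_eq_cvg; apply: nearW => k /=.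
by rewrite IpE.
Qed.

End dominated_Ip.

(** * Integrals of powers *)

Section one_dim_integrals.
Context {R : realType}.
Local Notation leb := (@lebesgue_measure R).

Lemma FTC2_itv (F f : R -> R) (a b : R) : a < b ->
  (forall x, a <= x <= b -> is_derive x (1 : R) F (f x)) ->
  (forall x, a <= x <= b -> {for x, continuous f}) ->
  (\int[leb]_(x in `[a, b]) (f x)%:E = (F b - F a)%:E)%E.
Proof.
move=> ab dF cf; rewrite (@continuous_FTC2 _ f F a b ab) ?EFinB//.
- by apply: continuous_in_subspaceT => x; rewrite inE/= in_itv/=; exact: cf.
- have cF x : a <= x <= b -> {for x, continuous F}.
    by move=> /dF/is_derive1_continuous.
  split.
  + move=> x; rewrite in_itv/= => /andP[ax xb].
    by have [] := dF x _; rewrite ?(ltW ax) ?(ltW xb).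
  + by apply: cvg_at_right_filter; apply: cF; rewrite lexx ltW.
  + by apply: cvg_at_left_filter; apply: cF; rewrite lexx ltW.
move=> x; rewrite in_itv/= => /andP[ax xb].
by apply: is_derive1_val; apply: dF; rewrite (ltW ax) (ltW xb).
Qed.

Lemma is_derive_powR_pos (c x : R) : 0 < x ->
  is_derive x (1 : R) (fun y : R => y `^ c) (c * x `^ (c - 1)).
Proof. exact: is_derive1_powR. Qed.

Lemma continuous_powR_pos (c x : R) : 0 < x -> {for x, continuous (fun y : R => y `^ c)}.
Proof. by move=> x0; exact: is_derive1_continuous (is_derive_powR_pos c x0). Qed.

Lemma integral_powR01 (c : R) : -1 < c ->
  (\int[leb]_(s in `]0%R, 1%R[) (s `^ c)%:E = ((c + 1)^-1)%:E)%E.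
Proof.
move=> c1; have c0 : 0 < c + 1 by lra.
rewrite integral_itv_bndo_bndc; last first.
  by apply/measurable_EFinP; apply: measurable_funTS; exact: measurable_powR.
(* For negative c the integrand is singular at 0, so the fundamental theorem is applied on [h k, 1]
   and these intervals exhaust ]0, 1]. *)
pose h (k : nat) : R := k.+2%:R^-1.
have h0 k : 0 < h k by rewrite invr_gt0.
have h1 k : h k < 1 by rewrite invf_lt1// ltr1n.
have E k : (\int[leb]_(s in `[h k, 1%R]) (s `^ c)%:E = ((c + 1)^-1 * (1 - h k `^ (c + 1)))%:E)%E.
  pose F (s : R) := (c + 1)^-1 * s `^ (c + 1).
  transitivity ((F 1 - F (h k))%:E); last by rewrite /F powR1 mulrBr.
  apply: FTC2_itv => //.
  - move=> x /andP[hx _]; have x0 : 0 < x by exact: lt_le_trans hx.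
    have := is_derive1_scale (c + 1)^-1 (is_derive_powR_pos (c + 1) x0).
    by rewrite mulrA mulVf ?gt_eqF// mul1r addrK.
  - by move=> x /andP[hx _]; apply: continuous_powR_pos; exact: lt_le_trans hx.
have U : \bigcup_k `[h k, 1%R]%classic = `]0%R, 1%R]%classic.
  apply/seteqP; split => [x [k _]|x]; rewrite /= !in_itv/= => /andP[x0 x1].
    by rewrite x1 (lt_le_trans (h0 k)).
  have := near_infty_natSinv_lt (PosNum x0) => -[k _ /(_ _ (leqnn k)) /= kx].
  exists k => //; rewrite /= in_itv/= x1 andbT (le_trans _ (ltW kx))//.
  by rewrite lef_pV2 ?posrE// ler_nat.
have H : (\int[leb]_(s in `[h k, 1%R]) (s `^ c)%:E)%E @[k --> \oo] -->
    (\int[leb]_(s in `]0%R, 1%R]) (s `^ c)%:E)%E.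
  rewrite -U; apply: ge0_nondecreasing_set_cvg_integral.
  - move=> m k mk; apply/subsetPset => x /=; rewrite !in_itv/= => /andP[hx ->].
    by rewrite andbT (le_trans _ hx)// lef_pV2 ?posrE// ler_nat.
  - by move=> k; exact: measurable_itv.
  - by move=> k; apply/measurable_EFinP; apply: measurable_funTS; exact: measurable_powR.
  - by move=> k x _; rewrite lee_fin powR_ge0.
apply: (cvg_unique _ H); first exact: ereal_hausdorff.
rewrite (funext E); apply/cvg_EFin; first exact: nearW.
rewrite -[X in _ --> X]mulr1; apply: cvgMl_tmp.
rewrite -[X in _ --> X]subr0; apply: cvgB; first exact: cvg_cst.
apply/cvgrPdist_lt => e e0; near=> k.
rewrite sub0r normrN ger0_norm ?powR_ge0//.
rewrite (_ : e = (e `^ (c + 1)^-1) `^ (c + 1)); last first.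
  by rewrite -powRrM mulVf ?gt_eqF// powRr1// ltW.
rewrite gt0_ltr_powR ?nnegrE ?powR_ge0 ?(ltW (h0 k))//.
apply: (@lt_trans _ _ k.+1%:R^-1); first by rewrite ltf_pV2 ?posrE// ltr_nat.
by near: k; exact: (near_infty_natSinv_lt (PosNum (powR_gt0 _ e0))).
Unshelve. all: by end_near. Qed.

End one_dim_integrals.

Section radial_power.
Context {R : realType} {n : nat} (r : R).
Hypotheses (n0 : (0 < n)%N) (r0 : 0 < r).
Local Notation mu := (@lebesgue_rV R n).
Local Notation B := (@eball R n r).

Lemma Ip_enorm_powR (p b : R) : - n%:R < b * p ->
  Ip mu B p (fun x => enorm x `^ b) =
  (mu B * (r `^ (b * p) * (b * p / n%:R + 1)^-1)%:E)%E.
Proof.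
move=> bp; have n0' : 0 < n%:R :> R by rewrite ltr0n.
rewrite IpE (eq_integral (fun x => ((enorm x `^ (b * p))%:E))); last first.
  by move=> x _; rewrite ger0_norm ?powR_ge0// -powRrM.
have H1 : measurable_fun setT (fun s : measurableTypeR R => (s `^ (b * p))%:E).
  by apply/measurable_EFinP; exact: measurable_powR.
have H2 (s : measurableTypeR R) : (0%R <= (s `^ (b * p))%:E)%E by rewrite lee_fin powR_ge0.
rewrite (radial_integral n0 r0 H1 H2).
congr (_ * _)%E; rewrite EFinM -integral_powR01; last first.
  by rewrite ltr_pdivlMr// mulN1r.
rewrite -ge0_integralZl//; first last.
- by move=> s _; rewrite lee_fin powR_ge0.
- by apply/measurable_EFinP; apply: measurable_funTS; exact: measurable_powR.
apply: eq_integral => s _.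
by rewrite powRM ?powR_ge0 ?(ltW r0)// -powRrM EFinM mulrC [_^-1 * _]mulrC.
Qed.

Lemma Ip_enorm_powR_lty (p b : R) : - n%:R < b * p ->
  (Ip mu B p (fun x => enorm x `^ b)%R < +oo)%E.
Proof.
move=> bp; rewrite Ip_enorm_powR// lte_mul_pinfty//.
  by rewrite ge0_fin_numE// mu_eball_fin.
by rewrite ltry.
Qed.

Lemma mu_set0_eq0 : mu [set 0] = 0%E.
Proof.
have [V V0 muV] : exists2 V : R, 0 < V & mu B = V%:E.
  have := mu_eball_gt0 (n := n) r0; have := mu_eball_fin (n := n) r.
  by case: (mu B) => [v _|//|//]; rewrite lte_fin; exists v.
have m0 : measurable [set 0 : 'rV[R]_n].
  rewrite (_ : [set 0] = [set v : 'rV[R]_n | forall i, [set 0 : R] (v ord0 i)]).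
    by apply: (@measurable_box_rV R n (fun=> [set 0])) => i; exact: measurable_set1.
  apply/seteqP; split => [x -> i|x x0]; first by rewrite /= mxE.
  by apply/rowP => i; rewrite mxE; exact: x0.
apply/eqP; rewrite eq_le measure_ge0 andbT; apply/lee_addgt0Pr => e e0; rewrite add0e.
(* As s / r <= 1, the ball of radius s has measure V (s / r)^n <= V s / r <= e. *)
pose s := Num.min r (e / V * r).
have s0 : 0 < s by rewrite lt_min r0 mulr_gt0// divr_gt0.
apply: (@le_trans _ _ (mu (eball s))).
  apply: le_measure; rewrite ?inE//; first exact: measurable_eball.
  by move=> x ->; rewrite /eball /= enorm0.
rewrite (mu_eball_scale s0 r0) muV -EFinM lee_fin -ler_pdivlMr//.
have sr : 0 <= s / r <= 1.
  by rewrite divr_ge0 ?(ltW s0) ?(ltW r0)// ler_pdivrMr// mul1r ge_min lexx.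
apply: (@le_trans _ _ (s / r)).
  by rewrite -[leRHS]expr1; case/andP : sr => *; apply: ler_wiXn2l.
by rewrite ler_pdivrMr// ge_min lexx orbT.
Qed.

End radial_power.

(** * Vanishing gradients and the eigenvalue as a Sobolev constant *)

Section poincare_sobolev.
Context {R : realType} {n : nat} (r p : R).
Hypotheses (p2 : 2 <= p).
Implicit Types (u v : 'rV[R]_n -> R) (G H : 'rV[R]_n -> 'rV[R]_n).
Local Notation mu := (@lebesgue_rV R n).
Local Notation B := (@eball R n r).
Local Notation E := (Ip mu B p).

Let mB : measurable B. Proof. exact: measurable_eball. Qed.
Let p1 : 1 < p. Proof. by apply: lt_le_trans p2; rewrite ltr1n. Qed.
Let p0 : 0 < p. Proof. exact: lt_trans ltr01 p1. Qed.

Lemma Ip2_continuous (f : 'rV[R]_n -> R) : continuous f ->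
  Ip mu B 2 f = (\int[mu]_(x in B) (f x ^+ 2))%:E.
Proof.
move=> cf; rewrite IpE /Rintegral fineK; last first.
  apply: integrable_fin_num => //.
  by apply: (@integrable_ball_continuous _ _ _ (fun x => f x ^+ 2)); exact: (continuous_mul cf cf).
by apply: eq_integral => x _; rewrite powR_mulrn// real_normK// num_real.
Qed.

(** Poincare's inequality was proved in L^2. Since p >= 2, the convergence of the approximants and
    of their i-th derivatives descends from L^p to L^2; the derivatives tend to 0 there, so the
    approximants tend both to 0 and to u. *)
Lemma W01p_grad0 u G (i : 'I_n) : W01p B p u G ->
  {ae mu, forall x, B x -> G x = 0} -> {ae mu, forall x, B x -> u x = 0}.
Proof.
move=> /(W01p_facts p1)[mu_ _ mG _ [phi [tphi c1 c2]]] G0.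
have C1phi k := test_C1 (tphi k).
have mphi k : measurable_fun B (phi k) by exact: measurable_C1.
have mgphi k j : measurable_fun B (fun x => grad (phi k) x ord0 j) by exact: measurable_grad_C1.
have md k : measurable_fun B (pderiv i (phi k)).
  by have := mgphi k i; rewrite /grad; under eq_fun do rewrite mxE.
have c3 : E (pderiv i (phi k)) @[k --> \oo] --> 0%E.
  apply: cvge0_le c2 => [k|k]; first exact: Ip_ge0.
  rewrite [leRHS](@Ip_ae_eq _ _ _ _ _ mB p _ (enorm \o grad (phi k))).
  - apply: le_Ip => //; [exact: ltW|exact: measurable_enorm_comp|].
    move=> x _ /=; rewrite (ger0_norm (enorm_ge0 _)).
    by have := coord_le_enorm (grad (phi k) x) i; rewrite mxE.
  - by apply: measurable_enorm_comp; exact: measurable_subG.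
  - exact: measurable_enorm_comp.
  - by apply: filterS G0 => x H Bx /=; rewrite H// subr0.
have muB : (mu B < +oo)%E by exact: mu_eball_fin.
have p2' : 0 < (2 : R) <= p by rewrite p2 andbT.
have c4 := cvg_Ip_interp mB muB p2' md c3.
have mdu k : measurable_fun B (phi k \- u) by exact: measurable_funB.
have c5 := cvg_Ip_interp mB muB p2' mdu c1.
have c6 : Ip mu B 2 (phi k) @[k --> \oo] --> 0%E.
  have c4' := cvge0_scale (4 * r ^+ 2) c4.
  apply: cvge0_le c4' => k; first exact: Ip_ge0.
  have [cphi _ dphi] := C1phi k.
  rewrite !Ip2_continuous// -EFinM lee_fin; apply: poincare_ball => // x nx.
  by split; [exact: test_out (tphi k) nx|exact: test_pderiv_out (tphi k) nx].
have c7 : Ip mu B 2 u @[_ --> \oo] --> 0%E.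
  apply: (cvge0_add_scale (powR_ge0 2 2) _ _ _ _ c6 c5) => k; try exact: Ip_ge0.
  apply: Ip_add => // x _ /=.
  by rewrite distrC -{1}(subrK (phi k x) (u x)) addrC ler_normD.
have I0 : Ip mu B 2 u = 0%E.
  by rewrite -(cvg_lim (@ereal_hausdorff R) c7) lim_cst//; exact: ereal_hausdorff.
exact: (Ip_eq0_ae mB (_ : 0 < 2) mu_ I0).
Qed.

(** Homogeneity: u is normalised by the factor A^(-1/q). As A is the integral of |u|^q, A^(p / q) is
    the p-th power of the L^q norm. *)
Lemma lambda_le u G (q A : R) : 0 < q -> 0 < A -> W01p B p u G ->
  Ip mu B q u = A%:E -> (lambda B p q * (A `^ (p / q))%:E <= E (enorm \o G))%E.
Proof.
move=> q0 A0 uG IA; have [mu_ _ mG EG _] := W01p_facts p1 uG.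
pose c := A `^ (- q^-1).
have c0 : 0 < c by exact: powR_gt0.
have cuG := W01p_scale p1 c uG.
have N1 : Lp_norm B q (fun x => c * u x) = 1%E.
  rewrite Lp_normE// -IpE Ip_scale ?(ltW q0)// IA -EFinM ger0_norm ?(ltW c0)//.
  rewrite /c -powRrM mulNr mulVf ?gt_eqF// powR_inv1 ?(ltW A0)// mulVf ?gt_eqF//.
  by rewrite poweR1r.
have : (lambda B p q <= Lp_vnorm B p (fun x => c *: G x) `^ p)%E.
  by apply: ereal_inf_lbound; exists ((fun x => c * u x), (fun x => c *: G x)).
rewrite (Lp_vnorm_powR _ p1) => H.
have {}H : (lambda B p q <= (c `^ p)%:E * E (enorm \o G))%E.
  apply: (le_trans H); rewrite le_eqVlt; apply/orP; left; apply/eqP.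
  rewrite -[c in RHS]ger0_norm ?(ltW c0)// -Ip_scale ?(ltW p0)//; last exact: measurable_enorm_comp.
  by congr (Ip _ _ _ _); apply/funext => x /=; rewrite enormZ ger0_norm// ltW.
have cA : c `^ p = (A `^ (p / q))^-1.
  by rewrite /c -powRrM mulNr powRN mulrC.
rewrite cA in H; have P0 : 0 < A `^ (p / q) by exact: powR_gt0.
apply: (@le_trans _ _ (((A `^ (p / q))^-1)%:E * E (enorm \o G) * (A `^ (p / q))%:E)%E).
  by apply: lee_wpmul2r => //; rewrite lee_fin powR_ge0.
by rewrite muleAC -EFinM mulVf ?gt_eqF// mul1e.
Qed.

End poincare_sobolev.

(** Both g + f and g - f are nondecreasing. With g a primitive of the bound, this controls an
    increment without integrating f. *)
Lemma norm_increment_le {R : realType} (f g df dg : R -> R) (a b : R) : a <= b ->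
  (forall x : R, a <= x <= b -> is_derive x (1 : R) f (df x)) ->
  (forall x : R, a <= x <= b -> is_derive x (1 : R) g (dg x)) ->
  (forall x : R, a <= x <= b -> `|df x| <= dg x) -> `|f b - f a| <= g b - g a.
Proof.
move=> ab Df Dg fg.
have mono (h dh : R -> R) : (forall x : R, a <= x <= b -> is_derive x (1 : R) h (dh x)) ->
    (forall x : R, a <= x <= b -> 0 <= dh x) -> h a <= h b.
  move=> Dh h0; have wc : {within `[a, b], continuous h}.
    by apply: derivable_within_continuous => x; rewrite in_itv/= => /Dh[].
  have Dh' x : x \in `]a, b[%R -> is_derive x (1 : R) h (dh x).
    by rewrite in_itv/= => /andP[ax xb]; apply: Dh; rewrite !ltW.
  have [c + E] := @MVT_segment R h dh a b ab Dh' wc.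
  by rewrite in_itv/= => cab; rewrite -subr_ge0 E mulr_ge0 ?h0 ?subr_ge0.
have H1 : g a + f a <= g b + f b.
  apply: (mono (fun x => g x + f x) (fun x => dg x + df x)) => x xab.
    exact: is_derive1_add (Dg x xab) (Df x xab).
  by have := fg x xab; rewrite ler_norml => /andP[]; lra.
have H2 : g a + -1 * f a <= g b + -1 * f b.
  apply: (mono (fun x => g x + -1 * f x) (fun x => dg x + -1 * df x)) => x xab.
    exact: is_derive1_add (Dg x xab) (is_derive1_scale _ (Df x xab)).
  by have := fg x xab; rewrite ler_norml => /andP[]; lra.
by rewrite ler_norml; apply/andP; split; lra.
Qed.

Lemma lebesgue_itv_lty {R : realType} (t L : R) :
  (@lebesgue_measure R `[t, L[%classic < +oo)%E.
Proof.
by rewrite (@lebesgue_measure_itv R `[t, L[) /=; case: ifP => // _; rewrite -EFinB ltry.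
Qed.

(** * Radial functions in W_0^{1,p} *)

Section radial_sobolev.
Context {R : realType} {n : nat} (r p : R).
Hypotheses (n0 : (0 < n)%N) (r0 : 0 < r) (p1 : 1 < p).
Local Notation mu := (@lebesgue_rV R n).
Local Notation leb := (@lebesgue_measure R).
Local Notation B := (@eball R n r).
Local Notation E := (Ip mu B p).

Let mB : measurable B. Proof. exact: measurable_eball. Qed.
Let p0 : 0 < p. Proof. exact: lt_trans ltr01 p1. Qed.

(* The approximants are K_k(|x|^2) - K_k(r^2), where K_k' is a smooth grid average
   of zeta that vanishes near 0 and near r^2. *)
Lemma radial_W01p (Z zeta : R -> R) (a C : R) : 0 < a <= 1 -> 0 <= C ->
  (forall t : R, 0 < t -> is_derive t (1 : R) Z (zeta t)) ->
  (forall t : R, 0 < t -> {for t, continuous zeta}) ->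
  measurable_fun setT zeta ->
  continuous (fun x : 'rV[R]_n => Z (dotr x x)) ->
  (forall t, 0 < t <= r ^+ 2 -> `|zeta t| <= C * t `^ (a - 1)) ->
  Z (r ^+ 2) = 0 -> - n%:R < (2 * a - 1) * p ->
  W01p B p (fun x => Z (dotr x x)) (fun x => (2 * zeta (dotr x x)) *: x).
Proof.
move=> /andP[a0 a1] C0 dZ cz mz cZ zC Zr ap.
have [S [kS S0 S1 ndS]] := @smooth_step R.
pose L := r ^+ 2; have L0 : 0 < L by rewrite exprn_gt0.
pose eta k := grid_sum S L zeta k.
have keta k j : Sm j (eta k) by exact: grid_sum_smooth.
have ceta k : continuous (eta k) by exact: (keta k 0%N).
have eta0 k := grid_sum_support S0 S1 L0 zeta k.
have etaC k t : 0 < t -> `|eta k t| <= C * (t / 2) `^ (a - 1).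
  move=> t0; apply: grid_sum_bound => //; first by rewrite subr_le0.
  by move=> s /andP[s0 /ltW sL]; apply: zC; rewrite s0.
have etacvg t : 0 < t < L -> eta k t @[k --> \oo] --> zeta t.
  by move=> t0; apply: grid_sum_cvg => //; apply: cz; case/andP : t0.
have /choice[K HK] k : exists K, forall t : R, is_derive t (1 : R) K (eta k t).
  have [e e0 He] := eta0 k.
  have [|K [dK _]] := primitive_vanishing (ceta k); last by exists K.
  by move=> t t0; apply: He; left; rewrite (le_trans t0)// ltW.
pose phi k (x : 'rV[R]_n) := K k (dotr x x) - K k (r ^+ 2).
have tphi k : test_function B (phi k).
  have [e e0 He] := eta0 k.
  by apply: (radial_test_function r0 e0 (keta k) (HK k)) => t te; apply: He; right.
have gphi k x : grad (phi k) x = (2 * eta k (dotr x x)) *: x.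
  apply/rowP => i; rewrite !mxE.
  apply: (@pderiv_radial _ _ (fun t => K k t - K k (r ^+ 2))).
  by have := is_derive1_add (HK k (dotr x x)) (is_derive_cst (- K k (r ^+ 2)) _ (1 : R)); rewrite addr0.
have mdot : measurable_fun setT (fun x : 'rV[R]_n => dotr x x).
  by apply: continuous_measurable_rV; exact: continuous_dotr.
have mzd : measurable_fun B (fun x : 'rV[R]_n => zeta (dotr x x)).
  by apply: measurable_funTS; exact: measurableT_comp.
have mu_ : measurable_fun B (fun x : 'rV[R]_n => Z (dotr x x)).
  by apply: measurable_funTS; exact: continuous_measurable_rV.
have mcoord (i : 'I_n) : measurable_fun B (fun x : 'rV[R]_n => x ord0 i).
  by apply: measurable_funTS; apply: continuous_measurable_rV; exact: coord_continuous.
have mG i : measurable_fun B (fun x : 'rV[R]_n => ((2 * zeta (dotr x x)) *: x) ord0 i).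
  under eq_fun do rewrite mxE; apply: measurable_funM => //.
  exact: measurable_funM.
have mphi k : measurable_fun B (phi k) by apply: measurable_C1; exact: test_C1 (tphi k).
have mgphi k i : measurable_fun B (fun x => grad (phi k) x ord0 i).
  by apply: measurable_grad_C1; exact: test_C1 (tphi k).
have ae0 : {ae mu, forall x : 'rV[R]_n, x != 0}.
  exists [set 0]; split; [| exact: mu_set0_eq0|].
    rewrite (_ : [set 0] = setT `&` @enorm R n @^-1` [set 0]).
      by apply: measurable_enorm => //; exact: measurable_set1.
    by apply/seteqP; split => x /=; [move=> ->; rewrite enorm0|move=> [_ /eqP]; rewrite enorm_eq0 => /eqP].
  by move=> x /= /negP; rewrite negbK => /eqP.
have dotB (x : 'rV[R]_n) : B x -> x != 0 -> 0 < dotr x x < L.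
  rewrite /eball /= -sqr_enorm -enorm_gt0 => xr x0.
  by rewrite exprn_gt0//= ltrXn2r ?nnegrE ?enorm_ge0// ltW.
(* The grid sum is controlled by the majorant at t / 2, whence the first factor; the second term is
   the bound on zeta itself. *)
pose C' := C * 2^-1 `^ (a - 1) + C.
have C'0 : 0 <= C' by rewrite addr_ge0 ?mulr_ge0 ?powR_ge0.
have diffC k t : 0 < t <= L -> `|eta k t - zeta t| <= C' * t `^ (a - 1).
  move=> /andP[t0 tL]; rewrite (le_trans (ler_normB _ _))// mulrDl; apply: lerD; last first.
    by apply: zC; rewrite t0.
  by rewrite (le_trans (etaC k t t0))// -mulrA -powRM ?invr_ge0 ?(ltW t0)// [2^-1 * t]mulrC.
apply: (W01p_of_approx p1 mu_ mG tphi).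
  (* The constant is the integral of C' s^(a - 1) over [0, L], which bounds the increment of the
     primitive of eta k - zeta. Pointwise convergence is itself dominated convergence on [t, L[,
     away from the singularity. *)
  apply: (@cvg_Ip_dominated _ _ _ mu B mB p _ (fun=> C' / a * L `^ a)) => //.
  - by move=> k; exact: measurable_funB.
  - apply: filterS ae0 => x x0 Bx; have /andP[t0 tL] := dotB x Bx x0.
    set t := dotr x x in t0 tL *.
    have sub s : t <= s <= L -> 0 < s by move=> /andP[ts _]; exact: lt_le_trans ts.
    have FK k : (\int[leb]_(s in `[t, L]) (eta k s)%:E = (K k L - K k t)%:E)%E.
      by apply: FTC2_itv => // s _; exact: ceta.
    have FZ : (\int[leb]_(s in `[t, L]) (zeta s)%:E = (Z L - Z t)%:E)%E.
      by apply: FTC2_itv => // s /sub s0; [exact: dZ|exact: cz].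
    have mI : measurable (`[t, L[%classic : set (measurableTypeR R)) by exact: measurable_itv.
    have mzI : measurable_fun `[t, L[ (fun s => (zeta s)%:E).
      by apply/measurable_EFinP; exact: measurable_funTS.
    have meI k : measurable_fun `[t, L[ (fun s => (eta k s)%:E).
      apply/measurable_EFinP; apply: measurable_funTS; exact: continuous_measurable_fun.
    have [|||||_ _] := @dominated_convergence _ _ R leb _ mI
      (fun k s => (eta k s)%:E) (fun s => (zeta s)%:E) (cst (C * (t / 2) `^ (a - 1))%:E).
    + exact: meI.
    + exact: mzI.
    + apply: aeW => s; rewrite /= in_itv/= => /andP[ts sL]; apply/cvg_EFin; first exact: nearW.
      by apply: etacvg; rewrite sL (lt_le_trans t0).
    + apply: measurable_bounded_integrable => //; last exact: bounded_cst.
      exact: lebesgue_itv_lty.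
    + apply: aeW => s k; rewrite /= in_itv/= lee_fin => /andP[ts sL].
      rewrite (le_trans (etaC k s (lt_le_trans t0 ts)))// ler_wpM2l//.
      have P y : y `^ (a - 1) = (y `^ (1 - a))^-1 by rewrite -powRN opprB.
      have s0 := lt_le_trans t0 ts; have t2 : 0 < t / 2 by rewrite divr_gt0.
      have s2 : 0 < s / 2 by rewrite divr_gt0.
      rewrite !P lef_pV2; [|by rewrite posrE powR_gt0|by rewrite posrE powR_gt0].
      by apply: ge0_ler_powR; rewrite ?nnegrE ?subr_ge0 ?(ltW t2) ?(ltW s2) ?ler_pM2r.
    rewrite integral_itv_bndo_bndc// FZ => H.
    have {}H : (K k L - K k t)%:E @[k --> \oo] --> (Z L - Z t)%:E.
      rewrite (_ : (fun k => _) = (fun k => \int[leb]_(s in `[t, L[) (eta k s)%:E)%E)//.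
      by apply/funext => k; rewrite integral_itv_bndo_bndc// FK.
    have /fine_cvgP[_ {}H] := H.
    rewrite (_ : (fun k => _) = fun k => (Z L - Z t) - (K k L - K k t)).
      by rewrite -(subrr (Z L - Z t)); apply: cvgB; [exact: cvg_cst|exact: H].
    by apply/funext => k; rewrite /phi /= -/t -/L Zr; ring.
  - apply: filterS ae0 => x x0 k Bx; have /andP[t0 tL] := dotB x Bx x0.
    set t := dotr x x in t0 tL *.
    have sub s : t <= s <= L -> 0 < s by move=> /andP[ts _]; exact: lt_le_trans ts.
    have /= := @norm_increment_le _ (fun s => K k s + -1 * Z s) (fun s => C' / a * s `^ a)
      (fun s => eta k s + -1 * zeta s) (fun s => C' / a * (a * s `^ (a - 1))) t L (ltW tL).
    rewrite Zr => H.
    rewrite (_ : phi k x - _ = - (K k L + -1 * 0 - (K k t + -1 * Z t))); last first.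
      by rewrite /phi -/t -/L; ring.
    rewrite normrN; apply: le_trans (H _ _ _) _.
    + move=> s /sub s0; exact: is_derive1_add (HK k s) (is_derive1_scale _ (dZ s s0)).
    + move=> s /sub s0; exact: is_derive1_scale _ (is_derive_powR_pos _ s0).
    + move=> s /andP[ts sL]; have s0 := lt_le_trans t0 ts.
      rewrite mulN1r mulrA divfK ?gt_eqF//.
      by apply: diffC; rewrite s0.
    + by rewrite lerBlDr lerDl mulr_ge0 ?powR_ge0// divr_ge0// ltW.
  - by apply: Ip_continuous_lty; [exact: ltW|move=> x; exact: cst_continuous].
have mpow : measurable_fun B (fun x : 'rV[R]_n => enorm x `^ (2 * a - 1)).
  have : measurable_fun setT (fun x : 'rV[R]_n => enorm x `^ (2 * a - 1)).
    exact: measurableT_comp (measurable_powR _) measurable_enorm.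
  exact: measurable_funTS.
have gE k (x : 'rV[R]_n) : (enorm \o (grad (phi k) \- (fun x => (2 * zeta (dotr x x)) *: x))) x
    = 2 * `|eta k (dotr x x) - zeta (dotr x x)| * enorm x.
  by rewrite /= gphi -scalerBl enormZ -mulrBr normrM ger0_norm.
(* The gradient of a function of |x|^2 carries a factor |x|, so the bound t^(a - 1) at t = |x|^2
   becomes |x|^(2 a - 1), whose p-th power is integrable by the assumption on a. *)
apply: (@cvg_Ip_dominated _ _ _ mu B mB p _ (fun x => 2 * C' * enorm x `^ (2 * a - 1))) => //.
- by move=> k; apply: measurable_enorm_comp; exact: measurable_subG.
- exact: measurable_funM.
- apply: filterS ae0 => x x0 Bx; have tL := dotB x Bx x0.
  have C1 : `|eta k (dotr x x) - zeta (dotr x x)| @[k --> \oo] --> `|zeta (dotr x x) - zeta (dotr x x)|.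
    by apply: cvg_norm; apply: cvgB; [exact: etacvg|exact: cvg_cst].
  rewrite (_ : (fun k => _) = fun k => 2 * `|eta k (dotr x x) - zeta (dotr x x)| * enorm x); last first.
    by apply/funext => k; exact: gE.
  rewrite (_ : 0 = 2 * `|zeta (dotr x x) - zeta (dotr x x)| * enorm x); last first.
    by rewrite subrr normr0 mulr0 mul0r.
  apply: cvgM; last exact: cvg_cst.
  by apply: cvgM; [exact: cvg_cst|exact: C1].
- apply: filterS ae0 => x x0 k Bx; have tL := dotB x Bx x0.
  rewrite gE ger0_norm ?mulr_ge0 ?enorm_ge0//.
  rewrite -!mulrA ler_wpM2l//.
  apply: (@le_trans _ _ (C' * dotr x x `^ (a - 1) * enorm x)).
    by case/andP : tL => t0 tL; rewrite ler_wpM2r ?enorm_ge0// diffC// t0 ltW.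
  rewrite -mulrA ler_wpM2l// -sqr_enorm.
  have e0 : 0 < enorm x by rewrite enorm_gt0.
  rewrite -powR_mulrn ?enorm_ge0// -powRrM -{2}[enorm x]powRr1 ?enorm_ge0// -powRD ?(gt_eqF e0) ?implybT//.
  by rewrite (_ : 2%:R * (a - 1) + 1 = 2 * a - 1)//; ring.
- rewrite Ip_scale ?(ltW p0)// lte_mul_pinfty ?lee_fin ?powR_ge0//.
  exact: Ip_enorm_powR_lty.
Qed.

End radial_sobolev.

(** * The equation of a radial profile *)

Section dilation.
Context {R : realType} {n : nat}.
Hypotheses (n0 : (0 < n)%N).
Local Notation mu := (@lebesgue_rV R n).
Local Notation leb := (@lebesgue_measure R).
Local Notation I01 := (`]0%R, 1%R[%classic : set (measurableTypeR R)).

Lemma ge0_integral_swap d (T : measurableType d) (m : {sigma_finite_measure set T -> \bar R})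
    (D : set (measurableTypeR R)) (f : T * measurableTypeR R -> \bar R) : measurable D ->
  measurable_fun setT f -> (forall z, (0 <= f z)%E) ->
  (\int[m]_x \int[leb]_(s in D) f (x, s) = \int[leb]_(s in D) \int[m]_x f (x, s))%E.
Proof.
move=> mD mf f0; pose g := f \_ (setT `*` D).
have mg : measurable_fun setT g.
  apply/(measurable_restrictT _ (measurableX measurableT mD)).
  exact: measurable_funTS.
have g0 z : (0 <= g z)%E by rewrite /g patchE; case: ifP.
have := @fubini_tonelli _ _ _ _ R m leb g mg g0.
have gE x s : g (x, s) = ((fun s => f (x, s)) \_ D) s.
  rewrite /g !patchE; suff -> : ((x, s) \in setT `*` D) = (s \in D) by [].
  by apply/idP/idP; rewrite !inE //= => -[].
rewrite (_ : (\int[m]_x _ = \int[m]_x \int[leb]_(s in D) f (x, s))%E); last first.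
  by apply: eq_integral => x _; rewrite [RHS]integral_mkcond; apply: eq_integral => s _; exact: gE.
move=> ->; rewrite [RHS]integral_mkcond; apply: eq_integral => s _.
rewrite /fubini_G patchE; case: ifPn => sD.
  by apply: eq_integral => x _; rewrite gE patchE sD.
by rewrite integral0_eq// => x _; rewrite gE patchE (negbTE sD).
Qed.

Lemma measurable_partial_integral d (T : measurableType d)
    (D : set (measurableTypeR R)) (f : T * measurableTypeR R -> \bar R) : measurable D ->
  measurable_fun setT f -> (forall z, (0 <= f z)%E) ->
  measurable_fun setT (fun x => \int[leb]_(s in D) f (x, s))%E.
Proof.
move=> mD mf f0; pose h := f \_ (setT `*` D).
have mh : measurable_fun setT h.
  apply/(measurable_restrictT _ (measurableX measurableT mD)).
  exact: measurable_funTS.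
have h0 z : (0 <= h z)%E by rewrite /h patchE; case: ifP.
have := @measurable_fun_fubini_tonelli_F _ _ _ _ R leb h mh h0.
congr (measurable_fun _ _); apply/funext => x; rewrite [RHS]integral_mkcond.
apply: eq_integral => s _; rewrite /h !patchE.
suff -> : ((x, s) \in setT `*` D) = (s \in D) by [].
by apply/idP/idP; rewrite !inE //= => -[].
Qed.

Lemma measurable_dilation (b : R) :
  measurable_fun setT (fun z : 'rV[R]_n * measurableTypeR R => (z.2 : R) `^ b *: z.1).
Proof.
apply/measurable_fun_rVP => i.
rewrite (_ : _ \o _ = fun z : 'rV[R]_n * measurableTypeR R => (z.2 : R) `^ b * coord_rV i z.1).
  apply: measurable_funM; first exact: measurableT_comp (measurable_powR _) measurable_snd.
  exact: measurableT_comp (measurable_coord_rV i) measurable_fst.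
by apply/funext => z; rewrite /coord_rV /= !mxE.
Qed.

Let mT (g : 'rV[R]_n -> R) : measurable_fun setT g ->
  measurable_fun setT (fun z : 'rV[R]_n * measurableTypeR R =>
    (z.2 : R) `^ (-1) * g ((z.2 : R) `^ (- n%:R^-1) *: z.1)).
Proof.
move=> mg; apply: measurable_funM.
  exact: measurableT_comp (measurable_powR _) measurable_snd.
exact: measurableT_comp mg (measurable_dilation _).
Qed.

Let mS (F : measurableTypeR R -> R) : measurable_fun setT F ->
  measurable_fun setT (fun z : 'rV[R]_n * measurableTypeR R =>
    F ((z.2 : R) `^ n%:R^-1 * enorm z.1)).
Proof.
move=> mF; apply: (measurableT_comp mF); apply: measurable_funM.
  exact: measurableT_comp (measurable_powR _) measurable_snd.
exact: measurableT_comp (@measurable_enorm R n) measurable_fst.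
Qed.

(** It is applied to the positive and negative parts of -(1/n) y . grad phi(y); the difference of
    the two results is phi x when x is not 0. *)
Definition ray_integral (g : 'rV[R]_n -> R) (x : 'rV[R]_n) : \bar R :=
  (\int[leb]_(s in I01) ((s : R) `^ (-1) * g ((s : R) `^ (- n%:R^-1) *: x))%:E)%E.

(** The mean of F(|x|) over the ball of radius |y|, in the variable s = (|x| / |y|)^n. *)
Definition radial_mean (F : measurableTypeR R -> R) (y : 'rV[R]_n) : \bar R :=
  (\int[leb]_(s in I01) (F ((s : R) `^ n%:R^-1 * enorm y))%:E)%E.

Let mI : measurable I01. Proof. exact: measurable_itv. Qed.

Lemma ray_integral_ge0 g x : (forall y, 0 <= g y) -> (0 <= ray_integral g x)%E.
Proof. by move=> g0; apply: integral_ge0 => s _; rewrite lee_fin mulr_ge0 ?powR_ge0. Qed.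

Lemma radial_mean_ge0 (F : measurableTypeR R -> R) y : (forall s, 0 <= F s) -> (0 <= radial_mean F y)%E.
Proof. by move=> F0; apply: integral_ge0 => s _; rewrite lee_fin. Qed.

Lemma measurable_ray_integral (g : 'rV[R]_n -> R) : measurable_fun setT g -> (forall y, 0 <= g y) ->
  measurable_fun setT (ray_integral g).
Proof.
move=> mg g0; apply: (@measurable_partial_integral _ _ I01 (fun z : 'rV[R]_n * measurableTypeR R =>
  ((z.2 : R) `^ (-1) * g ((z.2 : R) `^ (- n%:R^-1) *: z.1))%:E)) => //.
  by apply/measurable_EFinP; exact: mT.
by move=> z; rewrite lee_fin mulr_ge0 ?powR_ge0.
Qed.

Lemma measurable_radial_mean (F : measurableTypeR R -> R) : measurable_fun setT F ->
  (forall s, 0 <= F s) -> measurable_fun setT (radial_mean F).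
Proof.
move=> mF F0; apply: (@measurable_partial_integral _ _ I01 (fun z : 'rV[R]_n * measurableTypeR R =>
  (F ((z.2 : R) `^ n%:R^-1 * enorm z.1))%:E)) => //.
  by apply/measurable_EFinP; exact: mS.
by move=> z; rewrite lee_fin.
Qed.

(* For fixed s the inner integrals correspond under y = s^(-1/n) x, of Jacobian s^-1. *)
Lemma dilation_tonelli (F : measurableTypeR R -> R) (g : 'rV[R]_n -> R) :
  measurable_fun setT F -> (forall s, 0 <= F s) ->
  measurable_fun setT g -> (forall y, 0 <= g y) ->
  (\int[mu]_x ((F (enorm x))%:E * ray_integral g x) =
   \int[mu]_y ((g y)%:E * radial_mean F y))%E.
Proof.
move=> mF F0 mg g0.
have mFe : measurable_fun setT (fun x : 'rV[R]_n => F (enorm x)).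
  exact: measurableT_comp mF (@measurable_enorm R n).
pose f1 (z : 'rV[R]_n * measurableTypeR R) := (F (enorm z.1) *
  ((z.2 : R) `^ (-1) * g ((z.2 : R) `^ (- n%:R^-1) *: z.1)))%:E.
pose f2 (z : 'rV[R]_n * measurableTypeR R) := (g z.1 *
  F ((z.2 : R) `^ n%:R^-1 * enorm z.1))%:E.
transitivity (\int[mu]_x \int[leb]_(s in I01) f1 (x, s))%E.
  apply: eq_integral => x _; rewrite /ray_integral -ge0_integralZl//.
  - apply/measurable_EFinP; apply: measurable_funTS.
    exact: measurableT_comp (mT mg) (pair1_measurable x).
  - by move=> s _; rewrite lee_fin mulr_ge0 ?powR_ge0.
  - by rewrite lee_fin.
transitivity (\int[mu]_x \int[leb]_(s in I01) f2 (x, s))%E; last first.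
  apply: eq_integral => x _; rewrite /radial_mean -ge0_integralZl//.
  - apply/measurable_EFinP; apply: measurable_funTS.
    exact: measurableT_comp (mS mF) (pair1_measurable x).
  - by move=> s _; rewrite lee_fin.
  - by rewrite lee_fin.
have f10 z : (0 <= f1 z)%E by rewrite lee_fin !mulr_ge0 ?powR_ge0.
have f20 z : (0 <= f2 z)%E by rewrite lee_fin mulr_ge0.
have mf1 : measurable_fun setT f1.
  apply/measurable_EFinP; apply: measurable_funM; last exact: mT.
  exact: measurableT_comp mFe measurable_fst.
have mf2' : measurable_fun setT f2.
  apply/measurable_EFinP; apply: measurable_funM; last exact: mS.
  exact: measurableT_comp mg measurable_fst.
rewrite (@ge0_integral_swap _ _ mu I01 f1 mI mf1 f10).
rewrite (@ge0_integral_swap _ _ mu I01 f2 mI mf2' f20).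
apply: eq_integral => s; rewrite inE/= in_itv/= => /andP[s0 s1].
pose c := s `^ (- n%:R^-1); have c0 : 0 < c by exact: powR_gt0.
have mf2 : measurable_fun setT (fun x : 'rV[R]_n => f2 (x, s)).
  apply/measurable_EFinP; apply: measurable_funM => //.
  exact: measurableT_comp (mS mF) (pair2_measurable s).
rewrite (ge0_integral_affine 0 c0 mf2 (fun x => f20 (x, s))) -ge0_integralZl//; first last.
- by rewrite lee_fin exprn_ge0// ltW.
- have := measurableT_comp mf2 (measurable_affine c (0 : 'rV[R]_n)); exact.
apply: eq_integral => x _; rewrite /f1 /f2 /= addr0 -EFinM enormZ (ger0_norm (ltW c0)) [s `^ _ * (c * _)]mulrA.
have -> : s `^ n%:R^-1 * c = 1 by rewrite /c powRN mulfV// gt_eqF// powR_gt0.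
have -> : c ^+ n = s `^ (-1).
  by rewrite /c -powR_mulrn ?powR_ge0// -powRrM mulNr mulVf// pnatr_eq0 -lt0n.
by rewrite mul1r; congr EFin; rewrite /c; ring.
Qed.

(** Rescaling to the fixed radius r lets a single cumulated mass, a function on ]0, 1], give the
    means over all the balls. *)
Lemma radial_mean_scale (F : measurableTypeR R -> R) (r : R) (y : 'rV[R]_n) :
  measurable_fun setT F -> (forall s, 0 <= F s) -> 0 < r -> y != 0 ->
  radial_mean F y = (((r / enorm y) ^+ n)%:E *
    \int[leb]_(s in `]0%R, ((enorm y / r) ^+ n)%R[) (F (r * s `^ n%:R^-1))%:E)%E.
Proof.
move=> mF F0 r0 y0; have e0 : 0 < enorm y by rewrite enorm_gt0.
pose Y := (enorm y / r) ^+ n; have Y0 : 0 < Y by rewrite exprn_gt0// divr_gt0.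
pose J := `]0%R, Y[%classic : set (measurableTypeR R).
have mJ : measurable J by exact: measurable_itv.
pose h := (fun s : measurableTypeR R => (F (r * (s : R) `^ n%:R^-1))%:E) \_ J.
have mh : measurable_fun setT h.
  apply/(measurable_restrictT _ mJ); apply: measurable_funTS; apply/measurable_EFinP.
  apply: (measurableT_comp mF); exact: measurable_funM.
have h0 s : (0 <= h s)%E by rewrite /h patchE; case: ifP => // _; rewrite lee_fin.
rewrite -/Y -/J [X in (_ * X)%E]integral_mkcond -/h.
rewrite (ge0_integral_affine1 0 Y0 mh h0) muleA -EFinM.
rewrite -exprMn mulrA divfK ?gt_eqF// divff ?gt_eqF// expr1n mul1e.
rewrite /radial_mean integral_mkcond; apply: eq_integral => s _.
rewrite /h !patchE addr0; have -> : (Y * s \in J) = (s \in I01).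
  have E : (0 < Y * s < Y) = ((0 < s < 1)%R : bool).
    by rewrite pmulr_rgt0// -[X in _ * _ < X]mulr1 ltr_pM2l.
  by apply/idP/idP; rewrite !inE /J /= !in_itv/= E.
case: ifPn => //; rewrite inE/= in_itv/= => /andP[s0 s1].
rewrite powRM ?(ltW Y0) ?(ltW s0)// (_ : Y `^ n%:R^-1 = enorm y / r).
  by congr (F _)%:E; rewrite mulrA [r * _]mulrC divfK ?gt_eqF// mulrC.
rewrite /Y -powR_mulrn ?divr_ge0 ?(ltW r0) ?(ltW e0)// -powRrM mulfV ?pnatr_eq0 -?lt0n//.
by rewrite powRr1// divr_ge0 ?(ltW r0) ?(ltW e0).
Qed.

End dilation.

Section weak_radial.
Context {R : realType} {n : nat} (r : R).
Hypotheses (n0 : (0 < n)%N) (r0 : 0 < r).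
Local Notation mu := (@lebesgue_rV R n).
Local Notation leb := (@lebesgue_measure R).
Local Notation B := (@eball R n r).
Local Notation I01 := (`]0%R, 1%R[%classic : set (measurableTypeR R)).

Let mB : measurable B. Proof. exact: measurable_eball. Qed.
Let mI : measurable I01. Proof. exact: measurable_itv. Qed.
Let nn0 : n%:R != 0 :> R. Proof. by rewrite pnatr_eq0 -lt0n. Qed.
Let np : 0 < n%:R :> R. Proof. by rewrite ltr0n. Qed.

Variable phi : 'rV[R]_n -> R.
Hypothesis tphi : test_function B phi.
Local Notation D := (fun y : 'rV[R]_n => - n%:R^-1 * dotr y (grad phi y)).

Let C1phi : C1 phi. Proof. exact: test_C1 tphi. Qed.

Lemma continuous_radial_derivative : continuous D.
Proof.
have [_ _ cd] := C1phi.
apply: continuous_scale; apply: (@continuous_sum_ord _ _ _ (fun i (y : 'rV[R]_n) => y ord0 i * grad phi y ord0 i)) => i.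
rewrite /grad; under eq_fun do rewrite mxE.
by apply: continuous_mul; [exact: coord_continuous|exact: cd].
Qed.

Lemma radial_derivative_out y : r <= enorm y -> D y = 0.
Proof.
move=> ry; rewrite /dotr big1 ?mulr0// => i _; rewrite mxE (test_pderiv_out _ tphi) ?mulr0//.
by rewrite /eball /= => /(le_lt_trans ry); rewrite ltxx.
Qed.

Lemma radial_derivative_le : exists2 M : R, 0 <= M & forall y, `|D y| <= M * enorm y.
Proof.
have [_ _ cd] := C1phi.
have [||M HM] := @bounded_continuous_rV _ _ (fun y => enorm (grad phi y)) r.
- move=> x; apply: (@continuous_comp _ _ _ (fun x => dotr (grad phi x) (grad phi x)) Num.sqrt).
    apply: (@continuous_sum_ord _ _ _ (fun i x => grad phi x ord0 i * grad phi x ord0 i)) => i.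
    by rewrite /grad; under eq_fun do rewrite !mxE; exact: continuous_mul.
  exact: sqrt_continuous.
- move=> y ry; apply/eqP; rewrite enorm_eq0; apply/eqP/rowP => i.
  rewrite !mxE (test_pderiv_out _ tphi)//.
  by rewrite /eball /= => /(le_lt_trans ry); rewrite ltxx.
have M0 : 0 <= M by rewrite (le_trans _ (HM 0)).
exists (n%:R^-1 * M); first by rewrite mulr_ge0.
move=> y; rewrite mulNr normrN normrM ger0_norm// -mulrA ler_wpM2l//.
rewrite (le_trans (norm_dotr_le_enorm _ _))// mulrC ler_wpM2r ?enorm_ge0//.
by rewrite (le_trans _ (HM y))// ler_norm.
Qed.

(* The fundamental theorem of calculus on the ray from x to infinity, in the variable
   s = (|x| / |y|)^n. *)
Lemma ray_identity x : x != 0 ->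
  (\int[leb]_(s in I01) ((s : R) `^ (-1) * D ((s : R) `^ (- n%:R^-1) *: x))%:E =
   (phi x)%:E)%E.
Proof.
move=> x0; have e0 : 0 < enorm x by rewrite enorm_gt0.
pose c (s : R) := s `^ (- n%:R^-1).
have c0 (s : R) : 0 < s -> 0 < c s by exact: powR_gt0.
pose h (s : R) := s `^ (-1) * D (c s *: x).
have dphi (t : R) : is_derive t (1 : R) (fun t : R => phi (t *: x)) (dotr x (grad phi (t *: x))).
  have := is_derive_dir (0 + t *: x) x C1phi; rewrite add0r => -[d1 <-].
  have := @is_derive_line _ _ phi 0 x t; rewrite add0r => /(_ d1).
  by congr is_derive; apply/funext => s; rewrite add0r.
have dG (s : R) : 0 < s -> is_derive s (1 : R) (fun s : R => phi (c s *: x)) (h s).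
  move=> s0; have := (@is_derive1_comp R (fun t : R => phi (t *: x)) c s _ _
    (dphi (c s)) (is_derive_powR_pos (- n%:R^-1) s0)).
  congr is_derive; rewrite /h dotrZl.
  have -> : s `^ (- n%:R^-1 - 1) = s `^ (-1) * c s.
    by rewrite addrC powRD// (gt_eqF s0) implybT.
  by ring.
have ch (s : R) : 0 < s -> {for s, continuous h}.
  move=> s0.
  have cc : {for s, continuous c} by exact: continuous_powR_pos.
  have c1 : {for s, continuous (fun s : R => s `^ (-1))} by exact: continuous_powR_pos.
  apply: (@continuousM _ _ _ _ s c1).
  apply: (@continuous_comp _ _ _ (fun s => c s *: x) D); last exact: continuous_radial_derivative.
  exact: (@cvgZr_tmp).
(* For s <= d the point s^(-1/n) x lies outside the open ball, where D vanishes; the integral thus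
   starts at d > 0, away from the singularity at 0. The bound 1/2 only ensures d < 1. *)
pose d := Num.min ((enorm x / r) ^+ n) 2^-1.
have d0 : 0 < d by rewrite lt_min exprn_gt0 ?divr_gt0//= invr_gt0.
have d1 : d < 1 by rewrite gt_min (_ : 2^-1 < 1) ?orbT// invf_lt1 ?ltr1n.
have cd (s : R) : 0 < s <= d -> r <= enorm (c s *: x).
  move=> /andP[s0 sd]; rewrite enormZ (ger0_norm (ltW (c0 s s0))).
  have sx : s `^ n%:R^-1 <= enorm x / r.
    have q0 : 0 <= enorm x / r by rewrite divr_ge0 ?ltW.
    rewrite (_ : enorm x / r = ((enorm x / r) ^+ n) `^ n%:R^-1); last first.
      by rewrite -powR_mulrn// -powRrM mulfV// powRr1.
    apply: ge0_ler_powR; rewrite ?nnegrE ?invr_ge0 ?exprn_ge0 ?(ltW s0)//.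
    by rewrite (le_trans sd)// ge_min lexx.
  rewrite /c powRN mulrC ler_pdivlMr ?powR_gt0//.
  by rewrite mulrC -ler_pdivlMr.
have zh (s : R) : 0 < s <= d -> h s = 0.
  by move=> sd; rewrite /h (radial_derivative_out (cd s sd)) mulr0.
have mh : measurable_fun setT (h : measurableTypeR R -> R).
  apply: measurable_funM; first exact: measurable_powR.
  have mD : measurable_fun setT D.
    by apply: continuous_measurable_rV; exact: continuous_radial_derivative.
  apply: (measurableT_comp mD).
  exact: (measurableT_comp (measurable_dilation (- n%:R^-1)) (pair1_measurable x)).
transitivity (\int[leb]_(s in `[d, 1%R[) (h s)%:E)%E.
  rewrite integral_mkcond [RHS]integral_mkcond; apply: eq_integral => s _.
  rewrite !patchE; have [sd|ds] := ltP s d.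
    rewrite [in RHS]ifF; last first.
      by apply/negbTE/negP; rewrite inE/= in_itv/= => /andP[/(lt_le_trans sd)]; rewrite ltxx.
    case: ifPn => //; rewrite inE/= in_itv/= => /andP[s0 s1].
    by rewrite -/(c s) -/(h s) zh// s0 ltW.
  suff -> : (s \in I01) = (s \in (`[d, 1[%classic : set (measurableTypeR R))) by [].
  by apply/idP/idP; rewrite !inE /= !in_itv/= => /andP[? ->]; rewrite ?ds// (lt_le_trans d0).
rewrite integral_itv_bndo_bndc; last by apply/measurable_EFinP; exact: measurable_funTS.
have dG' (s : R) : d <= s <= 1 -> is_derive s (1 : R) (fun s : R => phi (c s *: x)) (h s).
  by move=> /andP[/(lt_le_trans d0) s0 _]; exact: dG.
have ch' (s : R) : d <= s <= 1 -> {for s, continuous h}.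
  by move=> /andP[/(lt_le_trans d0) s0 _]; exact: ch.
rewrite (FTC2_itv d1 dG' ch') /c powR1 scale1r (test_out tphi (x := d `^ (- n%:R^-1) *: x)) ?subr0//.
have dd : 0 < d <= d by rewrite d0 lexx.
by rewrite /eball /= => /(le_lt_trans (cd d dd)); rewrite ltxx.
Qed.

(** The ray identity replaces phi by ray integrals of D, and [dilation_tonelli] moves the dilations
    onto F, whose means appear. Tonelli is applied to the positive and negative parts of D
    separately; both integrals are finite because |D y| <= M |y| leaves the weight |y|^(1 - n),
    integrable in dimension n. *)
Lemma weak_radial (F : measurableTypeR R -> R) (Q : R -> R) : measurable_fun setT F ->
  (forall s, 0 <= F s) ->
  (forall y, 0 < y <= 1 ->
    (\int[leb]_(s in `]0%R, y[) (F (r * s `^ n%:R^-1))%:E = (Q y)%:E)%E) ->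
  \int[mu]_(x in B) (F (enorm x) * phi x) =
  \int[mu]_(x in B) ((r / enorm x) ^+ n * Q ((enorm x / r) ^+ n) * D x).
Proof.
move=> mF F0 QE.
pose Dp y := Num.max (D y) 0; pose Dm y := Num.max (- D y) 0.
have Dp0 y : 0 <= Dp y by rewrite le_max lexx orbT.
have Dm0 y : 0 <= Dm y by rewrite le_max lexx orbT.
have Dpm y : Dp y - Dm y = D y.
  by rewrite /Dp /Dm; case: (leP (D y) 0) => h; case: (leP (- D y) 0) => h'; lra.
have mD : measurable_fun setT D.
  by apply: continuous_measurable_rV; exact: continuous_radial_derivative.
have mDp : measurable_fun setT Dp by apply: measurable_maxr => //; exact: measurable_cst.
have mDm : measurable_fun setT Dm.
  by apply: measurable_maxr; [exact: measurableT_comp|exact: measurable_cst].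
pose sR (y : 'rV[R]_n) := (r / enorm y) ^+ n * Q ((enorm y / r) ^+ n).
have Yle y : B y -> y != 0 -> 0 < (enorm y / r) ^+ n <= 1.
  rewrite /eball /= -enorm_gt0 => yr y0; rewrite exprn_gt0 ?divr_gt0//=.
  by rewrite exprn_ile1 ?divr_ge0 ?enorm_ge0 ?(ltW r0)// ler_pdivrMr// mul1r ltW.
have SE y : B y -> y != 0 -> radial_mean F y = (sR y)%:E.
  by move=> By y0; rewrite (radial_mean_scale n0 mF F0 r0 y0) QE ?Yle.
have Q1 y : 0 < y <= 1 -> 0 <= Q y <= Q 1.
  move=> /andP[y0 y1]; rewrite -!lee_fin -!QE ?ltr01 ?lexx ?y0//; apply/andP; split.
    by apply: integral_ge0 => s _; rewrite lee_fin.
  apply: ge0_subset_integral; [exact: measurable_itv|exact: measurable_itv| | |].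
  - apply/measurable_EFinP; apply: measurable_funTS; apply: (measurableT_comp mF).
    exact: measurable_funM.
  - by move=> s _; rewrite lee_fin.
  - by move=> s /=; rewrite !in_itv/= => /andP[-> /lt_le_trans ->].
have Q10 : 0 <= Q 1 by have /Q1/andP[] : 0 < (1 : R) <= 1 by rewrite ltr01 lexx.
have [M M0 DM] := radial_derivative_le.
have fin (g : 'rV[R]_n -> R) : measurable_fun setT g -> (forall y, 0 <= g y) -> (forall y, g y <= `|D y|) ->
    mu.-integrable setT (fun y => (g y)%:E * radial_mean F y)%E /\
    mu.-integrable setT (fun x => (F (enorm x))%:E * ray_integral g x)%E.
  move=> mg g0 gD.
  have mY : measurable_fun setT (fun y => (g y)%:E * radial_mean F y)%E.
    apply: emeasurable_funM; first exact/measurable_EFinP.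
    exact: measurable_radial_mean.
  have Y0 y : (0 <= (g y)%:E * radial_mean F y)%E.
    by rewrite mule_ge0 ?lee_fin// radial_mean_ge0.
  have I : (\int[mu]_y ((g y)%:E * radial_mean F y) < +oo)%E.
    pose W (y : 'rV[R]_n) := M * r ^+ n * Q 1 * enorm y `^ (1 - n%:R).
    have W0 y : 0 <= W y.
      by rewrite !mulr_ge0 ?powR_ge0 ?exprn_ge0 ?(ltW r0).
    have mW : measurable_fun setT (fun y : 'rV[R]_n => enorm y `^ (1 - n%:R)).
      exact: measurableT_comp (measurable_powR _) (@measurable_enorm R n).
    rewrite (_ : (\int[mu]_y _ = \int[mu]_(y in B) ((g y)%:E * radial_mean F y))%E); last first.
      rewrite [RHS]integral_mkcond; apply: eq_integral => y _; rewrite patchE; case: ifPn => //.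
      rewrite notin_setE /eball /= => /negP; rewrite -leNgt => /radial_derivative_out Dy.
      have gy : g y = 0 by apply/eqP; rewrite eq_le g0 andbT (le_trans (gD y))// Dy normr0.
      by rewrite gy mul0e.
    apply: (@le_lt_trans _ _ (Ip mu B 1 W)); last first.
      rewrite /W Ip_scale//; last exact: measurable_funTS.
      rewrite lte_mul_pinfty ?lee_fin ?powR_ge0//; apply: Ip_enorm_powR_lty => //.
      by rewrite mulr1; lra.
    rewrite IpE; apply: ge0_le_integral => //.
    - exact: measurable_funTS.
    - apply: measurable_powR_norm; apply: measurable_funM; first exact: measurable_cst.
      exact: measurable_funTS.
    move=> y By; have [->|y0] := eqVneq y 0.
      suff -> : g 0 = 0 by rewrite mul0e lee_fin powR_ge0.
      by apply/eqP; rewrite eq_le g0 andbT (le_trans (gD 0))// /dotr big1 ?mulr0 ?normr0// => i _; rewrite mxE mul0r.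
    rewrite SE// -EFinM lee_fin ger0_norm// powRr1//.
    have /andP[q0 q1] := Q1 _ (Yle y By y0).
    have ey : 0 < enorm y by rewrite enorm_gt0.
    apply: (@le_trans _ _ (M * enorm y * ((r / enorm y) ^+ n * Q 1))).
      apply: ler_pM => //; first by rewrite mulr_ge0 ?exprn_ge0 ?divr_ge0 ?(ltW r0) ?(ltW ey).
        by rewrite (le_trans (gD y)).
      by rewrite ler_wpM2l ?exprn_ge0 ?divr_ge0 ?(ltW r0) ?(ltW ey).
    rewrite le_eqVlt; apply/orP; left; apply/eqP; rewrite /W.
    rewrite powRD; last by rewrite (gt_eqF ey) implybT.
    rewrite powRr1 ?(ltW ey)// powRN powR_mulrn ?(ltW ey)// expr_div_n.
    by ring.
  split; apply/integrableP; split => //.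
  - rewrite (eq_integral (fun y => (g y)%:E * radial_mean F y)%E)// => y _.
    by rewrite gee0_abs.
  - apply: emeasurable_funM; last exact: measurable_ray_integral.
    by apply/measurable_EFinP; exact: measurableT_comp mF (@measurable_enorm R n).
  - rewrite (eq_integral (fun x => (F (enorm x))%:E * ray_integral g x)%E); last first.
      by move=> y _; rewrite gee0_abs// mule_ge0 ?lee_fin// ray_integral_ge0.
    by rewrite dilation_tonelli.
have DpD y : Dp y <= `|D y| by rewrite ge_max ler_norm normr_ge0.
have DmD y : Dm y <= `|D y| by rewrite ge_max ler_normr lexx orbT normr_ge0.
have [iY1 iX1] := fin Dp mDp Dp0 DpD; have [iY2 iX2] := fin Dm mDm Dm0 DmD.
have key : (\int[mu]_x (F (enorm x) * phi x)%:E = \int[mu]_x (sR x * D x)%:E)%E.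
  transitivity (\int[mu]_x (((F (enorm x))%:E * ray_integral Dp x)%E - ((F (enorm x))%:E * ray_integral Dm x)%E)%E)%E; last first.
    rewrite integralB// !dilation_tonelli// -integralB//; apply: eq_integral => y _.
    have [->|y0] := eqVneq y 0.
      have D0 : D 0 = 0 by rewrite /dotr big1 ?mulr0// => i _; rewrite mxE mul0r.
      by rewrite /Dp /Dm D0 oppr0 maxxx !mul0e sube0 mulr0.
    have [yB|] := ltP (enorm y) r; first by rewrite SE// -!EFinM -EFinB -mulrBl Dpm mulrC.
    move=> /radial_derivative_out Dy.
    by rewrite /Dp /Dm Dy oppr0 maxxx !mul0e sube0 mulr0.
  apply: ae_eq_integral => //.
  - apply/measurable_EFinP; apply: measurable_funM.
      exact: measurableT_comp mF (@measurable_enorm R n).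
    by apply: continuous_measurable_rV; case: C1phi.
  - by apply: measurable_int; exact: (integrableB _ iX1 iX2).
  exists [set 0]; split; [|exact: mu_set0_eq0 n0 r0|].
    rewrite (_ : [set 0] = setT `&` @enorm R n @^-1` [set 0]).
      by apply: measurable_enorm => //; exact: measurable_set1.
    by apply/seteqP; split => x /=; [move=> ->; rewrite enorm0|move=> [_ /eqP]; rewrite enorm_eq0 => /eqP].
  move=> x /=; apply: contra_notP => /eqP x0 _.
  have := ray_identity x0; rewrite integralE => RE.
  have RP : (\int[leb]_(s in I01) (fun s => ((s : R) `^ (-1) * D ((s : R) `^ (- n%:R^-1) *: x))%:E)^\+ s
     = ray_integral Dp x)%E.
    apply: eq_integral => s _; rewrite funeposE -EFin_max; congr EFin.
    by rewrite /Dp maxr_pMr ?powR_ge0// mulr0.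
  have RM : (\int[leb]_(s in I01) (fun s => ((s : R) `^ (-1) * D ((s : R) `^ (- n%:R^-1) *: x))%:E)^\- s
     = ray_integral Dm x)%E.
    apply: eq_integral => s _; rewrite funenegE -EFinN -EFin_max; congr EFin.
    by rewrite /Dm -mulrN maxr_pMr ?powR_ge0// mulr0.
  rewrite RP RM in RE; move: RE.
  have := ray_integral_ge0 x Dp0; have := ray_integral_ge0 x Dm0.
  case: (ray_integral Dp x) => [a||]//; case: (ray_integral Dm x) => [b||]// _ _.
  by rewrite -EFinB => -[<-]; rewrite -!EFinM -EFinB mulrBr.
rewrite !Rintegral_ballT; first by rewrite /Rintegral key.
- move=> x; rewrite /eball /= => /negP; rewrite -leNgt => /radial_derivative_out ->.
  by rewrite mulr0.
- by move=> x xB; rewrite (test_out tphi xB) mulr0.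
Qed.

End weak_radial.

Lemma continuous_abs_powR {R : realType} (b : R) : 0 < b -> continuous (fun t : R => `|t| `^ b).
Proof.
move=> b0 t; have [->|t0] := eqVneq t 0.
  apply/cvgrPdist_lt => e e0; rewrite normr0 powR0 ?gt_eqF//.
  have e1 : 0 < e `^ b^-1 by exact: powR_gt0.
  near=> s; rewrite sub0r normrN ger0_norm ?powR_ge0//.
  have H : `|s| < e `^ b^-1.
    by near: s; have /cvgrPdist_lt/(_ _ e1) := @cvg_id _ (nbhs (0 : R)); apply: filterS => s /=; rewrite sub0r normrN.
  have -> : e = (e `^ b^-1) `^ b by rewrite -powRrM mulVf ?gt_eqF// powRr1// ltW.
  by rewrite gt0_ltr_powR ?nnegrE ?powR_ge0.
apply: (@continuous_comp _ _ _ (fun t : R => `|t|) (fun s : R => s `^ b)).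
  exact: norm_continuous.
by apply: continuous_powR_pos; rewrite normr_gt0.
Unshelve. all: by end_near. Qed.

Lemma dotr_delta {R : realType} {n : nat} (v : 'rV[R]_n) i : dotr (delta_mx ord0 i) v = v ord0 i.
Proof.
rewrite /dotr (bigD1 i)//= mxE !eqxx mul1r big1 ?addr0// => j ji.
by rewrite mxE (negbTE ji) andbF mul0r.
Qed.

Lemma differentiable_dotr {R : realType} {n : nat} (x : 'rV[R]_n) :
  differentiable (fun x : 'rV[R]_n => dotr x x) x.
Proof.
have D1 (i : 'I_n) : differentiable (fun x : 'rV[R]_n => x ord0 i) x.
  exact: differentiable_coord.
rewrite (_ : (fun x => _) = \sum_(i < n) (fun x : 'rV[R]_n => x ord0 i * x ord0 i)).
  apply: (@differentiable_sum _ _ _ _ (fun (i : 'I_n) (x : 'rV[R]_n) => x ord0 i * x ord0 i) x) => i.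
  exact: (@differentiableM R 'rV[R]_n (fun x : 'rV[R]_n => x ord0 i) (fun x : 'rV[R]_n => x ord0 i) x).
by apply/funext => y; rewrite fct_sumE.
Qed.

(** * Profiles as functions of |x|^alpha *)

Section profile.
Context {R : realType} {n : nat} (r p alpha : R).
Hypotheses (n0 : (0 < n)%N) (r0 : 0 < r) (p1 : 1 < p) (al : 0 < alpha <= 1)
  (ap : - n%:R < (alpha - 1) * p).
Variable m : R -> R.
Hypothesis cm : continuous m.
Local Notation leb := (@lebesgue_measure R).
Local Notation B := (@eball R n r).

(* The lower bound -1 makes 0 an interior point. *)
Definition profile_primitive (t : R) : R := \int[leb]_(s in `[(-1), t]) m s.
Local Notation P := profile_primitive.

Definition profile (x : 'rV[R]_n) : R := P (r `^ alpha) - P (enorm x `^ alpha).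

(** Times x, this is the gradient of [profile] away from 0; the exponent is alpha - 2 because x is
    not normalised. *)
Definition profile_slope (x : 'rV[R]_n) : R :=
  - (alpha * m (enorm x `^ alpha) * enorm x `^ (alpha - 2)).

Let alpha0 : 0 < alpha. Proof. by case/andP : al. Qed.

Lemma is_derive_profile_primitive (t : R) : 0 <= t -> is_derive t (1 : R) P (m t).
Proof. by move=> t0; apply: is_derive_primitive => //; apply: lt_le_trans t0; rewrite ltrN10. Qed.

Lemma continuous_profile_primitive (t : R) : 0 <= t -> {for t, continuous P}.
Proof. by move=> t0; exact: is_derive1_continuous (is_derive_profile_primitive t0). Qed.

Let enorm_pow (x : 'rV[R]_n) (b : R) : dotr x x `^ b = enorm x `^ (2 * b).
Proof. by rewrite -sqr_enorm -powR_mulrn ?enorm_ge0// -powRrM. Qed.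

Lemma continuous_profile : continuous profile.
Proof.
move=> x; apply: continuous_sub; first by move=> y; exact: cst_continuous.
move=> y; apply: (@continuous_comp _ _ _ (fun x : 'rV[R]_n => enorm x `^ alpha) P).
  rewrite (_ : (fun x => _) = (fun t : R => `|t| `^ alpha) \o enorm); last first.
    by apply/funext => z /=; rewrite ger0_norm ?enorm_ge0.
  by apply: (@continuous_comp _ _ _ enorm (fun t : R => `|t| `^ alpha)); [exact: continuous_enorm|exact: continuous_abs_powR].
by apply: continuous_profile_primitive; exact: powR_ge0.
Qed.

(** The profile as a function of |x|^2, the form taken by [radial_W01p]; [zeta] is its
    derivative. *)
Let Z (t : R) : R := P (r `^ alpha) - P (t `^ (alpha / 2)).
Let zeta (t : R) : R := - (m (t `^ (alpha / 2)) * (alpha / 2 * t `^ (alpha / 2 - 1))).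

Let ZE : (fun x : 'rV[R]_n => Z (dotr x x)) = profile.
Proof. by apply/funext => x; rewrite /Z enorm_pow mulrC divfK. Qed.

Let zetaE (x : 'rV[R]_n) : 2 * zeta (dotr x x) = profile_slope x.
Proof.
rewrite /zeta /profile_slope !enorm_pow.
have E1 : 2 * (alpha / 2) = alpha by field.
have E2 : 2 * (alpha / 2 - 1) = alpha - 2 by field.
by rewrite E1 E2; field.
Qed.

Let dZ (t : R) : 0 < t -> is_derive t (1 : R) Z (zeta t).
Proof.
move=> t0; have d1 := @is_derive1_comp R P (fun t : R => t `^ (alpha / 2)) t _ _ (is_derive_profile_primitive (powR_ge0 t (alpha / 2)))
  (is_derive_powR_pos (alpha / 2) t0).
have := is_derive1_add (is_derive_cst (P (r `^ alpha)) t (1 : R)) (is_derive1_scale (-1) d1).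
rewrite add0r /zeta mulN1r; congr is_derive.
by apply/funext => s /=; rewrite mulN1r.
Qed.

Let rE : r `^ alpha = (r ^+ 2) `^ (alpha / 2).
Proof.
have r0' : 0 <= r by exact: ltW.
rewrite -(powR_mulrn 2 r0') -powRrM; congr powR.
by field.
Qed.

Lemma profile_W01p (M : R) : 0 <= M -> (forall t, 0 <= t <= r `^ alpha -> `|m t| <= M) ->
  W01p B p profile (fun x => profile_slope x *: x).
Proof.
move=> M0 mM; rewrite -ZE (_ : (fun x => _) = (fun x => (2 * zeta (dotr x x)) *: x)); last first.
  by apply/funext => x; rewrite zetaE.
have a0 : 0 < alpha / 2 by rewrite divr_gt0.
apply: (@radial_W01p _ _ r p n0 r0 p1 Z zeta (alpha / 2) (M * (alpha / 2))).
- by rewrite a0/=; case/andP : al; lra.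
- by rewrite mulr_ge0 ?(ltW a0).
- exact: dZ.
- move=> t t0.
  have c1 : {for t, continuous (fun t : R => t `^ (alpha / 2))} by exact: continuous_powR_pos.
  have c2 : {for t, continuous (fun t : R => t `^ (alpha / 2 - 1))} by exact: continuous_powR_pos.
  have c3 : {for t, continuous (fun t : R => m (t `^ (alpha / 2)))}.
    by apply: (@continuous_comp _ _ _ (fun t : R => t `^ (alpha / 2)) m t); [exact: c1|exact: cm].
  apply: (@cvgN _ _ _ (nbhs t)); apply: (@continuousM _ _ _ _ t c3).
  exact: (@continuousM _ _ _ _ t (@cst_continuous _ _ _ _) c2).
- have mm : measurable_fun setT (fun t : measurableTypeR R => m (t `^ (alpha / 2))).
    by apply: (measurableT_comp (continuous_measurable_fun cm)); exact: measurable_powR.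
  rewrite (_ : zeta = fun t => m (t `^ (alpha / 2)) * (- (alpha / 2) * t `^ (alpha / 2 - 1))); last first.
    by apply/funext => t; rewrite /zeta; ring.
  apply: (measurable_funM mm); apply: measurable_funM; first exact: measurable_cst.
  exact: measurable_powR.
- rewrite ZE; exact: continuous_profile.
- move=> t /andP[t0 tr]; rewrite /zeta normrN normrM -[M * _ * _]mulrA; apply: ler_pM; [exact: normr_ge0|exact: normr_ge0| |].
    apply: mM; rewrite powR_ge0/=.
    rewrite rE.
    have tr0 : 0 <= r ^+ 2 by exact: exprn_ge0 (ltW r0).
    by apply: (ge0_ler_powR (ltW a0)); [exact: (ltW t0)|exact: tr0|exact: tr].
  have q0 : 0 <= alpha / 2 * t `^ (alpha / 2 - 1) by exact: mulr_ge0 (ltW a0) (powR_ge0 _ _).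
  by rewrite (ger0_norm q0) lexx.
- by rewrite /Z rE subrr.
- have -> : 2 * (alpha / 2) = alpha by field.
  exact: ap.
Qed.

Lemma is_derive_profile (x v : 'rV[R]_n) : x != 0 ->
  is_derive x v profile (dotr v (profile_slope x *: x)).
Proof.
rewrite -enorm_gt0 => x0; rewrite -ZE.
have t0 : 0 < dotr x x by rewrite -sqr_enorm exprn_gt0.
have := is_derive_radial v (dZ t0); rewrite -zetaE.
by congr is_derive; rewrite dotrZr [dotr v x]dotrC; ring.
Qed.

Lemma grad_profile (x : 'rV[R]_n) : x != 0 -> grad profile x = profile_slope x *: x.
Proof.
move=> x0; apply/rowP => i; rewrite mxE /pderiv.
by have [_ ->] := is_derive_profile (delta_mx ord0 i) x0; rewrite dotr_delta.
Qed.

Lemma differentiable_profile (x : 'rV[R]_n) : x != 0 -> differentiable profile x.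
Proof.
rewrite -enorm_gt0 => x0; rewrite -ZE.
have t0 : 0 < dotr x x by rewrite -sqr_enorm exprn_gt0.
apply: (@differentiable_comp _ _ _ _ (fun x : 'rV[R]_n => dotr x x) Z).
  exact: differentiable_dotr.
by apply/derivable1_diffP; have [] := dZ t0.
Qed.

Lemma continuous_profile_gradient (x : 'rV[R]_n) : x != 0 ->
  {for x, continuous (fun x => profile_slope x *: x)}.
Proof.
rewrite -enorm_gt0 => x0.
have c1 (b : R) : {for x, continuous (fun x : 'rV[R]_n => enorm x `^ b)}.
  apply: (@continuous_comp _ _ _ enorm (fun t : R => t `^ b)).
    exact: continuous_enorm.
  exact: continuous_powR_pos.
have c2 : {for x, continuous (fun x : 'rV[R]_n => m (enorm x `^ alpha))}.
  by apply: (@continuous_comp _ _ _ (fun x : 'rV[R]_n => enorm x `^ alpha) m x); [exact: c1|exact: cm].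
have c3 : {for x, continuous profile_slope}.
  apply: (@cvgN _ _ _ (nbhs x)); apply: (@continuousM _ _ _ _ x _ (c1 _)).
  exact: (@continuousM _ _ _ _ x (@cst_continuous _ _ _ _) c2).
exact: (@cvgZ _ _ _ _ _ _ _ _ _ c3 (@cvg_id _ (nbhs x))).
Qed.

End profile.

(** * Strict convexity of the p-energy *)

Section young.
Context {R : realType} {n : nat} (p : R).
Hypothesis p1 : 1 < p.
Let p0 : 0 < p. Proof. exact: lt_trans ltr01 p1. Qed.
Let pm : 0 < p - 1. Proof. by rewrite subr_gt0. Qed.

(** The function t^p / p - h^(p - 1) t has the derivative t^(p - 1) - h^(p - 1), so h is its strict
    minimum on t > 0, while the hypothesis says that its value at g is no larger. The cases g = 0
    and h = 0 are settled beforehand. *)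
Lemma young_eq (g h : R) : 0 <= g -> 0 <= h ->
  g `^ p / p + (1 - p^-1) * h `^ p <= g * h `^ (p - 1) -> g = h.
Proof.
move=> g0 h0 H; have pi0 : 0 < p^-1 by rewrite invr_gt0.
have pi1 : 0 < 1 - p^-1 by rewrite subr_gt0 invf_lt1.
have hE : h `^ p = h * h `^ (p - 1).
  have [->|hn] := eqVneq h 0; first by rewrite powR0 ?gt_eqF// mul0r.
  rewrite -{2}(powRr1 h0) -powRD; last by rewrite hn implybT.
  by congr powR; ring.
have [h00|hn] := eqVneq h 0.
  move: H; rewrite h00 !powR0 ?gt_eqF// !mulr0 addr0 pmulr_lle0// => H.
  apply/eqP; rewrite eq_le g0 andbT leNgt; apply/negP => g1.
  by have := powR_gt0 p g1; rewrite ltNge H.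
have hp : 0 < h by rewrite lt0r hn.
have P0 : 0 < h `^ p by exact: powR_gt0.
have [g00|gn] := eqVneq g 0.
  move: H; rewrite g00 powR0 ?gt_eqF// !mul0r add0r leNgt.
  by rewrite mulr_gt0.
have gp : 0 < g by rewrite lt0r gn.
pose f (t : R) := p^-1 * t `^ p + - h `^ (p - 1) * t.
pose df (t : R) := t `^ (p - 1) - h `^ (p - 1).
have Df (t : R) : 0 < t -> is_derive t (1 : R) f (df t).
  move=> t0; have := is_derive1_add (is_derive1_scale p^-1 (is_derive_powR_pos p t0))
    (is_derive1_scale (- h `^ (p - 1)) (is_derive_id t (1 : R))).
  by rewrite mulr1 mulrA mulVf ?gt_eqF// mul1r.
have mvt a b : 0 < a -> a < b -> exists2 c, a < c < b & f b - f a = df c * (b - a).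
  move=> a0 ab.
  have [||c + E] := @MVT R f df a b ab.
  - by move=> t; rewrite in_itv/= => /andP[/(lt_trans a0) t0 _]; exact: Df.
  - apply: derivable_within_continuous => t; rewrite in_itv/= => /andP[/(lt_le_trans a0) t0 _].
    by have [] := Df t t0.
  - by rewrite in_itv/= => cab; exists c.
have fgh : f g <= f h.
  rewrite /f; move: H; rewrite hE; move: (g `^ p) (h `^ (p - 1)) => A C H.
  have : p^-1 * A = A / p by rewrite mulrC.
  by lra.
apply/eqP; rewrite eq_le !leNgt; apply/andP; split; apply/negP => lt.
  have [c /andP[hc cg] E] := mvt h g hp lt.
  have : 0 < df c * (g - h).
    rewrite mulr_gt0 ?subr_gt0//; apply: gt0_ltr_powR => //.
    by rewrite nnegrE (le_trans h0)// ltW.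
  by rewrite -E; lra.
have [c /andP[gc ch] E] := mvt g h gp lt.
have : 0 < (h `^ (p - 1) - c `^ (p - 1)) * (h - g).
  rewrite mulr_gt0 ?subr_gt0//; apply: gt0_ltr_powR => //.
  by rewrite nnegrE (le_trans g0)// ltW.
have -> : (h `^ (p - 1) - c `^ (p - 1)) * (h - g) = - (f h - f g) by rewrite E /df; ring.
by lra.
Qed.

Definition pflux (H : 'rV[R]_n) : 'rV[R]_n := enorm H `^ (p - 2) *: H.

Lemma enorm_pflux H : enorm (pflux H) = enorm H `^ (p - 1).
Proof.
rewrite /pflux enormZ ger0_norm ?powR_ge0//.
have [->|h0] := eqVneq (enorm H) 0; first by rewrite mulr0 powR0 ?gt_eqF.
rewrite -{2}(powRr1 (enorm_ge0 H)) -powRD; last by rewrite h0 implybT.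
by congr powR; ring.
Qed.

Lemma dotr_pflux H : dotr (pflux H) H = enorm H `^ p.
Proof.
rewrite /pflux dotrZl -sqr_enorm -powR_mulrn ?enorm_ge0//.
have [->|h0] := eqVneq (enorm H) 0; first by rewrite [X in _ * X]powR0 ?pnatr_eq0// mulr0 powR0 ?gt_eqF.
by rewrite -powRD ?h0 ?implybT//; congr powR; ring.
Qed.

(** The remainder |G|^p / p - |H|^p / p - pflux H . (G - H) of the tangent to |.|^p / p at H,
    simplified by pflux H . H = |H|^p. *)
Definition energy_gap (G H : 'rV[R]_n) : R :=
  enorm G `^ p / p + (1 - p^-1) * enorm H `^ p - dotr (pflux H) G.

Let pc_pow (h : R) : 0 <= h -> (h `^ (p - 1)) `^ (p / (p - 1)) = h `^ p.
Proof. by move=> h0; rewrite -powRrM; congr powR; field; rewrite gt_eqF. Qed.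

Lemma energy_gap_ge0 G H : 0 <= energy_gap G H.
Proof.
rewrite subr_ge0 (le_trans (dotr_le_enorm _ _))// enorm_pflux mulrC.
have pc0 : 0 < p / (p - 1) by rewrite divr_gt0.
have E : p^-1 + (p / (p - 1))^-1 = 1 by field; rewrite !gt_eqF.
have := conjugate_powR (enorm_ge0 G) (powR_ge0 (enorm H) (p - 1)) p0 pc0 E.
rewrite pc_pow ?enorm_ge0// => /le_trans; apply; rewrite lerD2l mulrC ler_wpM2r ?powR_ge0//.
by rewrite lerBrDl E.
Qed.

(** Equality in Young's inequality forces |G| = |H|, then equality in Cauchy-Schwarz forces G . H =
    |H|^2, so |G - H|^2 = 0. *)
Lemma energy_gap_eq0 G H : energy_gap G H = 0 -> G = H.
Proof.
move=> /eqP; rewrite subr_eq0 => /eqP gap.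
have gh : enorm G = enorm H.
  apply: young_eq; rewrite ?enorm_ge0// gap.
  by rewrite (le_trans (dotr_le_enorm _ _))// enorm_pflux mulrC.
have [h0|hn] := eqVneq (enorm H) 0.
  move: gh; rewrite h0 => /eqP; rewrite enorm_eq0 => /eqP ->.
  by move: h0 => /eqP; rewrite enorm_eq0 => /eqP ->.
have hp : 0 < enorm H by rewrite lt0r hn enorm_ge0.
have GH : dotr G H = enorm H ^+ 2.
  have : dotr (pflux H) G = dotr (pflux H) H.
    by rewrite dotr_pflux -gap gh; field; rewrite gt_eqF.
  rewrite /pflux !dotrZl => /(mulfI (lt0r_neq0 (powR_gt0 _ hp))).
  by rewrite dotrC -sqr_enorm.
apply/eqP; rewrite -subr_eq0 -enorm_eq0 -sqrf_eq0 sqr_enormD enormN gh.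
by rewrite -scaleN1r dotrZr GH; apply/eqP; ring.
Qed.

(** Young's inequality for the exponents q / (q - 1) and q, with z measured in units of k. At q = 1
    the first exponent is infinite, and the statement is an equality. *)
Lemma young_level (q u z k : R) : 1 <= q -> 0 < u -> 0 <= z -> 0 < k ->
  u `^ (q - 1) * z <= k * ((1 - q^-1) * u `^ q + q^-1 * (z / k) `^ q).
Proof.
move=> q1 u0 z0 k0; have zk : 0 <= z / k by rewrite divr_ge0// ltW.
rewrite -{1}(divfK (lt0r_neq0 k0) z) mulrA [leRHS]mulrC ler_wpM2r ?(ltW k0)//.
move: q1; rewrite le_eqVlt => /orP[/eqP <-|q1].
  by rewrite invr1 !subrr mul0r add0r mul1r powRr0 mul1r powRr1.
have qm : 0 < q - 1 by rewrite subr_gt0.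
have q0 : 0 < q by exact: lt_trans ltr01 q1.
have qc0 : 0 < q / (q - 1) by rewrite divr_gt0.
have E : (q / (q - 1))^-1 + q^-1 = 1 by field; rewrite !gt_eqF.
have := conjugate_powR (powR_ge0 u (q - 1)) zk qc0 q0 E.
have -> : (u `^ (q - 1)) `^ (q / (q - 1)) = u `^ q.
  by rewrite -powRrM; congr powR; field; rewrite gt_eqF.
move=> /le_trans; apply; rewrite [_ / q]mulrC lerD2r mulrC ler_wpM2r ?powR_ge0//.
by rewrite lerBrDr E.
Qed.

End young.

(** * Testing the equation and identifying the extremal function *)

Section identification.
Context {R : realType} {n : nat} (r p : R).
Hypothesis p2 : 2 <= p.
Local Notation mu := (@lebesgue_rV R n).
Local Notation B := (@eball R n r).
Local Notation E := (Ip mu B p).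
Local Notation pc := (p / (p - 1)).
Implicit Types (u v z f : 'rV[R]_n -> R) (G H X : 'rV[R]_n -> 'rV[R]_n).

Let mB : measurable B. Proof. exact: measurable_eball. Qed.
Let p1 : 1 < p. Proof. by apply: lt_le_trans p2; rewrite ltr1n. Qed.
Let p0 : 0 < p. Proof. exact: lt_trans ltr01 p1. Qed.
Let pm : 0 < p - 1. Proof. by rewrite subr_gt0. Qed.
Let pc1 : 1 < pc. Proof. by rewrite ltr_pdivlMr// mul1r ltrBlDr ltrDl. Qed.
Let ppc : p^-1 + pc^-1 = 1. Proof. by field; rewrite !gt_eqF. Qed.

Lemma integrable_Ip (s : R) f : measurable_fun B f -> (Ip mu B s f < +oo)%E ->
  mu.-integrable B (EFin \o (fun x => `|f x| `^ s)).
Proof.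
move=> mf fs; apply/integrableP; split.
  exact: measurable_powR_norm.
rewrite (eq_integral (fun x => (`|f x| `^ s)%:E)); first by rewrite -IpE.
by move=> x _ /=; rewrite ger0_norm ?powR_ge0.
Qed.

Lemma Rintegral_powR (s c : R) f : (forall x, B x -> 0 <= f x) ->
  Ip mu B s f = c%:E -> \int[mu]_(x in B) (f x `^ s) = c.
Proof.
move=> f0 fc; have -> : c = fine (Ip mu B s f) by rewrite fc.
rewrite IpE; congr fine; apply: eq_integral => x; rewrite inE => Bx.
by rewrite (ger0_norm (f0 x Bx)).
Qed.

Lemma integrable_dotr X G : (forall i, measurable_fun B (fun x => X x ord0 i)) ->
  (forall i, measurable_fun B (fun x => G x ord0 i)) ->
  (Ip mu B pc (enorm \o X) < +oo)%E -> (E (enorm \o G) < +oo)%E ->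
  mu.-integrable B (EFin \o (fun x => dotr (X x) (G x))).
Proof.
move=> mX mG Xoo Goo.
have I := integrable_pairing mB p1 pc1 ppc (measurable_enorm_comp mX) (measurable_enorm_comp mG) Xoo Goo.
apply: (le_integrable mB _ _ I).
  by apply/measurable_EFinP; exact: measurable_dotr_comp.
move=> x _ /=; rewrite lee_fin (le_trans (norm_dotr_le_enorm _ _))//.
by rewrite ger0_norm// mulr_ge0 ?enorm_ge0.
Qed.

(** Applied to phi k - v, [lambda_le] bounds lam times the p-th power of the L^q norm by the energy
    of the difference, which tends to 0. *)
Lemma approx_Lq v G (q lam : R) (phi : nat -> 'rV[R]_n -> R) : 0 < q -> 0 < lam ->
  lambda B p q = lam%:E -> W01p B p v G -> (Ip mu B q v < +oo)%E ->
  (forall k, test_function B (phi k)) ->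
  E (enorm \o (grad (phi k) \- G)) @[k --> \oo] --> 0%E ->
  Ip mu B q (phi k \- v) @[k --> \oo] --> 0%E.
Proof.
move=> q0 lam0 lamE vG vq tphi c; have q0' := ltW q0.
have [mv _ mG _ _] := W01p_facts p1 vG.
have mphi k : measurable_fun B (phi k) by apply: measurable_C1; exact: test_C1 (tphi k).
have W k : W01p B p (phi k \- v) (grad (phi k) \- G).
  exact: W01p_sub (W01p_test p1 (tphi k)) vG.
have mpv k : measurable_fun B (phi k \- v) by exact: measurable_funB.
have fin k : (Ip mu B q (phi k \- v)%R < +oo)%E.
  apply: (@le_lt_trans _ _ ((2 `^ q)%:E * (Ip mu B q (phi k) + Ip mu B q v))%E).
    by apply: Ip_add => // x _ /=; exact: ler_normB.
  rewrite lte_mul_pinfty ?lee_fin ?powR_ge0//; apply: lte_add_pinfty vq.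
  by apply: Ip_continuous_lty => //; case: (test_C1 (tphi k)).
have qp : 0 < q / p by rewrite divr_gt0.
apply/(@cvg_poweR0 _ _ _ _ _ (q / p) qp); first by move=> k; exact: Ip_ge0.
apply: cvge0_le (cvge0_scale lam^-1 c) => k; first exact: poweR_ge0.
have := lambda_le p2 q0 _ (W k); rewrite lamE.
have := Ip_ge0 mu B q (phi k \- v); move: (fin k).
case: (Ip mu B q (phi k \- v)) => [a _|//|//]; rewrite lee_fin le_eqVlt => /orP[/eqP <- _|a0 H].
  rewrite poweR_EFin powR0 ?invr_eq0 ?gt_eqF// mule_ge0 ?lee_fin ?invr_ge0 ?(ltW lam0)//.
  exact: Ip_ge0.
have {}H := H a a0 erefl.
rewrite invf_div poweR_EFin.
have -> : (a `^ (p / q))%:E = ((lam^-1)%:E * (lam%:E * (a `^ (p / q))%:E))%E.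
  by rewrite -!EFinM mulrA mulVf ?gt_eqF// mul1r.
by apply: lee_wpmul2l H; rewrite lee_fin invr_ge0 ltW.
Qed.

(** Both sides pass to the limit along the approximants of v: the left one in L^s, the right one
    through the gradients in L^p. The exponent s is a parameter because it will be q for q > 1, but
    p for q = 1. *)
Lemma weak_extend f X v G (s sc : R) : 1 < s -> 1 < sc -> s^-1 + sc^-1 = 1 ->
  measurable_fun B f -> (forall i, measurable_fun B (fun x => X x ord0 i)) ->
  (Ip mu B sc f < +oo)%E -> (Ip mu B pc (enorm \o X) < +oo)%E ->
  (forall phi, test_function B phi ->
    \int[mu]_(x in B) (f x * phi x) = \int[mu]_(x in B) dotr (X x) (grad phi x)) ->
  W01p B p v G -> (Ip mu B s v < +oo)%E ->
  (forall phi : nat -> 'rV[R]_n -> R, (forall k, test_function B (phi k)) ->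
    E (phi k \- v) @[k --> \oo] --> 0%E ->
    E (enorm \o (grad (phi k) \- G)) @[k --> \oo] --> 0%E ->
    Ip mu B s (phi k \- v) @[k --> \oo] --> 0%E) ->
  \int[mu]_(x in B) (f x * v x) = \int[mu]_(x in B) dotr (X x) (G x).
Proof.
move=> s1 sc1 ssc mf mX fsc Xpc WE vG vs Hs.
have [mv _ mG EG [phi [tphi c1 c2]]] := W01p_facts p1 vG.
have mphi k : measurable_fun B (phi k) by apply: measurable_C1; exact: test_C1 (tphi k).
have mg k i : measurable_fun B (fun x => grad (phi k) x ord0 i).
  by apply: measurable_grad_C1; exact: test_C1 (tphi k).
have phis k : (Ip mu B s (phi k) < +oo)%E.
  apply: Ip_continuous_lty; first by rewrite ltW// (lt_trans ltr01).
  by case: (test_C1 (tphi k)).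
have gE k : (E (enorm \o grad (phi k)) < +oo)%E by apply: (enormE_grad_lty r p1); exact: test_C1 (tphi k).
have L1 := cvg_pairing mB s1 sc1 ssc mf mv mphi fsc vs phis (Hs phi tphi c1 c2).
have L2 : \int[mu]_(x in B) dotr (X x) (grad (phi k) x) @[k --> \oo] -->
    \int[mu]_(x in B) dotr (X x) (G x).
  have mX' := measurable_enorm_comp mX.
  have md k : measurable_fun B (enorm \o (grad (phi k) \- G)).
    by apply: measurable_enorm_comp; exact: measurable_subG.
  have Ed k : (E (enorm \o (grad (phi k) \- G)%R) < +oo)%E.
    by have [_ _ _ + _] := W01p_facts p1 (W01p_sub p1 (W01p_test p1 (tphi k)) vG).
  (* The vector pairing is reduced to a scalar one: |X . (grad phi_k - G)| is at most |X| |grad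
     phi_k - G|, and the second factor tends to 0 in L^p. *)
  have c3 : E ((enorm \o (grad (phi k) \- G)) \- cst 0) @[k --> \oo] --> 0%E.
    rewrite (_ : (fun k => _) = fun k => E (enorm \o (grad (phi k) \- G)))//.
    by apply/funext => k; congr (Ip _ _ _ _); apply/funext => x /=; rewrite subr0.
  have E0 : (E (cst (0%R : R) : 'rV[R]_n -> R) < +oo)%E.
    by apply: Ip_continuous_lty; [exact: ltW|move=> x; exact: cst_continuous].
  have m0 : measurable_fun B (cst (0 : R) : 'rV[R]_n -> R) by exact: measurable_cst.
  have L := cvg_pairing mB p1 pc1 ppc mX' m0 md Xpc E0 Ed c3.
  have E1 : \int[mu]_(x in B) ((enorm \o X) x * cst (0 : R) x) = 0.
    rewrite (@eq_Rintegral _ _ _ _ _ (cst 0)); last by move=> x _ /=; rewrite mulr0.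
    by rewrite Rintegral_cst ?mul0r.
  rewrite E1 in L.
  apply/cvgrPdist_le => e e0; have /cvgrPdist_le/(_ e e0) := L.
  apply: filterS => k; rewrite sub0r normrN => Hk; rewrite distrC.
  have I1 := integrable_dotr mX (mg k) Xpc (gE k).
  have I2 := integrable_dotr mX mG Xpc EG.
  rewrite -RintegralB//; apply: le_trans Hk.
  apply: le_trans (le_normr_Rintegral mB (integrableB mB I1 I2)) _.
  rewrite [leRHS]ger0_norm; last first.
    by apply: Rintegral_ge0 => x _ /=; rewrite mulr_ge0 ?enorm_ge0.
  have mGk i : measurable_fun B (fun x => (grad (phi k) \- G) x ord0 i) by exact: measurable_subG.
  have I3 := integrable_pairing mB p1 pc1 ppc mX' (md k) Xpc (Ed k).
  apply: le_Rintegral => //.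
    exact: integrable_norm (integrableB mB I1 I2).
  move=> x _ /=; have -> : dotr (X x) (grad (phi k) x) - dotr (X x) (G x) = dotr (X x) (grad (phi k) x - G x).
    by rewrite dotrDr -[- G x]scaleN1r dotrZr mulN1r.
  exact: norm_dotr_le_enorm.
rewrite -(cvg_lim (@Rhausdorff R) L1) -(cvg_lim (@Rhausdorff R) L2).
rewrite (_ : (fun k => \int[mu]_(x in B) (f x * phi k x)) =
  fun k => \int[mu]_(x in B) dotr (X x) (grad (phi k) x))//.
by apply/funext => k; exact: WE.
Qed.

(* The energy gap has integral (1 - 1/p) (a - lam) <= 0. *)
Lemma identification u z G H (lam a : R) (i : 'I_n) : W01p B p u G -> W01p B p z H ->
  E (enorm \o G) = lam%:E -> E (enorm \o H) = a%:E -> a <= lam ->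
  \int[mu]_(x in B) dotr (pflux p (H x)) (G x) = lam ->
  {ae mu, forall x, B x -> u x = z x}.
Proof.
move=> uG zH EG EH alam XG.
have [mu_ _ mG _ _] := W01p_facts p1 uG.
have [mz _ mH _ _] := W01p_facts p1 zH.
have EG' : (E (enorm \o G) < +oo)%E by rewrite EG ltry.
have EH' : (E (enorm \o H) < +oo)%E by rewrite EH ltry.
have meG := measurable_enorm_comp mG; have meH := measurable_enorm_comp mH.
have mX j : measurable_fun B (fun x => pflux p (H x) ord0 j).
  rewrite /pflux; under eq_fun do rewrite mxE.
  by apply: measurable_funM => //; exact: measurableT_comp (measurable_powR _) meH.
have Xpc : (Ip mu B pc (enorm \o (fun x => pflux p (H x))) < +oo)%E.
  rewrite (_ : Ip _ _ _ _ = E (enorm \o H))//; rewrite !IpE; apply: eq_integral => x _.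
  rewrite /= enorm_pflux// !ger0_norm ?powR_ge0 ?enorm_ge0// -powRrM.
  by congr (_ `^ _)%:E; field; rewrite gt_eqF.
have I1 : mu.-integrable B (EFin \o (fun x => enorm (G x) `^ p)).
  have := integrable_Ip meG EG'; congr integrable; apply/funext => x /=.
  by rewrite ger0_norm ?enorm_ge0.
have I2 : mu.-integrable B (EFin \o (fun x => enorm (H x) `^ p)).
  have := integrable_Ip meH EH'; congr integrable; apply/funext => x /=.
  by rewrite ger0_norm ?enorm_ge0.
have R1 : \int[mu]_(x in B) (enorm (G x) `^ p) = lam.
  by apply: Rintegral_powR EG => x _; exact: enorm_ge0.
have R2 : \int[mu]_(x in B) (enorm (H x) `^ p) = a.
  by apply: Rintegral_powR EH => x _; exact: enorm_ge0.
have I3 := integrable_dotr mX mG Xpc EG'.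
have I1' := integrableZl mB p^-1 I1; have I2' := integrableZl mB (1 - p^-1) I2.
have I12 := integrableD mB I1' I2'; have I123 := integrableB mB I12 I3.
have gapE x : energy_gap p (G x) (H x) = p^-1 * enorm (G x) `^ p + (1 - p^-1) * enorm (H x) `^ p - dotr (pflux p (H x)) (G x).
  by rewrite /energy_gap [_ / p]mulrC.
have Igap : \int[mu]_(x in B) energy_gap p (G x) (H x) <= 0.
  rewrite (@eq_Rintegral _ _ _ _ _ (fun x => p^-1 * enorm (G x) `^ p + (1 - p^-1) * enorm (H x) `^ p - dotr (pflux p (H x)) (G x))); last by move=> x _; exact: gapE.
  rewrite (RintegralB mB I12 I3) (RintegralD mB I1' I2') (RintegralZl _ mB I1) (RintegralZl _ mB I2) R1 R2 XG.
  have pi0 : 0 < 1 - p^-1 by rewrite subr_gt0 invf_lt1.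
  rewrite (_ : _ - _ = (1 - p^-1) * (a - lam)); last by ring.
  by rewrite mulr_ge0_le0 ?(ltW pi0)// subr_le0.
have mgap : measurable_fun B (fun x => energy_gap p (G x) (H x)).
  have := measurable_int _ I123; move/measurable_EFinP.
  by congr measurable_fun; apply/funext => x; rewrite gapE.
have G1 : Ip mu B 1 (fun x => energy_gap p (G x) (H x)) = 0%E.
  have I : (\int[mu]_(x in B) (energy_gap p (G x) (H x))%:E)%E \is a fin_num.
    apply: integrable_fin_num => //; move: I123; congr integrable.
    by apply/funext => x; rewrite gapE.
  rewrite IpE (eq_integral (fun x => (energy_gap p (G x) (H x))%:E)); last first.
    by move=> x _; rewrite powRr1// ger0_norm// energy_gap_ge0.
  have I0 : (0 <= \int[mu]_(x in B) (energy_gap p (G x) (H x))%:E)%E.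
    by apply: integral_ge0 => x _; rewrite lee_fin energy_gap_ge0.
  by apply/eqP; rewrite eq_le I0 andbT -(fineK I) lee_fin.
have ae1 := Ip_eq0_ae mB ltr01 mgap G1.
have ae2 : {ae mu, forall x, B x -> G x - H x = 0}.
  by apply: filterS ae1 => x Hx Bx; rewrite (energy_gap_eq0 p1 (Hx Bx)) subrr.
have := W01p_grad0 p2 i (W01p_sub p1 uG zH) ae2.
by apply: filterS => x Hx Bx; apply/eqP; rewrite -subr_eq0 Hx.
Qed.

(* Young's inequality at the scale k = (a / lam)^(1/p) stands in for Hoelder's: it also
   covers q = 1 and needs no division by the norm of z. *)
Lemma extremal_level (u z : 'rV[R]_n -> R) (q lam a : R) : 1 <= q -> 0 < lam -> 0 <= a ->
  measurable_fun B u -> measurable_fun B z ->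
  (forall x, B x -> 0 < u x) -> (forall x, B x -> 0 <= z x) ->
  Ip mu B q u = 1%E -> (Ip mu B q z < +oo)%E ->
  (forall A, 0 < A -> Ip mu B q z = A%:E -> lam * A `^ (p / q) <= a) ->
  a = \int[mu]_(x in B) (lam * (u x `^ (q - 1) * z x)) -> a <= lam.
Proof.
move=> q1 lam0 a0 mu_ mz u0 z0 Iu zoo lamz aE.
have q0 : 0 < q by exact: lt_le_trans ltr01 q1.
move: a0; rewrite le_eqVlt => /orP[/eqP <-|a0]; first exact: ltW.
pose k := (a / lam) `^ p^-1; have k0 : 0 < k by exact: powR_gt0 (divr_gt0 a0 lam0).
have [b b0 bE] : exists2 b, 0 <= b & Ip mu B q z = b%:E.
  have := Ip_ge0 mu B q z; move: zoo; case: (Ip mu B q z) => [b _|//|//].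
  by rewrite lee_fin => b0; exists b.
have kq : k `^ q = (a / lam) `^ (q / p) by rewrite /k -powRrM; congr powR; exact: mulrC.
have bk : b <= k `^ q.
  move: b0; rewrite le_eqVlt => /orP[/eqP <-|b0]; first exact: powR_ge0.
  have H : b `^ (p / q) <= a / lam by rewrite ler_pdivlMr// mulrC lamz.
  rewrite kq (_ : b = (b `^ (p / q)) `^ (q / p)); last first.
    by rewrite -powRrM (_ : p / q * (q / p) = 1) ?powRr1 ?(ltW b0)//; field; rewrite !gt_eqF.
  by apply: ge0_ler_powR; rewrite ?nnegrE ?powR_ge0 ?divr_ge0 ?(ltW a0) ?(ltW lam0) ?(ltW q0) ?(ltW p0).
have Iu' : mu.-integrable B (EFin \o (fun x => u x `^ q)).
  have := integrable_Ip mu_ (_ : Ip mu B q u < +oo)%E; rewrite Iu ltry => /(_ isT).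
  apply: eq_integrable => // x; rewrite inE => Bx /=; by rewrite ger0_norm ?(ltW (u0 x Bx)).
have Iz' : mu.-integrable B (EFin \o (fun x => z x `^ q)).
  have := integrable_Ip mz zoo.
  apply: eq_integrable => // x; rewrite inE => Bx /=; by rewrite ger0_norm ?z0.
have Ru : \int[mu]_(x in B) (u x `^ q) = 1.
  by apply: Rintegral_powR Iu => x Bx; exact: ltW (u0 x Bx).
have Rz : \int[mu]_(x in B) (z x `^ q) = b.
  exact: Rintegral_powR z0 bE.
pose c1 := k * (1 - q^-1); pose c2 := k * q^-1 / k `^ q.
have J1 := integrableZl mB c1 Iu'; have J2 := integrableZl mB c2 Iz'.
have J12 := integrableD mB J1 J2.
have kiq : (k^-1) `^ q = (k `^ q)^-1.
  by rewrite -{1}(powR_inv1 (ltW k0)) -powRrM mulN1r powRN.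
have pt x : B x -> u x `^ (q - 1) * z x <= c1 * u x `^ q + c2 * z x `^ q.
  move=> Bx; rewrite (le_trans (young_level q1 (u0 x Bx) (z0 x Bx) k0))//.
  rewrite powRM ?z0 ?invr_ge0 ?(ltW k0)// kiq.
  by rewrite /c1 /c2 le_eqVlt; apply/orP; left; apply/eqP; ring.
have Iuz : mu.-integrable B (EFin \o (fun x => u x `^ (q - 1) * z x)).
  apply: (le_integrable mB _ _ J12).
    apply/measurable_EFinP; apply: measurable_funM => //.
    exact: measurableT_comp (measurable_powR _) mu_.
  move=> x Bx /=; rewrite lee_fin ger0_norm ?mulr_ge0 ?powR_ge0 ?z0//.
  by rewrite (le_trans (pt x Bx))// ler_norm.
rewrite RintegralZl// in aE.
have le1 : \int[mu]_(x in B) (u x `^ (q - 1) * z x) <= k.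
  apply: (@le_trans _ _ (\int[mu]_(x in B) (c1 * u x `^ q + c2 * z x `^ q))).
    exact: le_Rintegral.
  rewrite RintegralD// !RintegralZl// Ru Rz /c1 /c2.
  have h1 : b / k `^ q <= 1 by rewrite ler_pdivrMr ?mul1r// powR_gt0.
  have q1' : 0 <= q^-1 by rewrite invr_ge0 ltW.
  have h2 : k * q^-1 * (b / k `^ q) <= k * q^-1.
    by rewrite ler_piMr// mulr_ge0// ltW.
  have -> : k * q^-1 / k `^ q * b = k * q^-1 * (b / k `^ q) by rewrite [b / _]mulrC mulrA.
  by apply: le_trans (lerD (lexx _) h2) _; rewrite mulr1 -mulrDr subrK mulr1.
have ale : a <= lam * k by rewrite {1}aE ler_wpM2l// ltW.
(* If a / lam > 1, its p-th root k is strictly smaller than itself, against a <= lam k. *)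
rewrite leNgt; apply/negP => al.
have y1 : 1 < a / lam by rewrite ltr_pdivlMr// mul1r.
have y0 : 0 < a / lam by exact: lt_trans ltr01 y1.
have : a / lam <= k by rewrite ler_pdivrMr// mulrC.
have : k < a / lam.
  have gt1 (y c : R) : 0 < c -> 1 < y -> 1 < y `^ c.
    move=> c0 b1; have b0' : y \is Num.nneg by rewrite nnegrE (le_trans ler01)// ltW.
    have o0 : (1 : R) \is Num.nneg by rewrite nnegrE ler01.
    by have := gt0_ltr_powR c0 o0 b0' b1; rewrite powR1.
  have k1 : 1 < k by apply: gt1; rewrite ?invr_gt0.
  have -> : a / lam = k * k `^ (p - 1).
    rewrite -{1}(powRr1 (ltW k0)) -powRD; last by rewrite (gt_eqF k0) implybT.
    rewrite /k -powRrM (_ : p^-1 * (1 + (p - 1)) = 1) ?powRr1 ?(ltW y0)//.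
    by field; rewrite gt_eqF.
  by rewrite ltr_pMr// gt1.
by move=> /lt_le_trans h /h; rewrite ltxx.
Qed.

End identification.

(** * The profile of an extremal function *)

Section shell.
Context {R : realType} {n : nat} (r : R) (F : measurableTypeR R -> R).
Hypotheses (mF : measurable_fun setT F) (F0 : forall s, 0 <= F s).
Local Notation leb := (@lebesgue_measure R).
Local Notation I01 := (`]0%R, 1%R[%classic : set (measurableTypeR R)).
Hypothesis Foo : (\int[leb]_(s in I01) (F (r * s `^ n%:R^-1))%:E < +oo)%E.

(* In the variable s = (|x| / r)^n the uniform probability measure of the ball becomes
   the Lebesgue measure of ]0, 1[, so that shell y is the share of the ball of radius
   r y^(1/n) in the mean of F. The lower bound -1 makes 0 an interior point. *)
Definition shell_density : measurableTypeR R -> R :=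
  (fun s : measurableTypeR R => F (r * (s : R) `^ n%:R^-1)) \_ I01.

Definition shell (y : R) : R := \int[leb]_(s in `[(-1), y]) shell_density s.

Let mI : measurable I01. Proof. exact: measurable_itv. Qed.

Let md : measurable_fun setT shell_density.
Proof.
apply/(measurable_restrictT _ mI); apply: measurable_funTS; apply: (measurableT_comp mF).
exact: measurable_funM.
Qed.

Let d0 s : 0 <= shell_density s.
Proof. by rewrite /shell_density patchE; case: ifP. Qed.

Let Id (D : set (measurableTypeR R)) : measurable D -> leb.-integrable D (EFin \o shell_density).
Proof.
move=> mD; apply: (@integrableS _ _ _ _ setT) => //.
apply/integrableP; split; first exact/measurable_EFinP.
rewrite (eq_integral ((fun s : measurableTypeR R => (F (r * (s : R) `^ n%:R^-1))%:E) \_ I01)).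
  by rewrite -integral_mkcond.
move=> s _ /=; rewrite ger0_norm// /shell_density !patchE.
by case: ifP.
Qed.

Lemma continuous_shell (x : R) : -1 < x -> {for x, continuous shell}.
Proof.
move=> x1; have ab : -1 < x + 1 by lra.
have I : leb.-integrable `[(-1), x + 1] (EFin \o shell_density).
  by apply: Id; exact: measurable_itv.
have c := parameterized_integral_continuous (ltW ab) I.
have xin : x \in `]-1, x + 1[ by rewrite in_itv/= x1 ltrDl ltr01.
exact: (within_continuous_continuous ab c xin).
Qed.

Lemma shell_le (x y : R) : x <= y -> shell x <= shell y.
Proof.
move=> xy; have m (z : R) : measurable (`[(-1), z]%classic : set (measurableTypeR R)) by exact: measurable_itv.
rewrite -lee_fin /shell /Rintegral !fineK; first last.
- by apply: integrable_fin_num => //; exact: Id.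
- by apply: integrable_fin_num => //; exact: Id.
apply: ge0_subset_integral => //.
- by apply/measurable_EFinP; exact: measurable_funTS.
- by move=> s _; rewrite lee_fin.
- by move=> s /=; rewrite !in_itv/= => /andP[-> /le_trans ->].
Qed.

Lemma shell_ge0 (x : R) : 0 <= shell x.
Proof. by apply: Rintegral_ge0 => s _; exact: d0. Qed.

Lemma shellE (y : R) : 0 < y <= 1 ->
  (\int[leb]_(s in `]0%R, y[) (F (r * s `^ n%:R^-1))%:E = (shell y)%:E)%E.
Proof.
move=> /andP[y0 y1]; rewrite /shell /Rintegral fineK; last first.
  by apply: integrable_fin_num; [exact: measurable_itv|apply: Id; exact: measurable_itv].
rewrite -integral_itv_bndo_bndc; last by apply/measurable_EFinP; exact: measurable_funTS.
rewrite integral_mkcond [RHS]integral_mkcond; apply: eq_integral => s _.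
rewrite !patchE; case: ifPn => [|sn].
  rewrite inE/= in_itv/= => /andP[s0 sy].
  have s1 : s \in I01 by rewrite inE/= in_itv/= s0 (lt_le_trans sy).
  have -> : s \in (`[(-1)%R, y[%classic : set (measurableTypeR R)).
    by rewrite inE/= in_itv/= sy andbT (le_trans _ (ltW s0))// lerN10.
  by rewrite /shell_density patchE s1.
case: ifPn => //; rewrite inE/= in_itv/= => /andP[_ sy].
rewrite /shell_density patchE; case: ifPn => //; rewrite inE/= in_itv/= => /andP[s0 _].
by exfalso; move/negP : sn; apply; rewrite inE/= in_itv/= s0 sy.
Qed.

End shell.

Section extremal.
Context {R : realType} {n : nat} (r p q : R) (w : R -> R).
Hypotheses (n2 : (2 <= n)%N) (pn : n%:R < p) (r0 : 0 < r) (q1 : 1 <= q).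
Local Notation mu := (@lebesgue_rV R n).
Local Notation leb := (@lebesgue_measure R).
Local Notation B := (@eball R n r).
Local Notation E := (Ip mu B p).
Local Notation u := (fun x : 'rV[R]_n => w (enorm x)).
Local Notation I01 := (`]0%R, 1%R[%classic : set (measurableTypeR R)).
Hypothesis uext : positive_extremal B p q u.

(** The exponent of the radial p-harmonic function |x|^alpha: its p-flux is a multiple of |x|^(-n)
    x, which has no divergence away from 0. *)
Definition pexponent : R := (p - n%:R) / (p - 1).
Local Notation alpha := pexponent.

Let mB : measurable B. Proof. exact: measurable_eball. Qed.
Let n0 : (0 < n)%N. Proof. exact: ltn_trans n2. Qed.
Let np : 2 <= n%:R :> R. Proof. by rewrite ler_nat. Qed.
Let p2 : 2 <= p. Proof. by move: np pn; lra. Qed.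
Let p1 : 1 < p. Proof. by move: np pn; lra. Qed.
Let p0 : 0 < p. Proof. by move: np pn; lra. Qed.
Let pm : 0 < p - 1. Proof. by move: np pn; lra. Qed.
Let q0 : 0 < q. Proof. exact: lt_le_trans ltr01 q1. Qed.

Lemma pexponent_itv : 0 < alpha <= 1.
Proof.
rewrite /alpha divr_gt0//=; first by rewrite ler_pdivrMr// mul1r; move: np; lra.
by rewrite subr_gt0.
Qed.

Lemma pexponentE : (alpha - 1) * (p - 1) = 1 - n%:R.
Proof. by rewrite /alpha; field; rewrite gt_eqF. Qed.

Lemma pexponent_cond : - n%:R < (alpha - 1) * p.
Proof.
have /andP[a0 a1] := pexponent_itv; have E := pexponentE.
have : (alpha - 1) * p = 1 - n%:R + (alpha - 1) by rewrite -E; ring.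
by move=> ->; lra.
Qed.

Let i0 : 'I_n := Ordinal n0.
Let e0 : 'rV[R]_n := delta_mx ord0 i0.

Lemma extremal_facts : exists (lam : R) G, [/\ 0 < lam, lambda B p q = lam%:E,
  W01p B p u G, E (enorm \o G) = lam%:E & Ip mu B q u = 1%E].
Proof.
have [u0 N1 [G uG EG]] := uext.
have [mu_ _ mG EGoo _] := W01p_facts p1 uG.
rewrite (Lp_vnorm_powR _ p1) in EG.
have I1 : Ip mu B q u = 1%E.
  move: N1; rewrite Lp_normE// -IpE => H.
  have := poweRrM (Ip mu B q u) q^-1 q; rewrite H poweR1r mulVf ?gt_eqF//.
  by rewrite poweRe1// Ip_ge0.
have [lam lam0 lamE] : exists2 lam, 0 <= lam & E (enorm \o G) = lam%:E.
  have := Ip_ge0 mu B p (enorm \o G); move: EGoo; case: (E (enorm \o G)) => [b _|//|//].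
  by rewrite lee_fin => b0; exists b.
exists lam, G; split => //; last by rewrite -EG.
(* With lam = 0 the gradient vanishes almost everywhere, hence so does u, whose L^q norm is 1. *)
move: lam0; rewrite le_eqVlt => /orP[/eqP l0|//]; exfalso.
have ae1 : {ae mu, forall x, B x -> G x = 0}.
  have := Ip_eq0_ae mB p0 (measurable_enorm_comp mG) (_ : E (enorm \o G) = 0%E).
  rewrite lamE -l0 => /(_ erefl); apply: filterS => x Hx Bx.
  by apply/eqP; rewrite -enorm_eq0; apply/eqP; exact: Hx.
have ae2 := W01p_grad0 p2 i0 uG ae1.
have : Ip mu B q u = Ip mu B q (cst (0 : R)).
  by apply: Ip_ae_eq => //; exact: measurable_cst.
rewrite I1 IpE (eq_integral (cst 0%E)) ?integral0.
  by move=> /eqP; rewrite eqe oner_eq0.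
by move=> x _; rewrite normr0 powR0 ?gt_eqF.
Qed.

(** The cut-off is there because the hypotheses control w only on [0, r[, even as to
    measurability. *)
Definition extremal_source (lam : R) : measurableTypeR R -> R :=
  (fun s : measurableTypeR R => lam * (w s) `^ (q - 1)) \_ `[0%R, r[.

Lemma extremal_sourceE lam x : B x ->
  extremal_source lam (enorm x) = lam * u x `^ (q - 1).
Proof.
move=> Bx; rewrite /extremal_source patchE.
by have -> : enorm x \in (`[0, r[%classic : set R) by rewrite inE/= in_itv/= enorm_ge0.
Qed.

Lemma extremal_source_ge0 lam s : 0 <= lam -> 0 <= extremal_source lam s.
Proof.
by move=> l0; rewrite /extremal_source patchE; case: ifP => // _; rewrite mulr_ge0 ?powR_ge0.
Qed.

(** Measurability on the ball is with respect to the Borel sigma-algebra, so it passes to the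
    composite with s -> s e0, along which u is w. *)
Lemma measurable_extremal_source lam : measurable_fun B u ->
  measurable_fun setT (extremal_source lam).
Proof.
move=> mu_; have mD : measurable (`[0%R, r[%classic : set (measurableTypeR R)) by exact: measurable_itv.
apply/(measurable_restrictT _ mD); apply: measurable_funM => //.
suff mw : measurable_fun (`[0%R, r[%classic : set (measurableTypeR R)) w.
  exact: (measurableT_comp (measurable_powR (q - 1)) mw).
have ee : enorm e0 = 1 by exact: enorm_delta.
have es (s : R) : 0 <= s -> enorm (s *: e0) = s.
  by move=> s0; rewrite enormZ ee mulr1 ger0_norm.
have mi : measurable_fun setT (fun s : measurableTypeR R => (s : R) *: e0).
  apply/measurable_fun_rVP => j.
  rewrite (_ : _ \o _ = fun s : measurableTypeR R => s * e0 ord0 j).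
    exact: measurable_funM.
  by apply/funext => s; rewrite /coord_rV /= !mxE.
have := @measurable_comp _ _ _ _ _ _ B u `[0, r[%classic (fun s : measurableTypeR R => (s : R) *: e0) mB _ mu_ (measurable_funTS mi).
move=> H; apply: eq_measurable_fun (H _).
  by move=> s; rewrite inE/= in_itv/= => /andP[s0 _]; rewrite /= es.
by move=> y [s]; rewrite /= in_itv/= => /andP[s0 sr] <-; rewrite /eball/= es.
Qed.

Let Vfin : exists2 V : R, 0 < V & mu B = V%:E.
Proof.
have := mu_eball_gt0 (n := n) r0; have := mu_eball_fin (n := n) r.
by case: (mu B) => [v _|//|//]; rewrite lte_fin; exists v.
Qed.

(** [young_level] with z = k = 1 gives u^(q - 1) <= (1 - 1/q) u^q + 1/q, which is integrated over
    the ball. The bound approaches lam as q grows. *)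
Lemma extremal_source_mass lam V : 0 <= lam -> mu B = V%:E -> measurable_fun B u ->
  Ip mu B q u = 1%E ->
  (V%:E * \int[leb]_(s in I01) (extremal_source lam (r * s `^ n%:R^-1))%:E <=
   (lam * (1 - q^-1 + V / q))%:E)%E.
Proof.
move=> l0 VE mu_ Iu; have [u0 _ _] := uext.
have mS := measurable_extremal_source lam mu_.
have mSe : measurable_fun setT (fun s => (extremal_source lam s)%:E) by exact/measurable_EFinP.
have S0 s : (0 <= (extremal_source lam s)%:E)%E by rewrite lee_fin extremal_source_ge0.
rewrite -VE -(radial_integral n0 r0 mSe S0).
have qi : 0 <= 1 - q^-1 by rewrite subr_ge0 invf_le1.
have mup : measurable_fun B (fun x => (`|u x| `^ q)%:E) by exact: measurable_powR_norm.
apply: (@le_trans _ _ (\int[mu]_(x in B) ((lam * (1 - q^-1))%:E * (`|u x| `^ q)%:E + cst (lam / q)%:E x)))%E.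
  apply: ge0_le_integral => //.
  - by apply: measurable_funTS; apply: (measurableT_comp mSe); exact: measurable_enorm.
  - apply: emeasurable_funD; last exact: measurable_cst.
    by apply: emeasurable_funM => //; exact: measurable_cst.
  move=> x Bx; rewrite extremal_sourceE// -EFinM -EFinD lee_fin.
  have := young_level q1 (u0 x Bx) ler01 ltr01.
  rewrite mulr1 divr1 powR1 mulr1 mul1r => H.
  rewrite ger0_norm ?(ltW (u0 x Bx))//.
  by rewrite -!mulrA -mulrDr ler_wpM2l.
have lq : 0 <= lam / q by rewrite divr_ge0// ltW.
rewrite ge0_integralD//; first last.
- by apply: emeasurable_funM => //; exact: measurable_cst.
- by move=> x _; rewrite mule_ge0// lee_fin ?powR_ge0// mulr_ge0.
rewrite ge0_integralZl//.
rewrite -IpE Iu mule1 integral_cst// [X in (_ * X)%E]VE -EFinM -EFinD lee_fin.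
  by rewrite le_eqVlt; apply/orP; left; apply/eqP; ring.
by rewrite lee_fin mulr_ge0.
Qed.

Let T : R := r `^ alpha.

Definition extremal_mass (lam : R) : R -> R := shell (n := n) r (extremal_source lam).

(* The absolute value only makes the slope continuous on the whole line. *)
Definition extremal_slope (lam : R) (t : R) : R := alpha^-1 *
  (r ^+ n / n%:R * extremal_mass lam ((`|t| / T) `^ (n%:R / alpha))) `^ (p - 1)^-1.

Let a0 : 0 < alpha. Proof. by case/andP : pexponent_itv. Qed.
Let T0 : 0 < T. Proof. exact: powR_gt0. Qed.
Let nn : 0 < n%:R :> R. Proof. by rewrite ltr0n. Qed.

Section slope.
Variable (lam : R).
Hypotheses (l0 : 0 < lam) (mu_ : measurable_fun B u) (Iu : Ip mu B q u = 1%E).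

Let l0' : 0 <= lam. Proof. exact: ltW. Qed.
Let mS : measurable_fun setT (extremal_source lam).
Proof. exact: measurable_extremal_source. Qed.
Let S0 s : 0 <= extremal_source lam s. Proof. exact: extremal_source_ge0. Qed.

Lemma extremal_source_lty : (\int[leb]_(s in I01) (extremal_source lam (r * s `^ n%:R^-1))%:E < +oo)%E.
Proof.
have [V V0 VE] := Vfin; have := extremal_source_mass l0' VE mu_ Iu.
have : (0 <= \int[leb]_(s in I01) (extremal_source lam (r * s `^ n%:R^-1))%:E)%E.
  by apply: integral_ge0 => s _; rewrite lee_fin.
case: (\int[leb]_(s in I01) _)%E => [x _ _|_|//]; first exact: ltry.
by rewrite gt0_muley ?lte_fin.
Qed.

Lemma extremal_mass_ge0 y : 0 <= extremal_mass lam y.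
Proof. exact: shell_ge0. Qed.

Lemma extremal_slope_ge0 t : 0 <= extremal_slope lam t.
Proof. by rewrite /extremal_slope mulr_ge0 ?powR_ge0// invr_ge0 ltW. Qed.

Lemma extremal_slope_le s t : 0 <= s <= t -> extremal_slope lam s <= extremal_slope lam t.
Proof.
move=> /andP[s0 st]; have t0 := le_trans s0 st; rewrite /extremal_slope; apply: ler_wpM2l; first by rewrite invr_ge0 ltW.
have c0 : 0 <= r ^+ n / n%:R by rewrite divr_ge0 ?exprn_ge0 ?(ltW r0).
apply: ge0_ler_powR; first by rewrite invr_ge0 ltW.
- by rewrite nnegrE mulr_ge0 ?extremal_mass_ge0.
- by rewrite nnegrE mulr_ge0 ?extremal_mass_ge0.
apply: (ler_wpM2l c0); apply: (shell_le mS S0 extremal_source_lty).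
apply: ge0_ler_powR; first by rewrite divr_ge0 ?ltW.
- by rewrite nnegrE divr_ge0 ?normr_ge0 ?(ltW T0).
- by rewrite nnegrE divr_ge0 ?normr_ge0 ?(ltW T0).
by rewrite ler_pM2r ?invr_gt0// !ger0_norm.
Qed.

Lemma continuous_extremal_slope : continuous (extremal_slope lam).
Proof.
move=> t; apply: (@continuousM _ _ _ _ t (@cst_continuous _ _ _ _)).
pose h (t : R) := r ^+ n / n%:R * extremal_mass lam ((`|t| / T) `^ (n%:R / alpha)).
have ch : continuous h.
  move=> x; apply: (@continuousM _ _ _ _ x (@cst_continuous _ _ _ _)).
  apply: (@continuous_comp _ _ _ (fun t : R => (`|t| / T) `^ (n%:R / alpha)) (extremal_mass lam)).
    rewrite (_ : (fun t : R => _) = (fun s : R => `|s| `^ (n%:R / alpha)) \o (fun t : R => t * T^-1)).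
      apply: (@continuous_comp _ _ _ (fun t : R => t * T^-1) (fun s : R => `|s| `^ (n%:R / alpha))).
        exact: mulrr_continuous.
      by apply: continuous_abs_powR; rewrite divr_gt0.
    by apply/funext => s /=; rewrite normrM [`|T^-1|]ger0_norm// invr_ge0 ltW.
  by apply: (continuous_shell mS S0 extremal_source_lty); rewrite (lt_le_trans (ltrN10 _))// powR_ge0.
have h0 s : 0 <= h s.
  by rewrite /h mulr_ge0 ?extremal_mass_ge0// divr_ge0 ?exprn_ge0 ?(ltW r0).
rewrite (_ : (fun t : R => _) = (fun s : R => `|s| `^ (p - 1)^-1) \o h); last first.
  by apply/funext => s; rewrite /= (ger0_norm (h0 s)).
apply: (@continuous_comp _ _ _ h (fun s : R => `|s| `^ (p - 1)^-1)); first exact: ch.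
by apply: continuous_abs_powR; rewrite invr_gt0.
Qed.

(** At t = T the mass is evaluated at 1, that is over the whole ball, where [extremal_source_mass]
    bounds it. *)
Lemma extremal_slope_top V : mu B = V%:E ->
  extremal_slope lam T <= alpha^-1 *
    (r ^+ n / n%:R * (lam * (1 - q^-1 + V / q) / V)) `^ (p - 1)^-1.
Proof.
move=> VE; have V0 : 0 < V by have [V' V'0] := Vfin; rewrite VE => -[->].
rewrite /extremal_slope; apply: ler_wpM2l; first by rewrite invr_ge0 ltW.
have c0 : 0 <= r ^+ n / n%:R by rewrite divr_ge0 ?exprn_ge0 ?(ltW r0).
have qi : 0 <= 1 - q^-1 by rewrite subr_ge0 invf_le1.
have qi' : 0 <= q^-1 by rewrite invr_ge0 ltW.
apply: ge0_ler_powR; first by rewrite invr_ge0 ltW.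
- by rewrite nnegrE mulr_ge0 ?extremal_mass_ge0.
- by rewrite nnegrE mulr_ge0// divr_ge0 ?(ltW V0)// mulr_ge0// addr_ge0// mulr_ge0// ltW.
apply: (ler_wpM2l c0); rewrite (ger0_norm (ltW T0)) divff; last by rewrite gt_eqF.
rewrite powR1.
have o1 : 0 < (1 : R) <= 1 by rewrite ltr01 lexx.
have := extremal_source_mass l0' VE mu_ Iu.
rewrite (shellE mS S0 extremal_source_lty o1) -EFinM lee_fin => H.
by rewrite ler_pdivlMr// mulrC.
Qed.

Local Notation m := (extremal_slope lam).

(** [extremal_slope] is built for this identity: for t = |x|^alpha the argument of the mass is (|x|
    / r)^n, and the power 1/(p - 1) undoes the power p - 1 of the flux. The right side is the field
    produced by [weak_radial]. *)
Lemma pflux_extremal (x : 'rV[R]_n) : x != 0 ->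
  pflux p (profile_slope alpha m x *: x) =
  (- n%:R^-1 * ((r / enorm x) ^+ n * extremal_mass lam ((enorm x / r) ^+ n))) *: x.
Proof.
rewrite -enorm_gt0 => x0; have x0' := ltW x0.
rewrite /pflux scalerA; congr (_ *: _).
pose A := r ^+ n / n%:R * extremal_mass lam ((enorm x / r) ^+ n).
have A0 : 0 <= A.
  by rewrite /A mulr_ge0 ?extremal_mass_ge0// divr_ge0 ?exprn_ge0 ?(ltW r0).
have mE : alpha * m (enorm x `^ alpha) = A `^ (p - 1)^-1.
  rewrite /extremal_slope mulrA mulfV ?gt_eqF// mul1r; congr (_ `^ _); congr (_ * _).
  congr (extremal_mass lam _).
  rewrite ger0_norm ?powR_ge0// /T -powR_inv1 ?powR_ge0// -powRrM.
  have -> : r `^ (alpha * -1) = (r^-1) `^ alpha.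
    by rewrite -{1}(powR_inv1 (ltW r0)) -powRrM; congr powR; ring.
  rewrite -powRM ?invr_ge0 ?(ltW r0)// -powRrM.
  have -> : alpha * (n%:R / alpha) = n%:R by field; rewrite gt_eqF.
  by rewrite powR_mulrn// divr_ge0 ?(ltW r0).
rewrite /profile_slope mE; set s := A `^ (p - 1)^-1; set e := enorm x.
have ep : 0 < e := x0; have e0' : 0 <= e := x0'.
have s0 : 0 <= s by exact: powR_ge0.
have e2 : e `^ (alpha - 2) * e = e `^ (alpha - 1).
  rewrite -{2}(powRr1 e0') -powRD; last by rewrite (gt_eqF ep) implybT.
  by congr powR; ring.
have nE : enorm (- (s * e `^ (alpha - 2)) *: x) = s * e `^ (alpha - 1).
  by rewrite enormZ normrN ger0_norm ?mulr_ge0 ?powR_ge0// -mulrA e2.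
rewrite nE powRM ?powR_ge0// -powRrM.
have [s00|sn] := eqVneq s 0.
  have A00 : A = 0.
    by apply: (@powR_eq0_eq0 _ A (p - 1)^-1).
  rewrite s00 mul0r oppr0 mulr0.
  have : extremal_mass lam ((e / r) ^+ n) = 0.
    move/eqP: A00; rewrite /A mulf_eq0 => /orP[|/eqP//].
    by rewrite gt_eqF// divr_gt0// exprn_gt0.
  by move=> ->; rewrite !mulr0.
have sA : s `^ (p - 2) * s = A.
  rewrite -{2}(powRr1 s0) -powRD; last by rewrite sn implybT.
  rewrite /s -powRrM (_ : (p - 1)^-1 * (p - 2 + 1) = 1) ?powRr1//.
  by field; rewrite gt_eqF.
have eE : e `^ ((alpha - 1) * (p - 2)) * e `^ (alpha - 2) = (e ^+ n)^-1.
  rewrite -powRD; last by rewrite (gt_eqF ep) implybT.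
  rewrite -powR_mulrn// -powRN; congr powR.
  have H := pexponentE.
  have -> : (alpha - 1) * (p - 2) + (alpha - 2) = (alpha - 1) * (p - 1) - 1 by ring.
  by rewrite H; ring.
transitivity (- (s `^ (p - 2) * s * (e `^ ((alpha - 1) * (p - 2)) * e `^ (alpha - 2)))).
  by ring.
rewrite sA eE /A -/e [(r / e) ^+ n]expr_div_n.
by move: (extremal_mass _ _) (e ^- n) (r ^+ n) n%:R^-1 => M a b c; ring.
Qed.

End slope.

End extremal.

Lemma profile_primitive_le {R : realType} (m : R -> R) (s t : R) : continuous m ->
  (forall t, 0 <= m t) -> 0 <= s <= t -> profile_primitive m s <= profile_primitive m t.
Proof.
move=> cm m0 /andP[s0 st]; rewrite -subr_ge0.
have := @norm_increment_le R (cst 0) (profile_primitive m) (cst 0) m s t st.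
rewrite /= subrr normr0; apply.
- by move=> x /andP[sx _]; apply: is_derive_profile_primitive => //; exact: le_trans sx.
- by move=> x _; exact: m0.
Qed.

(** * The extremal function is its profile *)

Section extremal_identification.
Context {R : realType} {n : nat} (r p q : R) (w : R -> R).
Hypotheses (n2 : (2 <= n)%N) (pn : n%:R < p) (r0 : 0 < r) (q1 : 1 <= q).
Local Notation mu := (@lebesgue_rV R n).
Local Notation B := (@eball R n r).
Local Notation E := (Ip mu B p).
Local Notation u := (fun x : 'rV[R]_n => w (enorm x)).
Hypothesis uext : positive_extremal B p q u.
Local Notation alpha := (@pexponent R n p).
Local Notation m := (extremal_slope (n := n) r p q w).
Local Notation pc := (p / (p - 1)).

Let mB : measurable B. Proof. exact: measurable_eball. Qed.
Let n0 : (0 < n)%N. Proof. exact: ltn_trans n2. Qed.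
Let np : 2 <= n%:R :> R. Proof. by rewrite ler_nat. Qed.
Let p2 : 2 <= p. Proof. by move: np pn; lra. Qed.
Let p1 : 1 < p. Proof. by move: np pn; lra. Qed.
Let p0 : 0 < p. Proof. by move: np pn; lra. Qed.
Let pm : 0 < p - 1. Proof. by move: np pn; lra. Qed.
Let q0 : 0 < q. Proof. exact: lt_le_trans ltr01 q1. Qed.

Lemma extremal_profile : exists lam : R, [/\ 0 < lam, lambda B p q = lam%:E,
  measurable_fun B u /\ Ip mu B q u = 1%E,
  W01p B p (profile r alpha (m lam)) (fun x : 'rV[R]_n => profile_slope alpha (m lam) x *: x) &
  {ae mu, forall x, B x -> u x = profile r alpha (m lam) x}].
Proof.
have [lam [G [l0 lamE uG EG Iu]]] := extremal_facts n2 pn q1 uext.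
have [mu_ _ mG _ _] := W01p_facts p1 uG; have [u0 _ _] := uext.
have l0' : 0 <= lam by exact: ltW.
have cm : continuous (m lam) by exact: continuous_extremal_slope.
have m0 t : 0 <= m lam t by exact: extremal_slope_ge0.
pose z : 'rV[R]_n -> R := profile r alpha (m lam).
pose H (x : 'rV[R]_n) := profile_slope alpha (m lam) x *: x.
have mb t : 0 <= t <= r `^ alpha -> `|m lam t| <= m lam (r `^ alpha).
  move=> tT; rewrite (ger0_norm (m0 t)).
  exact: (extremal_slope_le n2 pn r0 q1 uext l0 mu_ Iu).
have zH : W01p B p z H.
  exact: (profile_W01p n0 r0 p1 (pexponent_itv n2 pn) (pexponent_cond n2 pn) cm (m0 _) mb).
exists lam; split => //.
have [mz _ mH EHoo _] := W01p_facts p1 zH.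
have meH := measurable_enorm_comp mH.
pose X (x : 'rV[R]_n) := pflux p (H x).
have mX i : measurable_fun B (fun x => X x ord0 i).
  rewrite /X /pflux; under eq_fun do rewrite mxE.
  by apply: measurable_funM => //; exact: measurableT_comp (measurable_powR _) meH.
have Xpc : (Ip mu B pc (enorm \o X) < +oo)%E.
  rewrite (_ : Ip _ _ _ _ = E (enorm \o H))//; rewrite !IpE; apply: eq_integral => x _.
  rewrite /= enorm_pflux// !ger0_norm ?powR_ge0 ?enorm_ge0// -powRrM.
  by congr (_ `^ _)%:E; field; rewrite gt_eqF.
pose f (x : 'rV[R]_n) := lam * u x `^ (q - 1).
have mup : measurable_fun B (fun x => u x `^ (q - 1)).
  exact: measurableT_comp (measurable_powR _) mu_.
have mf : measurable_fun B f by exact: measurable_funM.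
have mS := measurable_extremal_source q n2 lam mu_.
have S0 s := extremal_source_ge0 r q w s l0'.
have Soo := extremal_source_lty n2 r0 q1 uext l0 mu_ Iu.
have WE phi : test_function B phi ->
    \int[mu]_(x in B) (f x * phi x) = \int[mu]_(x in B) dotr (X x) (grad phi x).
  move=> tphi; have := weak_radial n0 r0 tphi mS S0 (fun y => shellE mS S0 Soo (y := y)).
  have -> : \int[mu]_(x in B) (extremal_source r q w lam (enorm x) * phi x) =
      \int[mu]_(x in B) (f x * phi x).
    by apply: eq_Rintegral => x; rewrite inE => Bx; rewrite extremal_sourceE.
  move=> ->; apply: eq_Rintegral => x _; rewrite /X /H.
  have [->|x0] := eqVneq x 0.
    by rewrite /pflux !scaler0 /dotr !big1 ?mulr0// => i _; rewrite mxE mul0r.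
  rewrite (pflux_extremal q w n2 pn r0 l0 x0) dotrZl.
  by rewrite mulrA; congr (_ * _); rewrite mulrC.
have key v K : W01p B p v K -> (Ip mu B q v < +oo)%E ->
    \int[mu]_(x in B) (f x * v x) = \int[mu]_(x in B) dotr (X x) (K x).
  (* For q = 1 the conjugate exponent is infinite; but then f is the constant lam, and the pairing
     is made in L^p and its dual. For q > 1, f lies in the dual exponent because its power q / (q -
     1) is a multiple of u^q. *)
  move=> vK vq; move: (q1); rewrite le_eqVlt => /orP[/eqP q1E|q1lt].
    have pc1 : 1 < pc by rewrite ltr_pdivlMr// mul1r ltrBlDr ltrDl.
    have ppc : p^-1 + pc^-1 = 1 by field; rewrite !gt_eqF.
    have [_ vp _ _ _] := W01p_facts p1 vK.
    apply: (weak_extend p2 p1 pc1 ppc mf mX _ Xpc WE vK vp) => //.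
    rewrite (_ : f = cst lam); last by apply/funext => x; rewrite /f -q1E subrr powRr0 mulr1.
    apply: Ip_continuous_lty; last by move=> x; exact: cst_continuous.
    by rewrite ltW// (lt_trans ltr01).
  have qm : 0 < q - 1 by rewrite subr_gt0.
  have qc1 : 1 < q / (q - 1) by rewrite ltr_pdivlMr// mul1r ltrBlDr ltrDl.
  have qqc : q^-1 + (q / (q - 1))^-1 = 1 by field; rewrite !gt_eqF.
  apply: (weak_extend p2 q1lt qc1 qqc mf mX _ Xpc WE vK vq).
    rewrite /f Ip_scale//; last by rewrite divr_ge0// ltW.
    rewrite (_ : Ip _ _ _ _ = Ip mu B q u); first by rewrite Iu mule1 ltry.
    rewrite !IpE; apply: eq_integral => x; rewrite inE => Bx.
    rewrite !ger0_norm ?powR_ge0 ?(ltW (u0 x Bx))// -powRrM.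
    by congr (_ `^ _)%:E; field; rewrite gt_eqF.
  by move=> phi tphi _; exact: (approx_Lq p2 q0 l0 lamE vK vq tphi).
have [a a0 EH] : exists2 a, 0 <= a & E (enorm \o H) = a%:E.
  have := Ip_ge0 mu B p (enorm \o H); move: EHoo; case: (E (enorm \o H)) => [b _|//|//].
  by rewrite lee_fin => b0; exists b.
have zq : (Ip mu B q z < +oo)%E.
  apply: Ip_continuous_lty; first exact: ltW.
  by move=> x; exact: (@continuous_profile R n r alpha (pexponent_itv n2 pn) (m lam) cm x).
have z0 x : B x -> 0 <= z x.
  rewrite /eball /= => xr; rewrite subr_ge0; apply: profile_primitive_le => //.
  rewrite powR_ge0/=; have /andP[al0 _] := pexponent_itv (R := R) n2 pn.
  by apply: ge0_ler_powR; rewrite ?nnegrE ?enorm_ge0 ?(ltW r0) ?(ltW al0) ?(ltW xr).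
have uq : (Ip mu B q u < +oo)%E by rewrite Iu ltry.
(* The equation tested with u: f u = lam u^q has integral lam. *)
have XG : \int[mu]_(x in B) dotr (X x) (G x) = lam.
  rewrite -(key u G uG uq) (@eq_Rintegral _ _ _ _ _ (fun x => lam * `|u x| `^ q)).
    rewrite RintegralZl//; last exact: integrable_Ip.
    by rewrite /Rintegral -IpE Iu /= mulr1.
  move=> x; rewrite inE => Bx; rewrite /f ger0_norm ?(ltW (u0 x Bx))// -mulrA.
  by congr (_ * _); rewrite mulrC mulr_powRB1// ltW// u0.
have XH : \int[mu]_(x in B) dotr (X x) (H x) = a.
  rewrite /Rintegral -[RHS]/(fine a%:E) -EH IpE; congr fine; apply: eq_integral => x _.
  by rewrite /= ger0_norm ?enorm_ge0// dotr_pflux.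
have alam : a <= lam.
  apply: (extremal_level p2 q1 l0 a0 mu_ mz u0 z0 Iu zq).
    move=> A A0 IA; have := lambda_le p2 q0 A0 zH IA.
    by rewrite lamE EH -EFinM lee_fin.
  rewrite -XH -(key z H zH zq); apply: eq_Rintegral => x _.
  by rewrite /f mulrA.
exact: (identification p2 (Ordinal n0) uG zH EG EH alam XG).
Qed.

End extremal_identification.

(** * The limit of the profiles *)

Section slope_limit.
Context {R : realType} (T : R).
Hypothesis T0 : 0 < T.

(** The left side is an increment of the primitive of m - 1 / T. On [e, T] the integrand is at most
    eta; on [0, e], where the slopes need not be close, only the crude bound M + 1 / T is used. *)
Lemma profile_gap (m : R -> R) (e eta M : R) : continuous m -> 0 < e <= T -> 0 <= eta ->
  (forall t, e <= t <= T -> `|m t - T^-1| <= eta) ->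
  (forall t, 0 <= t <= T -> 0 <= m t <= M) ->
  forall t, 0 <= t <= T ->
  `|profile_primitive m T - profile_primitive m t - T^-1 * (T - t)| <=
  T * eta + e * (M + T^-1).
Proof.
move=> cm /andP[e0 eT] eta0 meta mM t /andP[t0 tT].
have Ti : 0 < T^-1 by rewrite invr_gt0.
have TT : 0 <= T <= T by rewrite lexx ltW.
have /andP[mT1 mT2] := mM T TT; have M0 := le_trans mT1 mT2.
pose f (s : R) := profile_primitive m s + - T^-1 * s.
have Df (s : R) : 0 <= s -> is_derive s (1 : R) f (m s + - T^-1 * 1).
  move=> s0; exact: is_derive1_add (is_derive_profile_primitive cm s0)
    (is_derive1_scale (- T^-1) (is_derive_id s (1 : R))).
have inc (c a b : R) : 0 <= a <= b -> (forall s, a <= s <= b -> `|m s - T^-1| <= c) ->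
    `|f b - f a| <= c * (b - a).
  move=> /andP[a0 ab] H; rewrite mulrBr.
  apply: (norm_increment_le ab (g := fun s => c * s) (dg := fun=> c * 1) (df := fun s => m s + - T^-1 * 1)).
  - by move=> s /andP[sa _]; apply: Df; exact: le_trans sa.
  - by move=> s sab; rewrite !mulr1 H.
have -> : profile_primitive m T - profile_primitive m t - T^-1 * (T - t) = f T - f t.
  by rewrite /f; ring.
have big (a : R) : e <= a <= T -> `|f T - f a| <= T * eta.
  move=> /andP[ea aT]; have a0 : 0 <= a by rewrite (le_trans (ltW e0)).
  apply: le_trans (inc eta a T _ _) _; first by rewrite a0.
    by move=> s /andP[sa sT]; apply: meta; rewrite sT (le_trans ea).
  by rewrite mulrC ler_wpM2r//; lra.
have [et|te] := leP e t.
  rewrite (le_trans (big t _)) ?et// lerDl mulr_ge0 ?(ltW e0)//.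
  by rewrite addr_ge0 ?(ltW Ti).
have -> : f T - f t = (f T - f e) + (f e - f t) by ring.
rewrite (le_trans (ler_normD _ _))//; apply: lerD.
  by apply: big; rewrite lexx.
apply: le_trans (inc (M + T^-1) t e _ _) _; first by rewrite t0 ltW.
  move=> s /andP[ts se]; have /andP[s0 sM] : 0 <= m s <= M.
    by apply: mM; rewrite (le_trans t0 ts) (le_trans se).
  by rewrite (le_trans (ler_normB _ _))// !ger0_norm ?(ltW Ti)// lerD2r.
rewrite mulrC ler_wpM2r//; first by rewrite addr_ge0 ?(ltW Ti).
by lra.
Qed.

(** By monotonicity the upper bound at T holds everywhere, and only m(e) could be too small. The
    total increment is at least 1 - d, at most (1 / T + d)(T - e) of it comes from [e, T], and at
    most e m(e) from [0, e]; hence e m(e) >= e / T - d (1 + T), which explains the choice of d. *)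
Lemma slope_limit (I : Type) (F : set_system I) {FF : Filter F} (m : I -> R -> R) :
  (\forall q \near F, [/\ continuous (m q), forall t, 0 <= m q t &
    forall s t, 0 <= s <= t -> m q s <= m q t]) ->
  (forall eta, 0 < eta -> \forall q \near F, m q T <= T^-1 + eta) ->
  (forall eta, 0 < eta -> \forall q \near F,
    1 - eta <= profile_primitive (m q) T - profile_primitive (m q) 0) ->
  forall e eta, 0 < e <= T -> 0 < eta ->
  \forall q \near F, forall t, e <= t <= T -> `|m q t - T^-1| <= eta.
Proof.
move=> H1 H2 H3 e eta /andP[e0 eT] eta0.
pose d := eta * e / (1 + T).
have T1 : 0 < 1 + T by rewrite addr_gt0.
have d0 : 0 < d by rewrite divr_gt0// mulr_gt0.
have Ti : 0 < T^-1 by rewrite invr_gt0.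
have dE : d * (1 + T) = eta * e by rewrite divfK// gt_eqF.
near=> q.
have [cm m0 md] : [/\ continuous (m q), forall t, 0 <= m q t &
    forall s t, 0 <= s <= t -> m q s <= m q t] by near: q.
have h2 : m q T <= T^-1 + eta by near: q; exact: H2.
have h2' : m q T <= T^-1 + d by near: q; exact: H2.
have h3 : 1 - d <= profile_primitive (m q) T - profile_primitive (m q) 0 by near: q; exact: H3.
have inc (a b : R) : 0 <= a <= b ->
    profile_primitive (m q) b - profile_primitive (m q) a <= m q b * (b - a).
  move=> /andP[a0 ab]; rewrite mulrBr; apply: le_trans (ler_norm _) _.
  apply: (norm_increment_le ab (g := fun s => m q b * s) (dg := fun=> m q b * 1) (df := m q)).
  - by move=> s /andP[sa _]; apply: is_derive_profile_primitive => //; exact: le_trans sa.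
  - by move=> s _; exact: is_derive1_scale (is_derive_id s (1 : R)).
  - by move=> s /andP[sa sb]; rewrite mulr1 ger0_norm// md// sb (le_trans a0).
have i1 : profile_primitive (m q) e - profile_primitive (m q) 0 <= m q e * (e - 0).
  by apply: inc; rewrite lexx ltW.
have i2 : profile_primitive (m q) T - profile_primitive (m q) e <= m q T * (T - e).
  by apply: inc; rewrite eT ltW.
have i3 : m q T * (T - e) <= (T^-1 + d) * (T - e) by rewrite ler_wpM2r// subr_ge0.
have TT : T^-1 * T = 1 by rewrite mulVf// gt_eqF.
have me : T^-1 - eta <= m q e.
  rewrite -(ler_pM2r e0).
  have de : 0 <= d * e by rewrite mulr_ge0 ?ltW.
  move: i1 i2 i3 h3 dE TT de; rewrite subr0 mulrDl !mulrBr !mulrBl mulrDr mulr1.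
  move: (profile_primitive (m q) T) (profile_primitive (m q) e) (profile_primitive (m q) 0) => A B C.
  move: (m q e * e) (m q T * T) (m q T * e) (T^-1 * T) (T^-1 * e) (d * T) (d * e) (eta * e) => *.
  lra.
move=> t /andP[et tT]; rewrite ler_norml; apply/andP; split.
  by rewrite lerBrDr addrC (le_trans me)// md// et ltW.
by rewrite lerBlDr addrC (le_trans _ h2)// md// tT (le_trans (ltW e0)).
Unshelve. all: by end_near. Qed.

End slope_limit.

Lemma continuous_powR_exponent {R : realType} (a : R) : 0 < a -> continuous (fun x : R => a `^ x).
Proof.
move=> a0; rewrite (_ : (fun x : R => _) = expR \o (fun x : R => x * ln a)).
  move=> x; apply: (@continuous_comp _ _ _ (fun x : R => x * ln a) expR).
    exact: mulrr_continuous.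
  exact: continuous_expR.
by apply/funext => x; rewrite /powR gt_eqF.
Qed.

Lemma cvg_inv_pinfty {R : realType} (f : R -> R) : continuous f -> f q^-1 @[q --> +oo_R] --> f 0.
Proof.
move=> cf; have c1 : (fun q : R => q^-1) q @[q --> +oo_R] --> (0 : R).
  apply/cvgrPdist_lt => e e0; have ei : 0 < e^-1 by rewrite invr_gt0.
  near=> q; have q1 : e^-1 < q by near: q; apply: nbhs_pinfty_gt; exact: num_real.
  have q0 : 0 < q := lt_trans ei q1.
  by rewrite sub0r normrN gtr0_norm ?invr_gt0// -[ltRHS]invrK ltf_pV2 ?posrE.
exact: (@cvg_comp _ _ _ (fun q : R => q^-1) f +oo_R (nbhs (0 : R)) (nbhs (f 0)) c1 (cf 0)).
Unshelve. all: by end_near. Qed.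

(** * Bounds for the eigenvalue and the slope *)

Section bounds.
Context {R : realType} {n : nat} (r p : R).
Hypotheses (n2 : (2 <= n)%N) (pn : n%:R < p) (r0 : 0 < r).
Local Notation mu := (@lebesgue_rV R n).
Local Notation B := (@eball R n r).
Local Notation E := (Ip mu B p).
Local Notation alpha := (@pexponent R n p).
Local Notation T := (r `^ alpha).

Let mB : measurable B. Proof. exact: measurable_eball. Qed.
Let n0 : (0 < n)%N. Proof. exact: ltn_trans n2. Qed.
Let np : 2 <= n%:R :> R. Proof. by rewrite ler_nat. Qed.
Let p2 : 2 <= p. Proof. by move: np pn; lra. Qed.
Let p1 : 1 < p. Proof. by move: np pn; lra. Qed.
Let p0 : 0 < p. Proof. by move: np pn; lra. Qed.
Let pm : 0 < p - 1. Proof. by move: np pn; lra. Qed.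
Let a0 : 0 < alpha. Proof. by have /andP[] := pexponent_itv (R := R) n2 pn. Qed.
Let T0 : 0 < T. Proof. exact: powR_gt0. Qed.
Let Ti : 0 < T^-1. Proof. by rewrite invr_gt0. Qed.
Let nn : 0 < n%:R :> R. Proof. by rewrite ltr0n. Qed.
Let cc : continuous (cst T^-1 : R -> R). Proof. by move=> x; exact: cst_continuous. Qed.

Let a1 : alpha < 1.
Proof. by rewrite /pexponent ltr_pdivrMr// mul1r; move: np; lra. Qed.

Lemma profile_primitive_cst (c t : R) : 0 <= t -> profile_primitive (cst c) t = c * (t + 1).
Proof.
move=> t0; rewrite /profile_primitive Rintegral_cst; last exact: measurable_itv.
have L := @lebesgue_measure_itv R `[-1, t]%R.
rewrite /= lte_fin (lt_le_trans (ltrN10 _) t0) -EFinB opprK in L.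
rewrite -[RHS]/(c * fine (t + 1)%:E); congr (_ * fine _); exact: L.
Qed.

Definition limit_profile : 'rV[R]_n -> R := profile r alpha (cst T^-1).
Definition limit_gradient (x : 'rV[R]_n) : 'rV[R]_n := profile_slope alpha (cst T^-1) x *: x.

Lemma limit_profileE x : limit_profile x = 1 - (enorm x / r) `^ alpha.
Proof.
rewrite /limit_profile /profile !profile_primitive_cst ?powR_ge0//.
rewrite powRM ?enorm_ge0 ?invr_ge0 ?(ltW r0)//.
have -> : (r^-1) `^ alpha = T^-1.
  by rewrite -{1}(powR_inv1 (ltW r0)) -powRrM mulN1r powRN.
have : T^-1 * T = 1 by rewrite mulVf// gt_eqF.
by rewrite !mulrDr; move=> ->; ring.
Qed.

Lemma limit_W01p : W01p B p limit_profile limit_gradient.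
Proof.
apply: (profile_W01p n0 r0 p1 (pexponent_itv n2 pn) (pexponent_cond n2 pn) cc (ltW Ti)).
by move=> t _; rewrite /= ger0_norm// ltW.
Qed.

Lemma enorm_profile_gradient (m : R -> R) (x : 'rV[R]_n) :
  enorm (profile_slope alpha m x *: x) =
  alpha * `|m (enorm x `^ alpha)| * enorm x `^ (alpha - 1).
Proof.
rewrite enormZ /profile_slope normrN normrM [`|alpha * _|]normrM (ger0_norm (ltW a0)).
rewrite [`|_ `^ (alpha - 2)|]ger0_norm ?powR_ge0// -!mulrA; congr (_ * (_ * _)).
(* At the origin both sides vanish: [powR] sends 0 to 0 for every nonzero exponent, in particular
   for alpha - 1 < 0. *)
have [->|x0] := eqVneq (enorm x) 0.
  by congr (_ * _); rewrite mulr0 powR0// subr_eq0 lt_eqF.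
congr (_ * _); rewrite -{2}(powRr1 (enorm_ge0 x)) -powRD; last by rewrite x0 implybT.
by congr powR; ring.
Qed.

Lemma limit_energy V : mu B = V%:E ->
  E (enorm \o limit_gradient) = ((alpha / T) `^ p * (V * (r `^ ((alpha - 1) * p) * (n%:R / alpha))))%:E.
Proof.
move=> VE; have aT : 0 <= alpha / T by apply: divr_ge0; exact: ltW.
have mp : measurable_fun B (fun x : 'rV[R]_n => enorm x `^ (alpha - 1)).
  apply: measurable_funTS.
  exact: (measurableT_comp (measurable_powR (alpha - 1)) (@measurable_enorm R n)).
rewrite (_ : enorm \o _ = fun x : 'rV[R]_n => alpha / T * enorm x `^ (alpha - 1)); last first.
  apply/funext => x; rewrite /= /limit_gradient enorm_profile_gradient /=.
  by rewrite ger0_norm// ltW.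
rewrite Ip_scale ?(ltW p0)// (ger0_norm aT).
rewrite (Ip_enorm_powR n0 r0 (pexponent_cond n2 pn)) [X in (_ * (X * _))%E]VE -!EFinM.
congr (_ * (_ * (_ * _)))%:E.
have H := pexponentE n2 pn.
have -> : (alpha - 1) * p / n%:R + 1 = alpha / n%:R.
  have -> : (alpha - 1) * p = alpha - n%:R by rewrite -[alpha in RHS](subrK 1) -addrA -[1 - _]H; ring.
  by rewrite mulrBl divff ?gt_eqF// subrK.
by rewrite invf_div.
Qed.

(** The limit profile is at least theta on a ball of measure v0, so its L^q norm is at least theta
    v0^(1/q). As v0 depends on theta but not on q, the loss v0^(p / q) tends to 1. *)
Lemma lambda_upper V (theta : R) : mu B = V%:E -> 0 < theta < 1 ->
  exists2 v0 : R, 0 < v0 & forall q lam : R, 1 <= q -> lambda B p q = lam%:E ->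
  lam * (theta `^ p * v0 `^ (p / q)) <=
  (alpha / T) `^ p * (V * (r `^ ((alpha - 1) * p) * (n%:R / alpha))).
Proof.
move=> VE /andP[th0 th1].
(* The radius where the limit profile 1 - (|x| / r)^alpha takes the value theta. *)
pose d := r * (1 - theta) `^ alpha^-1.
have th' : 0 < 1 - theta by rewrite subr_gt0.
have d0 : 0 < d by rewrite mulr_gt0// powR_gt0.
have dr : d <= r.
  rewrite -[leRHS]mulr1; apply: ler_wpM2l; first exact: ltW.
  rewrite -[leRHS](powRr0 (1 - theta)); apply: ger_powR; last by rewrite invr_ge0 ltW.
  by rewrite th'/=; lra.
have [v0 v00 v0E] : exists2 v : R, 0 < v & mu (@eball R n d) = v%:E.
  have := mu_eball_gt0 (n := n) d0; have := mu_eball_fin (n := n) d.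
  by case: (mu _) => [v _|//|//]; rewrite lte_fin; exists v.
exists v0 => // q lam q1 lamE; have q0 : 0 < q by exact: lt_le_trans ltr01 q1.
have mUT : measurable_fun setT limit_profile.
  apply: continuous_measurable_rV => x.
  exact: (@continuous_profile R n r alpha (pexponent_itv n2 pn) _ cc x).
have mU : measurable_fun B limit_profile by exact: measurable_funTS.
have low : ((theta `^ q * v0)%:E <= Ip mu B q limit_profile)%E.
  have md : measurable (@eball R n d) by exact: measurable_eball.
  rewrite EFinM -v0E -integral_cst// IpE.
  apply: (@le_trans _ _ (\int[mu]_(x in @eball R n d) (`|limit_profile x| `^ q)%:E)%E).
    apply: ge0_le_integral => //.
    - by move=> x _; rewrite lee_fin powR_ge0.
    - by apply: measurable_powR_norm; exact: measurable_funTS.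
    move=> x; rewrite /eball /= => xd; rewrite lee_fin.
    have H : theta <= limit_profile x.
      rewrite limit_profileE lerBrDl -lerBrDr.
      have -> : 1 - theta = ((1 - theta) `^ alpha^-1) `^ alpha.
        by rewrite -powRrM mulVf ?gt_eqF// powRr1// ltW.
      apply: ge0_ler_powR; first exact: ltW.
      - by rewrite nnegrE divr_ge0 ?enorm_ge0 ?(ltW r0).
      - by rewrite nnegrE powR_ge0.
      - by rewrite ler_pdivrMr// mulrC ltW.
    apply: ge0_ler_powR; first exact: ltW.
    - by rewrite nnegrE ltW.
    - by rewrite nnegrE.
    - by rewrite (le_trans H)// ler_norm.
  apply: ge0_subset_integral => //.
  - exact: measurable_powR_norm.
  - by move=> x; rewrite /eball /= => /lt_le_trans; exact.
have Uoo : (Ip mu B q limit_profile < +oo)%E.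
  apply: Ip_continuous_lty; first exact: ltW.
  by move=> x; exact: (@continuous_profile R n r alpha (pexponent_itv n2 pn) _ cc x).
have [A AE] : exists A, Ip mu B q limit_profile = A%:E.
  have := Ip_ge0 mu B q limit_profile; move: Uoo.
  by case: (Ip mu B q limit_profile) => [A _ _|//|//]; exists A.
move: low; rewrite AE lee_fin => low.
have tv : 0 < theta `^ q * v0 by rewrite mulr_gt0// powR_gt0.
have A0 : 0 < A by exact: lt_le_trans low.
have := lambda_le p2 q0 A0 limit_W01p AE.
rewrite lamE (limit_energy VE) -EFinM lee_fin; apply: le_trans.
have lam0 : 0 <= lam.
  rewrite -lee_fin -lamE; apply: le_ereal_inf_tmp => _ [uG _ <-]; exact: poweR_ge0.
apply: ler_wpM2l => //.
have -> : theta `^ p * v0 `^ (p / q) = (theta `^ q * v0) `^ (p / q).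
  rewrite powRM ?powR_ge0 ?(ltW v00)// -powRrM; congr (_ `^ _ * _).
  by field; rewrite gt_eqF.
apply: ge0_ler_powR; [by apply: divr_ge0; exact: ltW|exact: (ltW tv)|exact: (ltW A0)|exact: low].
Qed.

(** This makes the upper bound sharp: with the energy of the limit profile in place of lam, and 1 in
    place of 1 - 1/q + V / q, the bound of [extremal_slope_top] equals alpha^-1 (alpha / T) = 1 /
    T. *)
Lemma slope_constant V : 0 < V ->
  r ^+ n / n%:R * ((alpha / T) `^ p * (V * (r `^ ((alpha - 1) * p) * (n%:R / alpha)))) / V =
  (alpha / T) `^ (p - 1).
Proof.
move=> V0; have aT : 0 < alpha / T by rewrite divr_gt0.
have -> : (alpha / T) `^ p = alpha / T * (alpha / T) `^ (p - 1).
  by rewrite mulr_powRB1 ?(ltW aT).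
have rT : r ^+ n * r `^ ((alpha - 1) * p) = T.
  rewrite -powR_mulrn ?(ltW r0)// -powRD; last by rewrite (gt_eqF r0) implybT.
  congr powR; have H := pexponentE n2 pn.
  have -> : (alpha - 1) * p = (alpha - 1) * (p - 1) + (alpha - 1) by ring.
  by rewrite H; ring.
have Tn : T != 0 by rewrite gt_eqF.
transitivity (r ^+ n * r `^ ((alpha - 1) * p) * T^-1 * (alpha / T) `^ (p - 1)).
  move: (r ^+ n) (r `^ ((alpha - 1) * p)) ((alpha / T) `^ (p - 1)) => x y z; field.
  by rewrite !gt_eqF// Tn.
by rewrite rT mulfV// mul1r.
Qed.

(* The factor c^(p-1) = (1 + eta T)^(p-1) = rho * rho is shared between the competitor's
   height theta, with theta^(-p) = rho, and the terms f(1/q) that tend to 1. *)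
Lemma slope_upper (lam : R -> R) (w : R -> R -> R) :
  (forall q, 1 <= q -> [/\ 0 < lam q, lambda B p q = (lam q)%:E,
     positive_extremal B p q (fun x : 'rV[R]_n => w q (enorm x)) &
     measurable_fun B (fun x : 'rV[R]_n => w q (enorm x)) /\
     Ip mu B q (fun x : 'rV[R]_n => w q (enorm x)) = 1%E]) ->
  forall eta, 0 < eta -> \forall q \near +oo_R,
    extremal_slope (n := n) r p q (w q) (lam q) T <= T^-1 + eta.
Proof.
move=> H eta eta0.
have [V V0 VE] : exists2 V : R, 0 < V & mu B = V%:E.
  have := mu_eball_gt0 (n := n) r0; have := mu_eball_fin (n := n) r.
  by case: (mu B) => [v _|//|//]; rewrite lte_fin; exists v.
(* The admissible ratio to the limit slope: c / T = 1 / T + eta. *)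
pose c := 1 + eta * T; have c1 : 1 < c by rewrite ltrDl mulr_gt0.
have c0 : 0 < c by exact: lt_trans ltr01 c1.
have gt1 (y e : R) : 0 < e -> 1 < y -> 1 < y `^ e.
  move=> e0 y1; have y0 : y \is Num.nneg by rewrite nnegrE (le_trans ler01)// ltW.
  have o0 : (1 : R) \is Num.nneg by rewrite nnegrE ler01.
  by have := gt0_ltr_powR e0 o0 y0 y1; rewrite powR1.
pose rho := c `^ ((p - 1) / 2).
have rho1 : 1 < rho by apply: gt1 => //; rewrite divr_gt0.
have rho0 : 0 < rho by exact: lt_trans ltr01 rho1.
pose theta := (rho `^ p^-1)^-1.
have tr1 : 1 < rho `^ p^-1 by apply: gt1 => //; rewrite invr_gt0.
have th : 0 < theta < 1 by rewrite invr_gt0 powR_gt0//= invf_lt1// powR_gt0.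
have thp : theta `^ p = rho^-1.
  rewrite /theta -powR_inv1 ?powR_ge0// -powRrM -powRrM (_ : p^-1 * (-1 * p) = -1) ?powR_inv1 ?(ltW rho0)//.
  by field; rewrite gt_eqF.
have [v0 v00 Hv] := lambda_upper VE th.
(* At x = 1/q this is v0^(-p/q), lost in the norm of the competitor, times the factor 1 - 1/q + V /
   q of the mass bound. *)
pose f (x : R) := (v0 `^ (- p)) `^ x * (1 + (V - 1) * x).
have cf : continuous f.
  move=> x; apply: (@continuousM _ _ _ _ x).
    by apply: continuous_powR_exponent; exact: powR_gt0.
  apply: (@continuousD _ _ _ _ _ x); first exact: cst_continuous.
  exact: mulrl_continuous.
have f0 : f 0 = 1 by rewrite /f powRr0 mulr0 addr0 mulr1.
have := cvg_inv_pinfty cf; rewrite f0 => /cvgrPdist_lt/(_ (rho - 1)).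
rewrite subr_gt0 => /(_ rho1) nf.
have n1 : \forall q \near +oo_R, 1 <= q :> R by exact: nbhs_pinfty_ge.
near=> q.
have q1 : 1 <= q by near: q.
have q0 : 0 < q by exact: lt_le_trans ltr01 q1.
have fq : f q^-1 <= rho.
  have : `|1 - f q^-1| < rho - 1 by near: q.
  by rewrite distrC => /(le_lt_trans (ler_norm _)) h; apply: ltW; move: h; rewrite ltrD2r.
have [l0 lamE ext [mu_ Iu]] := H q q1.
apply: le_trans (extremal_slope_top n2 pn r0 q1 ext l0 mu_ Iu VE) _.
have hl := Hv q (lam q) q1 lamE.
pose K := (alpha / T) `^ p * (V * (r `^ ((alpha - 1) * p) * (n%:R / alpha))).
rewrite -/K in hl.
have vq : v0 `^ (p / q) * (v0 `^ (- p)) `^ q^-1 = 1.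
  rewrite -powRrM -powRD; last by rewrite (gt_eqF v00) implybT.
  by rewrite (_ : p / q + - p / q = 0) ?powRr0// mulNr subrr.
have g0 : 0 <= 1 - q^-1 + V / q.
  rewrite addr_ge0 ?divr_ge0 ?(ltW V0) ?(ltW q0)//.
  by rewrite subr_ge0 invf_le1.
have K0 : 0 <= K.
  apply: mulr_ge0; first exact: powR_ge0.
  apply: mulr_ge0; first exact: ltW.
  by apply: mulr_ge0; [exact: powR_ge0|apply: divr_ge0; exact: ltW].
have vpos : 0 < (v0 `^ (- p)) `^ q^-1 by rewrite !powR_gt0.
have lamK : lam q * (1 - q^-1 + V / q) <= K * (rho * rho).
  have e1 : lam q = lam q * (theta `^ p * v0 `^ (p / q)) * (rho * (v0 `^ (- p)) `^ q^-1).
    rewrite thp; transitivity (lam q * (rho^-1 * rho) * (v0 `^ (p / q) * (v0 `^ (- p)) `^ q^-1)).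
      by rewrite vq mulVf ?gt_eqF// !mulr1.
    by ring.
  rewrite e1.
  have e2 : (v0 `^ (- p)) `^ q^-1 * (1 - q^-1 + V / q) = f q^-1.
    by rewrite /f; congr (_ * _); ring.
  rewrite -mulrA -[rho * _ * _]mulrA e2.
  apply: ler_pM => //.
  - by rewrite !mulr_ge0 ?powR_ge0 ?(ltW l0).
  - by rewrite mulr_ge0 ?(ltW rho0)// -e2 mulr_ge0 ?(ltW vpos).
  - by rewrite ler_wpM2l// ltW.
have rr : rho * rho = c `^ (p - 1).
  rewrite /rho -powRD; last by rewrite (gt_eqF c0) implybT.
  by congr powR; field.
have aT : 0 <= alpha / T by apply: divr_ge0; exact: ltW.
apply: (@le_trans _ _ (alpha^-1 * (((alpha / T) * c) `^ (p - 1)) `^ (p - 1)^-1)).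
  apply: ler_wpM2l; first by rewrite invr_ge0 ltW.
  have rn : 0 <= r ^+ n / n%:R by rewrite divr_ge0 ?exprn_ge0 ?(ltW r0) ?(ltW nn).
  apply: ge0_ler_powR; first by rewrite invr_ge0 ltW.
  - by rewrite nnegrE mulr_ge0// divr_ge0 ?(ltW V0)// mulr_ge0// ltW.
  - by rewrite nnegrE powR_ge0.
  rewrite powRM ?(ltW c0)// -(slope_constant V0) -/K -rr.
  have -> : r ^+ n / n%:R * K / V * (rho * rho) = r ^+ n / n%:R * (K * (rho * rho) / V) by ring.
  by apply: ler_wpM2l => //; rewrite ler_wpM2r// invr_ge0 ltW.
have aTc : 0 <= alpha / T * c by apply: mulr_ge0 => //; exact: ltW.
rewrite -powRrM mulfV ?gt_eqF// (powRr1 aTc).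
rewrite le_eqVlt; apply/orP; left; apply/eqP; rewrite /c.
by field; rewrite !gt_eqF.
Unshelve. all: by end_near. Qed.

(** The profile is at most its value z0 at the centre, so 1 = ||u||_q <= z0 V^(1/q). *)
Lemma profile_lower (q V : R) (m : R -> R) (u : 'rV[R]_n -> R) : 1 <= q -> mu B = V%:E ->
  continuous m -> (forall t, 0 <= m t) ->
  measurable_fun B u -> Ip mu B q u = 1%E ->
  {ae mu, forall x, B x -> u x = profile r alpha m x} ->
  V^-1 `^ q^-1 <= profile_primitive m T - profile_primitive m 0.
Proof.
move=> q1 VE cm m0 mu_ Iu uz; have q0 : 0 < q by exact: lt_le_trans ltr01 q1.
have V0 : 0 < V by have := mu_eball_gt0 (n := n) r0; rewrite VE lte_fin.
set z0 := _ - _.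
have z00 : 0 <= z0 by rewrite subr_ge0 profile_primitive_le// lexx ltW.
have mz : measurable_fun B (profile r alpha m : 'rV[R]_n -> R).
  apply: measurable_funTS; apply: continuous_measurable_rV => x.
  exact: (@continuous_profile R n r alpha (pexponent_itv n2 pn) _ cm x).
have : (Ip mu B q (profile r alpha m : 'rV[R]_n -> R) <= Ip mu B q (cst z0))%E.
  apply: le_Ip => //; first exact: ltW.
  move=> x; rewrite /eball /= => xr.
  have xT : enorm x `^ alpha <= T.
    by apply: ge0_ler_powR; rewrite ?nnegrE ?enorm_ge0 ?(ltW r0) ?(ltW a0) ?(ltW xr).
  have p3 : profile_primitive m 0 <= profile_primitive m (enorm x `^ alpha).
    by apply: profile_primitive_le => //; rewrite lexx powR_ge0.
  have p4 : profile_primitive m (enorm x `^ alpha) <= profile_primitive m T.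
    by apply: profile_primitive_le => //; rewrite powR_ge0.
  have p5 : 0 <= profile r alpha m x by rewrite /profile subr_ge0; exact: p4.
  rewrite (ger0_norm p5) /= (ger0_norm z00) /profile /z0.
  by apply: lerB; [exact: lexx|exact: p3].
rewrite -(Ip_ae_eq mB q mu_ mz uz) Iu IpE (eq_integral (cst (z0 `^ q)%:E)); last first.
  by move=> x _; rewrite /= (ger0_norm z00).
rewrite integral_cst// [X in (_ * X)%E]VE -EFinM lee_fin => H.
have H' : V^-1 <= z0 `^ q by rewrite -[V^-1]mul1r ler_pdivrMr.
rewrite -[leRHS](powRr1 z00) -(mulfV (lt0r_neq0 q0)) powRrM.
by apply: ge0_ler_powR; rewrite ?nnegrE ?powR_ge0 ?invr_ge0 ?(ltW V0) ?(ltW q0).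
Qed.

End bounds.

Lemma norm_le_enorm {R : realType} {n : nat} (x : 'rV[R]_n) : `|x| <= enorm x.
Proof.
rewrite [leLHS]/Num.norm /= mx_normrE; apply/bigmax_leP; split => /=; first exact: enorm_ge0.
by move=> [i j] _ /=; rewrite (ord1 i); exact: coord_le_enorm.
Qed.

Lemma uniform_cvg_norm {R : realType} {V : normedModType R} {n : nat} (A : set 'rV[R]_n)
    (f : R -> 'rV[R]_n -> V) (g : 'rV[R]_n -> V) :
  (forall e, 0 < e -> \forall q \near +oo_R, forall x, A x -> `|g x - f q x| < e) ->
  {uniform A, f @ +oo_R --> g}.
Proof.
move=> H P /uniform_nbhs[E [entE EP]].
move: entE; rewrite -entourage_from_ballE => -[e /= e0 eE].
have := H e e0; apply: filterS => q Hq; apply: EP => y Ay; apply: eE => /=.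
by rewrite -ball_normE; exact: Hq.
Qed.

(** * Convergence of the gradients in L^p *)

Section gradient_limit.
Context {R : realType} {n : nat} (r p : R).
Hypotheses (n2 : (2 <= n)%N) (pn : n%:R < p) (r0 : 0 < r).
Local Notation mu := (@lebesgue_rV R n).
Local Notation B := (@eball R n r).
Local Notation E := (Ip mu B p).
Local Notation alpha := (@pexponent R n p).
Local Notation T := (r `^ alpha).

Let mB : measurable B. Proof. exact: measurable_eball. Qed.
Let n0 : (0 < n)%N. Proof. exact: ltn_trans n2. Qed.
Let np : 2 <= n%:R :> R. Proof. by rewrite ler_nat. Qed.
Let p0 : 0 < p. Proof. by move: np pn; lra. Qed.
Let a0 : 0 < alpha. Proof. by have /andP[] := pexponent_itv (R := R) n2 pn. Qed.
Let T0 : 0 < T. Proof. exact: powR_gt0. Qed.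
Let Ti : 0 < T^-1. Proof. by rewrite invr_gt0. Qed.

Lemma profile_gradientB (m : R -> R) (x : 'rV[R]_n) :
  enorm (profile_slope alpha m x *: x - limit_gradient r p x) =
  alpha * `|m (enorm x `^ alpha) - T^-1| * enorm x `^ (alpha - 1).
Proof.
rewrite -(enorm_profile_gradient n2 pn (fun t => m t - T^-1)) /limit_gradient -scalerBl.
by congr (enorm (_ *: _)); rewrite /profile_slope /=; ring.
Qed.

Let mpow : measurable_fun B (fun x : 'rV[R]_n => enorm x `^ (alpha - 1)).
Proof.
apply: measurable_funTS.
exact: (measurableT_comp (measurable_powR (alpha - 1)) (@measurable_enorm R n)).
Qed.

(** Absolute continuity of the integral of |x|^((alpha - 1) p), by dominated convergence along the
    balls of radius 1 / (k + 1). *)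
Let small_ball (e : R) : 0 < e -> exists2 d : R, 0 < d &
  (E (fun x : 'rV[R]_n => enorm x `^ (alpha - 1) * \1_(@eball R n d) x)%R <= e%:E)%E.
Proof.
move=> e0; pose g (k : nat) (x : 'rV[R]_n) := enorm x `^ (alpha - 1) * \1_(@eball R n k.+1%:R^-1) x.
have mg k : measurable_fun B (g k).
  by apply: measurable_funM => //; apply: measurable_indic; exact: measurable_eball.
have : E (g k) @[k --> \oo] --> 0%E.
  apply: (cvg_Ip_dominated mB p0 mg mpow).
  - have ae0 : {ae mu, forall x : 'rV[R]_n, x != 0}.
      exists [set 0]; split; [|exact: mu_set0_eq0 n0 r0|].
        rewrite (_ : [set 0] = setT `&` @enorm R n @^-1` [set 0]).
          by apply: measurable_enorm => //; exact: measurable_set1.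
        by apply/seteqP; split => x /=; [move=> ->; rewrite enorm0|move=> [_ /eqP]; rewrite enorm_eq0 => /eqP].
      by move=> x /= /negP; rewrite negbK => /eqP.
    apply: filterS ae0 => x; rewrite -enorm_gt0 => x0 _.
    apply/cvgrPdist_lt => d d0; near=> k.
    rewrite /g indicE memNset ?mulr0 ?subrr ?normr0// /eball /=; apply/negP; rewrite -leNgt ltW//.
    near: k; exact: (near_infty_natSinv_lt (PosNum x0)).
  - apply: aeW => x k _; rewrite /g normrM ger0_norm ?powR_ge0// ler_piMr ?powR_ge0//.
    by rewrite indicE; case: (_ \in _); rewrite ?normr1 ?normr0.
  - exact: (Ip_enorm_powR_lty n0 r0 (pexponent_cond n2 pn)).
rewrite cvge0P; last by move=> k; exact: Ip_ge0.
move=> /(_ e e0) [k _ /(_ k (leqnn k)) H].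
by exists k.+1%:R^-1.
Unshelve. all: by end_near. Qed.

(** The slopes are uniformly close to 1 / T only away from 0. Near 0 they are merely bounded, but
    the weight |x|^((alpha - 1) p) is integrable, so a small ball contributes little. *)
Lemma gradient_limit (m : R -> R -> R) :
  (\forall q \near +oo_R, continuous (m q) /\ forall t, 0 <= t <= T -> 0 <= m q t <= T^-1 + 1) ->
  (forall e eta, 0 < e <= T -> 0 < eta ->
    \forall q \near +oo_R, forall t, e <= t <= T -> `|m q t - T^-1| <= eta) ->
  E (fun x : 'rV[R]_n => enorm (profile_slope alpha (m q) x *: x - limit_gradient r p x))
    @[q --> +oo_R] --> 0%E.
Proof.
move=> Hm Hl; rewrite cvge0P; last by move=> q; exact: Ip_ge0.
move=> e e0.
have [K KE K0] : exists2 K, E (fun x : 'rV[R]_n => enorm x `^ (alpha - 1)) = K%:E & 0 <= K.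
  have := Ip_ge0 mu B p (fun x : 'rV[R]_n => enorm x `^ (alpha - 1)).
  have := Ip_enorm_powR_lty n0 r0 (pexponent_cond n2 pn).
  by case: (E _) => [K _|//|//]; rewrite lee_fin; exists K.
(* C bounds |m - 1 / T|, both terms lying in [0, C]. With A the constant of [Ip_add], the energy (e
   / 2) / D allowed on the small ball and the choice (alpha eta)^p = s make each of the two parts at
   most e / 2. *)
pose C := T^-1 + 1; have C0 : 0 < C by rewrite addr_gt0.
pose A := 2 `^ p; have A0 : 0 < A by rewrite powR_gt0.
pose D := A * (alpha * C) `^ p; have D0 : 0 < D by apply: mulr_gt0 => //; apply: powR_gt0; exact: mulr_gt0.
have e2 : 0 < e / 2 by rewrite divr_gt0.
have [d d0 Hd] := small_ball (divr_gt0 e2 D0).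
pose s := e / 2 / (A * (K + 1)).
have K1 : 0 < K + 1 by rewrite ltr_wpDl.
have s0 : 0 < s by rewrite /s divr_gt0// mulr_gt0.
pose eta := s `^ p^-1 / alpha.
have eta0 : 0 < eta by apply: divr_gt0 => //; exact: powR_gt0.
have etaE : (alpha * eta) `^ p = s.
  by rewrite /eta mulrC divfK ?gt_eqF// -powRrM mulVf ?gt_eqF// powRr1// ltW.
pose eps := Num.min T (d `^ alpha).
have eps0 : 0 < eps <= T by rewrite lt_min T0 powR_gt0//= ge_min lexx.
have Hl' := Hl eps eta eps0 eta0.
near=> q.
have [cm mb] : continuous (m q) /\ forall t, 0 <= t <= T -> 0 <= m q t <= T^-1 + 1 by near: q.
have ml : forall t, eps <= t <= T -> `|m q t - T^-1| <= eta by near: q.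
have mE : measurable_fun B (fun x : 'rV[R]_n => enorm (profile_slope alpha (m q) x *: x - limit_gradient r p x)).
  under eq_fun do rewrite profile_gradientB.
  apply: measurable_funM => //; apply: measurable_funM => //.
  apply: measurableT_comp => //; apply: measurable_funB => //.
  apply: measurable_funTS; apply: (measurableT_comp (continuous_measurable_fun cm)).
  exact: (measurableT_comp (measurable_powR alpha) (@measurable_enorm R n)).
have m1 : measurable_fun B (fun x : 'rV[R]_n => alpha * eta * enorm x `^ (alpha - 1)).
  exact: measurable_funM.
have m3 : measurable_fun B (fun x : 'rV[R]_n => enorm x `^ (alpha - 1) * \1_(@eball R n d) x).
  by apply: measurable_funM => //; apply: measurable_indic; exact: measurable_eball.
have m2 : measurable_fun B (fun x : 'rV[R]_n => alpha * C * (enorm x `^ (alpha - 1) * \1_(@eball R n d) x)).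
  exact: measurable_funM.
have H12 (x : 'rV[R]_n) : B x ->
    `|enorm (profile_slope alpha (m q) x *: x - limit_gradient r p x)| <=
    `|alpha * eta * enorm x `^ (alpha - 1)| +
    `|alpha * C * (enorm x `^ (alpha - 1) * \1_(@eball R n d) x)|.
  rewrite {1}/eball /= => xr; rewrite profile_gradientB.
  have P0 : 0 <= enorm x `^ (alpha - 1) by exact: powR_ge0.
  have xT : enorm x `^ alpha <= T.
    by apply: ge0_ler_powR; [exact: ltW|exact: enorm_ge0|exact: (ltW r0)|exact: ltW].
  have tT : 0 <= enorm x `^ alpha <= T by rewrite powR_ge0.
  have a0' : 0 <= alpha by exact: ltW.
  have g1 : 0 <= alpha * `|m q (enorm x `^ alpha) - T^-1| * enorm x `^ (alpha - 1).
    by apply: mulr_ge0 => //; exact: mulr_ge0.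
  have g2 : 0 <= alpha * eta * enorm x `^ (alpha - 1).
    by apply: mulr_ge0 => //; apply: mulr_ge0 => //; exact: ltW.
  have g3 : 0 <= alpha * C * (enorm x `^ (alpha - 1) * \1_(@eball R n d) x).
    apply: mulr_ge0; first by apply: mulr_ge0 => //; exact: ltW.
    by apply: mulr_ge0 => //; rewrite indicE; case: (_ \in _); rewrite ?ler01.
  rewrite (ger0_norm g1) (ger0_norm g2) (ger0_norm g3).
  rewrite indicE; case: (boolP (x \in eball d)) => xd.
    rewrite mulr1 -[leLHS]add0r; apply: lerD; first exact: g2.
    apply: ler_wpM2r => //; apply: ler_wpM2l => //.
    have /andP[mb1 mb2] := mb _ tT.
    by rewrite ler_norml /C; apply/andP; split; move: Ti mb1 mb2; lra.
  rewrite !mulr0 addr0; apply: ler_wpM2r => //; apply: ler_wpM2l => //.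
  apply: ml; rewrite xT andbT ge_min; apply/orP; right.
  move: xd; rewrite notin_setE /eball /= => /negP; rewrite -leNgt => dx.
  by apply: ge0_ler_powR; [exact: ltW|exact: (ltW d0)|exact: enorm_ge0|].
apply: (le_trans (Ip_add mu mB (ltW p0) m1 m2 mE H12)).
rewrite !Ip_scale ?(ltW p0)// KE.
rewrite [`|alpha * eta|]ger0_norm; last by apply: mulr_ge0; exact: ltW.
rewrite [`|alpha * C|]ger0_norm; last by apply: mulr_ge0; exact: ltW.
rewrite etaE -EFinM.
apply: (@le_trans _ _ (A%:E * ((s * K)%:E + ((alpha * C) `^ p)%:E * (e / 2 / D)%:E))%E).
  apply: lee_wpmul2l; first by rewrite lee_fin ltW.
  apply: leeD => //; apply: lee_wpmul2l => //; by rewrite lee_fin powR_ge0.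
have -> : (A%:E * ((s * K)%:E + ((alpha * C) `^ p)%:E * (e / 2 / D)%:E) =
  (A * (s * K + (alpha * C) `^ p * (e / 2 / D)))%:E)%E by [].
rewrite lee_fin mulrDr.
have -> : A * ((alpha * C) `^ p * (e / 2 / D)) = e / 2.
  by rewrite mulrA -/D mulrC divfK// gt_eqF.
have : A * (s * K) <= e / 2.
  have -> : e / 2 = A * (s * (K + 1)).
    have AK : A * (K + 1) != 0 by rewrite gt_eqF// mulr_gt0.
    by rewrite mulrCA /s divfK.
  by apply: ler_wpM2l; [exact: ltW|apply: ler_wpM2l; [exact: ltW|rewrite lerDl]].
by lra.
Unshelve. all: by end_near. Qed.

End gradient_limit.

(** * The three convergences *)

Unset Implicit Arguments.

Theorem corollary2p12 (R : realType) (N : nat) (p r : R) (w : R -> R -> R)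
    (N_ge2 : (2 <= N)%N) (p_gtN : N%:R < p) (r_gt0 : 0 < r)
    (w_extremal : forall q : R, 1 <= q ->
      positive_extremal (@eball R N r) p q (fun x => w q (enorm x))) :
  exists v : R -> 'rV[R]_N -> R,
    (forall q : R, 1 <= q ->
      continuous_rep (@eball R N r) (fun x => w q (enorm x)) (v q)) /\
    let U := fun x : 'rV[R]_N =>
      1 - (enorm x / r) `^ ((p - N%:R) / (p - 1)) in
    [/\ cvg_C (eball r) v U,
        cvg_W01p (eball r) p v U
      & forall e : R, 0 < e < r -> cvg_C1 (annulus e r) v U].
Proof.
have al := pexponent_itv (R := R) N_ge2 p_gtN.
set alpha := @pexponent R N p in al.
have a0 : 0 < alpha by case/andP : al.
pose T := r `^ alpha; have T0 : 0 < T by exact: powR_gt0.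
have Ti : 0 < T^-1 by rewrite invr_gt0.
have N2 : 2 <= N%:R :> R by rewrite ler_nat.
have p1 : 1 < p by move: N2 p_gtN; lra.
have p0 : 0 < p by exact: lt_trans ltr01 p1.
have mB : measurable (@eball R N r) by exact: measurable_eball.
have [V V0 VE] : exists2 V : R, 0 < V & lebesgue_rV N (@eball R N r) = V%:E.
  have := mu_eball_gt0 (n := N) r_gt0; have := mu_eball_fin (n := N) r.
  by case: (lebesgue_rV N _) => [v _|//|//]; rewrite lte_fin; exists v.
(* The premise 1 <= q is kept under the existential, so that lam, and with it the slopes, are
   functions on all reals. *)
have /choice[lam Hlam] q : exists lam : R, 1 <= q -> [/\ 0 < lam,
    lambda (@eball R N r) p q = lam%:E,
    measurable_fun (@eball R N r) (fun x => w q (enorm x)) /\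
      Ip (lebesgue_rV N) (@eball R N r) q (fun x => w q (enorm x)) = 1%E,
    W01p (@eball R N r) p (profile r alpha (extremal_slope (n := N) r p q (w q) lam))
      (fun x : 'rV[R]_N => profile_slope alpha (extremal_slope (n := N) r p q (w q) lam) x *: x) &
    {ae lebesgue_rV N, forall x, @eball R N r x ->
      w q (enorm x) = profile r alpha (extremal_slope (n := N) r p q (w q) lam) x}].
  have [q1|q1] := leP 1 q; last by exists 0.
  by have [lam H] := extremal_profile N_ge2 p_gtN r_gt0 q1 (w_extremal q q1); exists lam.
pose m q := extremal_slope (n := N) r p q (w q) (lam q).
(* The profile is the continuous representative; [G q] serves both as its weak gradient and, away
   from 0, as its classical one. *)
pose v q : 'rV[R]_N -> R := profile r alpha (m q).
pose G q (x : 'rV[R]_N) := profile_slope alpha (m q) x *: x.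
have cm q : 1 <= q -> continuous (m q).
  move=> q1; have [l0 _ [mu_ Iu] _ _] := Hlam q q1.
  exact: (continuous_extremal_slope N_ge2 p_gtN r_gt0 q1 (w_extremal q q1) l0 mu_ Iu).
have m0 q t : 0 <= m q t by exact: extremal_slope_ge0.
have md q : 1 <= q -> forall s t, 0 <= s <= t -> m q s <= m q t.
  move=> q1 s t; have [l0 _ [mu_ Iu] _ _] := Hlam q q1.
  exact: (extremal_slope_le N_ge2 p_gtN r_gt0 q1 (w_extremal q q1) l0 mu_ Iu).
have cv q : 1 <= q -> continuous (v q).
  by move=> q1 x; exact: (@continuous_profile R N r alpha al (m q) (cm q q1) x).
have n1 : \forall q \near +oo_R, 1 <= q :> R by exact: nbhs_pinfty_ge.
have mT : forall eta, 0 < eta -> \forall q \near +oo_R, m q T <= T^-1 + eta.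
  apply: (slope_upper N_ge2 p_gtN r_gt0) => q q1.
  by have [l0 lE mI _ _] := Hlam q q1; split => //; exact: w_extremal.
have lower : forall eta, 0 < eta -> \forall q \near +oo_R,
    1 - eta <= profile_primitive (m q) T - profile_primitive (m q) 0.
  move=> eta eta0; have Vi : 0 < V^-1 by rewrite invr_gt0.
  have := cvg_inv_pinfty (continuous_powR_exponent Vi).
  rewrite powRr0 => /cvgrPdist_lt/(_ eta eta0) nV; near=> q.
  have q1 : 1 <= q by near: q.
  have [_ _ [mu_ Iu] _ uz] := Hlam q q1.
  apply: le_trans (profile_lower N_ge2 p_gtN r_gt0 q1 VE (cm q q1) (m0 q) mu_ Iu uz).
  have : `|1 - V^-1 `^ q^-1| < eta by near: q.
  by move=> /(le_lt_trans (ler_norm _)) h; rewrite lerBlDr -lerBlDl ltW.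
have slope : forall e eta, 0 < e <= T -> 0 < eta ->
    \forall q \near +oo_R, forall t, e <= t <= T -> `|m q t - T^-1| <= eta.
  apply: (slope_limit T0) => //.
  by apply: filterS n1 => q q1; split; [exact: cm|exact: m0|exact: md].
have mb : \forall q \near +oo_R, continuous (m q) /\ forall t, 0 <= t <= T -> 0 <= m q t <= T^-1 + 1.
  near=> q; have q1 : 1 <= q by near: q.
  have h : m q T <= T^-1 + 1 by near: q; exact: mT.
  split; first exact: cm.
  move=> t tT; apply/andP; split; first exact: m0.
  exact: le_trans (md q q1 t T tT) h.
have UE : (fun x : 'rV[R]_N => 1 - (enorm x / r) `^ ((p - N%:R) / (p - 1))) = limit_profile r p.
  by apply/funext => x; rewrite limit_profileE.
have cU : continuous (@limit_profile R N r p).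
  have cc : continuous (cst T^-1 : R -> R) by move=> x; exact: cst_continuous.
  by move=> x; exact: (@continuous_profile R N r alpha al _ cc x).
have unif : forall eta, 0 < eta -> \forall q \near +oo_R, forall x : 'rV[R]_N,
    enorm x <= r -> `|v q x - limit_profile r p x| <= eta.
  move=> eta eta0; pose M := T^-1 + 1.
  have M0 : 0 < M + T^-1 by rewrite !addr_gt0.
  have eta2 : 0 < eta / 2 by rewrite divr_gt0.
  pose d := eta / 2 / T; have d0 : 0 < d by rewrite divr_gt0.
  (* The choices of d and e make each of the two terms T d and e (M + 1 / T) of [profile_gap] at
     most eta / 2. *)
  pose e := Num.min T (eta / 2 / (M + T^-1)).
  have e0 : 0 < e <= T by rewrite lt_min T0 ge_min lexx/= andbT divr_gt0.
  have nd := slope e d e0 d0.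
  near=> q.
  have [cq bq] : continuous (m q) /\ forall t, 0 <= t <= T -> 0 <= m q t <= M by near: q.
  have dq : forall t, e <= t <= T -> `|m q t - T^-1| <= d by near: q.
  move=> x xr.
  have tT : 0 <= enorm x `^ alpha <= T.
    rewrite powR_ge0/=.
    by apply: ge0_ler_powR; [exact: ltW|exact: enorm_ge0|exact: (ltW r_gt0)|].
  have gap := profile_gap T0 cq e0 (ltW d0) dq bq tT.
  have -> : v q x - limit_profile r p x = profile_primitive (m q) T -
      profile_primitive (m q) (enorm x `^ alpha) - T^-1 * (T - enorm x `^ alpha).
    rewrite /v /limit_profile /profile -/alpha -/T !profile_primitive_cst ?powR_ge0//.
    by rewrite -mulrBr; congr (_ - _ * _); rewrite opprD addrACA subrr addr0.
  apply: (le_trans gap).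
  have -> : T * d = eta / 2 by rewrite /d mulrC divfK ?gt_eqF.
  have : e * (M + T^-1) <= eta / 2 by rewrite -ler_pdivlMr// ge_min lexx orbT.
  by lra.
have gradv q x : 1 <= q -> x != 0 -> grad (v q) x = G q x.
  by move=> q1 x0; have := @grad_profile R N r alpha (m q) (cm q q1) x x0.
exists v; split => [q q1|].
  split; first exact: continuous_subspaceT (cv q q1).
  by have [_ _ _ _ uz] := Hlam q q1; apply: filterS uz => x ux Bx; rewrite ux.
rewrite UE; split.
- split; [by move=> q q1; exact: continuous_subspaceT (cv q q1)|exact: continuous_subspaceT|].
  apply: uniform_cvg_norm => e e0; have e2 : 0 < e / 2 by rewrite divr_gt0.
  apply: filterS (unif _ e2) => q Hq x /closure_eball xr.
  by rewrite distrC (le_lt_trans (Hq x xr))//; move: e0; lra.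
- exists G, (limit_gradient r p); split.
  + by move=> q q1; have [] := Hlam q q1.
  + exact: limit_W01p.
  + apply/(Lp_norm_cvg0 r p1 (F := +oo_R)); rewrite cvge0P; last by move=> q; exact: Ip_ge0.
    (* On a ball of measure V the uniform bound d contributes at most d^p V = e. *)
    move=> e e0; pose d := (e / V) `^ p^-1.
    have d0 : 0 < d by rewrite powR_gt0// divr_gt0.
    have nd := unif d d0; near=> q.
    have q1 : 1 <= q by near: q.
    have dq : forall x : 'rV[R]_N, enorm x <= r -> `|v q x - limit_profile r p x| <= d by near: q.
    have mv : measurable_fun (@eball R N r) (v q \- limit_profile r p).
      by apply: measurable_funTS; apply: measurable_funB; apply: continuous_measurable_rV => //; exact: cv.
    have md' : measurable_fun (@eball R N r) (cst d) by exact: measurable_cst.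
    apply: (le_trans (le_Ip (lebesgue_rV N) mB (ltW p0) mv md' _)).
      by move=> x /ltW xr /=; rewrite (ger0_norm (ltW d0)) dq.
    rewrite IpE (eq_integral (cst (d `^ p)%:E)); last first.
      by move=> x _; rewrite /= (ger0_norm (ltW d0)).
    rewrite integral_cst// [X in (_ * X)%E]VE -EFinM lee_fin /d -powRrM mulVf ?gt_eqF//.
    by rewrite powRr1 ?divfK ?gt_eqF// divr_ge0// ltW.
  + apply/(Lp_norm_cvg0 r p1 (F := +oo_R)).
    exact: (gradient_limit N_ge2 p_gtN r_gt0 mb slope).
move=> e /andP[e0 er]; exists G, (limit_gradient r p).
have nz x : closure (@annulus R N e r) x -> x != 0.
  by move=> /closure_annulus/andP[ex _]; rewrite -enorm_gt0 (lt_le_trans e0).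
have nz' x : annulus e r x -> x != 0.
  by rewrite /annulus /= => /andP[ex _]; rewrite -enorm_gt0 (lt_trans e0).
have cc : continuous (cst T^-1 : R -> R) by move=> x; exact: cst_continuous.
split.
- move=> q q1; split.
  + move=> x /nz' x0; split; last exact: gradv.
    by have := @differentiable_profile R N r alpha (m q) (cm q q1) x x0.
  + exact: continuous_subspaceT (cv q q1).
  + apply: continuous_in_subspaceT => x; rewrite inE => /nz x0.
    by have := @continuous_profile_gradient R N alpha (m q) (cm q q1) x x0.
- split.
  + move=> x /nz' x0; split; last by have := @grad_profile R N r alpha (cst T^-1) cc x x0.
    by have := @differentiable_profile R N r alpha (cst T^-1) cc x x0.
  + exact: continuous_subspaceT.
  + apply: continuous_in_subspaceT => x; rewrite inE => /nz x0.
    by have := @continuous_profile_gradient R N alpha (cst T^-1) cc x x0.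
- apply: uniform_cvg_norm => d d0; have d2 : 0 < d / 2 by rewrite divr_gt0.
  apply: filterS (unif _ d2) => q Hq x /closure_annulus/andP[_ xr].
  by rewrite distrC (le_lt_trans (Hq x xr))//; move: d0; lra.
- apply: uniform_cvg_norm => d d0.
  (* As alpha <= 1, the weight |x|^(alpha - 1) is largest on the inner sphere |x| = e, so c bounds
     the factor of the slope difference on the whole annulus. *)
  pose c := alpha * e `^ (alpha - 1).
  have c0 : 0 < c by rewrite mulr_gt0// powR_gt0.
  have eT : 0 < e `^ alpha <= T.
    rewrite powR_gt0//=; apply: ge0_ler_powR; [exact: ltW|exact: (ltW e0)|exact: (ltW r_gt0)|exact: ltW].
  have d2 : 0 < d / 2 / c by rewrite !divr_gt0.
  apply: filterS (slope _ _ eT d2) => q Hq x /closure_annulus/andP[ex xr].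
  rewrite distrC (le_lt_trans (norm_le_enorm _))//.
  rewrite /G (profile_gradientB r N_ge2 p_gtN).
  have x0 : 0 < enorm x by exact: lt_le_trans ex.
  have Hx : `|m q (enorm x `^ alpha) - T^-1| <= d / 2 / c.
    apply: Hq; apply/andP; split.
      by apply: ge0_ler_powR; [exact: ltW|exact: (ltW e0)|exact: (ltW x0)|].
    by apply: ge0_ler_powR; [exact: ltW|exact: (ltW x0)|exact: (ltW r_gt0)|].
  have Hp : enorm x `^ (alpha - 1) <= e `^ (alpha - 1).
    have P y : y `^ (alpha - 1) = (y `^ (1 - alpha))^-1 by rewrite -powRN opprB.
    have a1 : 0 <= 1 - alpha by rewrite subr_ge0; case/andP : al.
    rewrite !P lef_pV2; [|by rewrite posrE powR_gt0|by rewrite posrE powR_gt0].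
    by apply: ge0_ler_powR; [exact: a1|exact: (ltW e0)|exact: (ltW x0)|].
  apply: (@le_lt_trans _ _ (d / 2 / c * c)); last first.
    by rewrite divfK ?gt_eqF//; move: d0; lra.
  have -> : d / 2 / c * c = alpha * (d / 2 / c) * e `^ (alpha - 1).
    by rewrite {2}/c mulrA [_ * alpha]mulrC.
  apply: ler_pM; last exact: Hp.
  - by apply: mulr_ge0 => //; exact: ltW.
  - exact: powR_ge0.
  - by apply: ler_wpM2l; [exact: ltW|exact: Hx].
Unshelve. all: by end_near. Qed.
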